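(* Let $K$ be an algebraically closed field of characteristic zero. The number of Eckardt points of a smooth cubic surface in $\mathbb{P}^3_K$ can only be $0,1,2,3,4,6,9,10$ or $18$. Moreover, if $S$ is a smooth cubic surface with exactly $n$ Eckardt points, then $S$ is projectively equivalent to a cubic surface of the family $\mathcal{S}e_n$ defined in the context, and the singular locus of $\mathcal{S}e_n$ is given by $\Sigma_n$ (that is, a member of $\mathcal{S}e_n$ is singular if and only if $\Sigma_n$ vanishes at its parameters).
   Context: $K$ is an algebraically closed field of characteristic zero; $[x,y,z,t]$ are homogeneous coordinates on $\mathbb{P}^3_K$; two surfaces are projectively equivalent if an element of $\mathrm{PGL}_4(K)$ maps one to the other. A smooth cubic surface contains exactly $27$ lines. A point of a smooth cubic surface $S$ is an Eckardt point if it is the intersection of three (necessarily coplanar) lines of $S$. For $b,c,d,e,f\in K$ with $c\neq 0$ let $S_{b,c,d,e,f}$ be the cubic surface $$bc(t-x)(xz+yt)+c^{2}(z+t)(xz-yt)-cd(y-z)(xz+yt)+c(e+f)(x-y)(xz-yt)-ef(2x^{2}y-2xy^{2}+xz^{2}-xzt+yzt-yt^{2})=0 .$$ Let $$\begin{aligned}\Sigma_0 ={}& c(c-f)(-c+e)(c+f)(c+e)(-e+f)(-cd+cf+ef)(-cd+ce+ef)\\ &\cdot(-c^{2}-cd+ef)(bc-cf+ef)(bc-ce+ef)(bc-cd+2ef)(bc-c^{2}+ef)\\ &\cdot(bc^{2}+c^{2}d+bcf-2c^{2}f-cdf+2ef^{2})(bc^{2}+c^{2}d+bce-2c^{2}e-cde+2e^{2}f)\\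 &\cdot(-bc^{3}-2bc^{2}d+c^{3}d+bc^{2}e+c^{2}de+bc^{2}f+c^{2}df+3bcef-4c^{2}ef-3cdef+4e^{2}f^{2}).\end{aligned}$$ The families are obtained from $S_{b,c,d,e,f}$ by imposing the following conditions $\Lambda_n$ on the parameters (only parameter values for which the denominators do not vanish are considered), where $\sqrt{-3},\sqrt5\in K$ are fixed square roots: - $\mathcal{S}e_0$: no condition; - $\mathcal{S}e_1$: $\Lambda_1=\{b=-(c^2+ef)/c\}$; - $\mathcal{S}e_2$: $\Lambda_2=\Lambda_1\cup\{d=(c^2+ef)/c\}$; - $\mathcal{S}e_3$: $\Lambda_3=\Lambda_1\cup\{d=(3ef-c^2+cf+ce)/(2c)\}$; - $\mathcal{S}e_4$: $\Lambda_4=\Lambda_3\cup\{f=c(3c-e)/(c+e)\}$; - $\mathcal{S}e_6$: $\Lambda_6=\Lambda_3\cup\{f=-c(5c+e)/(c+e)\}$; - $\mathcal{S}e_9$: $\Lambda_9=\Lambda_3\cup\{e=\sqrt{-3}\,c\}$; - $\mathcal{S}e_{10}$: $\Lambda_{10}=\Lambda_4\cup\{e=(2-\sqrt5)c\}$; - $\mathcal{S}e_{18}$: $\Lambda_{18}=\Lambda_4\cup\{e=\sqrt{-3}\,c\}$. $\Sigma_n$ denotes the result of substituting the conditions $\Lambda_n$ into $\Sigma_0$ (for $n=10,18$ the surface does not depend on the remaining parameter $c\neq 0$, and $\Sigma_n$ does not vanish for $c\neq0$). *)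

(* Defs.v *)
From HB Require Import structures.
From mathcomp Require Import all_boot all_order all_algebra.
From mathcomp Require Import mpoly.

Set Implicit Arguments.
Unset Strict Implicit.
Unset Printing Implicit Defensive.

Import GRing.Theory.
Local Open Scope ring_scope.

(* The points, lines and planes of P^3_K are the subspaces of K^4 of dimension
   1, 2 and 3, so that equality of points of P^3 is Leibniz equality in
   {vspace 'rV[K]_4}. A cubic surface is given by a cubic form in K[x,y,z,t]. *)
Section CubicSurfaces.
Variable K : fieldType.
Implicit Types (F G : {mpoly K[4]}) (v : 'rV[K]_4) (P L : {vspace 'rV[K]_4}).

Definition vanishes F v : Prop := F.@[v ord0] = 0.

Definition cubic_form F : Prop := F != 0 /\ F \is 3.-homog.

Definition singular F : Prop :=
  exists v, [/\ v != 0, vanishes F v & forall i : 'I_4, vanishes F^`M(i) v].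

Definition smooth_cubic F : Prop := cubic_form F /\ ~ singular F.

Definition is_point P : Prop := \dim P = 1%N.

Definition line_on F L : Prop :=
  \dim L = 2%N /\ (forall v, v \in L -> vanishes F v).

Definition Eckardt_point F P : Prop :=
  is_point P /\
  exists L1 L2 L3,
    [/\ [/\ line_on F L1, line_on F L2 & line_on F L3],
        [/\ L1 != L2, L1 != L3 & L2 != L3]
      & P = (L1 :&: L2 :&: L3)%VS].

Definition num_Eckardt_points F (n : nat) : Prop :=
  exists s : seq {vspace 'rV[K]_4},
    [/\ uniq s, size s = n & forall P, P \in s <-> Eckardt_point F P].

(* An invertible matrix carries the zero locus of F onto that of G. *)
Definition proj_equiv F G : Prop :=
  exists2 M : 'M[K]_4, M \in unitmx &
    forall v, vanishes F v <-> vanishes G (v *m M).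

End CubicSurfaces.

Record params (K : Type) := Params { pb : K; pc : K; pd : K; pe : K; pf : K }.

Section Families.
Variable K : fieldType.
Implicit Types p : params K.

Definition cubicS p : {mpoly K[4]} :=
  let: Params b c d e f := p in
  let x : {mpoly K[4]} := 'X_(0 : 'I_4) in
  let y : {mpoly K[4]} := 'X_(1 : 'I_4) in
  let z : {mpoly K[4]} := 'X_(2 : 'I_4) in
  let t : {mpoly K[4]} := 'X_(3 : 'I_4) in
    (b * c) *: ((t - x) * (x * z + y * t))
  + (c ^+ 2) *: ((z + t) * (x * z - y * t))
  - (c * d) *: ((y - z) * (x * z + y * t))
  + (c * (e + f)) *: ((x - y) * (x * z - y * t))
  - (e * f) *: (2 * x ^+ 2 * y - 2 * x * y ^+ 2 + x * z ^+ 2 - x * z * t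
                + y * z * t - y * t ^+ 2).

Definition Sigma0 p : K :=
  let: Params b c d e f := p in
  c * (c - f) * (- c + e) * (c + f) * (c + e) * (- e + f)
  * (- c * d + c * f + e * f) * (- c * d + c * e + e * f)
  * (- c ^+ 2 - c * d + e * f) * (b * c - c * f + e * f)
  * (b * c - c * e + e * f) * (b * c - c * d + 2 * e * f)
  * (b * c - c ^+ 2 + e * f)
  * (b * c ^+ 2 + c ^+ 2 * d + b * c * f - 2 * c ^+ 2 * f - c * d * f
     + 2 * e * f ^+ 2)
  * (b * c ^+ 2 + c ^+ 2 * d + b * c * e - 2 * c ^+ 2 * e - c * d * e
     + 2 * e ^+ 2 * f)
  * (- b * c ^+ 3 - 2 * b * c ^+ 2 * d + c ^+ 3 * d + b * c ^+ 2 * e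
     + c ^+ 2 * d * e + b * c ^+ 2 * f + c ^+ 2 * d * f + 3 * b * c * e * f
     - 4 * c ^+ 2 * e * f - 3 * c * d * e * f + 4 * e ^+ 2 * f ^+ 2).

(* The conditions Lambda_n as substitutions. When Lambda_n adds a condition to
   Lambda_m, the new condition is substituted first: the values assigned by
   Lambda_m are expressions in the parameter it determines. *)
Definition Lambda1 p : params K :=
  let: Params _ c d e f := p in
  Params (- (c ^+ 2 + e * f) / c) c d e f.

Definition Lambda2 p : params K :=
  let: Params b c _ e f := p in
  Lambda1 (Params b c ((c ^+ 2 + e * f) / c) e f).

Definition Lambda3 p : params K :=
  let: Params b c _ e f := p in
  Lambda1
    (Params b c ((3 * e * f - c ^+ 2 + c * f + c * e) / (2 * c)) e f).

Definition Lambda4 p : params K :=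
  let: Params b c d e _ := p in
  Lambda3 (Params b c d e (c * (3 * c - e) / (c + e))).

Definition Lambda6 p : params K :=
  let: Params b c d e _ := p in
  Lambda3 (Params b c d e (- c * (5 * c + e) / (c + e))).

(* In the next three, s3 and s5 stand for square roots of -3 and of 5. *)
Definition Lambda9 (s3 : K) p : params K :=
  let: Params b c d _ f := p in Lambda3 (Params b c d (s3 * c) f).

Definition Lambda10 (s5 : K) p : params K :=
  let: Params b c d _ f := p in Lambda4 (Params b c d ((2 - s5) * c) f).

Definition Lambda18 (s3 : K) p : params K :=
  let: Params b c d _ f := p in Lambda4 (Params b c d (s3 * c) f).

Definition Eckardt_numbers : seq nat := [:: 0; 1; 2; 3; 4; 6; 9; 10; 18]%N.

(* The default branch is n = 0; n outside Eckardt_numbers is never used. *)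
Definition Lambda (s3 s5 : K) (n : nat) p : params K :=
  match n with
  | 1 => Lambda1 p
  | 2 => Lambda2 p
  | 3 => Lambda3 p
  | 4 => Lambda4 p
  | 6 => Lambda6 p
  | 9 => Lambda9 s3 p
  | 10 => Lambda10 s5 p
  | 18 => Lambda18 s3 p
  | _ => p
  end%N.

(* c <> 0 and the denominators in Lambda_n do not vanish. No Lambda_n changes
   c, and c + e occurs as a denominator only after e has its final value. *)
Definition admissible (s3 s5 : K) (n : nat) p : Prop :=
  let q := Lambda s3 s5 n p in
  pc q != 0 /\ (n \in [:: 4; 6; 10; 18]%N -> pc q + pe q != 0).

Definition Se (s3 s5 : K) (n : nat) p : {mpoly K[4]} :=
  cubicS (Lambda s3 s5 n p).

Definition Sigma (s3 s5 : K) (n : nat) p : K := Sigma0 (Lambda s3 s5 n p).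

End Families.

(* Main.v *)
(* A cubic form is treated as a symmetric trilinear form a, so that v is singular
   when a(v,v,.) = 0, and v is an Eckardt point when its polar quadric a(v,.,.)
   is the product of the tangent plane at v and another plane, the mirror of a
   harmonic homology.

   A smooth surface contains a line: some point has a degenerate polar quadric,
   hence a cuspidal tangent section, and elimination finds a line through that
   section. The planes through a line have a discriminant of degree 5 in which a
   double root produces a singular point; so there are enough tritangent planes
   to find an L-set, and its basis gives the equation of the general family.

   If all the homologies commute, there are at most two Eckardt points; they can
   be taken as intersection points of lines of the L-set, and this gives the
   conditions Lambda_1 and Lambda_2. Otherwise two non-commuting homologies
   generate a group isomorphic to S_3, and coordinates p, q, s, r exist in which
   the equation is pq(p + q + l(s,r)) + g(s,r) = 0. Splitting g gives the family
   Se_3. All the Eckardt points of such a surface are explicit: if l = 0, it is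
   the Fermat surface with 18 of them, and if l = z the form g can be reduced, in
   the cases with more than three Eckardt points, to ga z^3 + z t^2 (4 or 10),
   z^2 t + 8 z t^2 + eta t^3 (6) or ga z^3 + t^3 (9 or 18).

   For the singular members, the discriminant of the planes through the line
   x = y = 0 of the general family is mn(m - n) L_e L_f with explicit linear forms
   L_e, L_f. The surface is singular outside this line exactly when there is a
   double root, and the other factors of Sigma_0 are the conditions for a
   singular point on the line. *)
Require Import Defs.
From HB Require Import structures.
From mathcomp Require Import all_boot all_order all_algebra.
From mathcomp Require Import mpoly.
From mathcomp Require Import separable ring zify.
From Stdlib Require Import Classical.
Import GRing.Theory.
Local Open Scope ring_scope.
Set Implicit Arguments.
Unset Strict Implicit.
Unset Printing Implicit Defensive.

(** * Cubic forms as symmetric trilinear forms *)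

(** The first two claims come from a single statement, [Se_classified]: a smooth form has a complete
    list of Eckardt points, and it has the equation of a member of the family indexed by the length
    of that same list. As the number of Eckardt points is unique, nothing is ever counted on the
    families themselves. Completeness of the lists rests on rank: at an Eckardt point the matrix of
    the polar quadric is a product of two linear forms, and comparing entries leaves finitely many
    explicit candidates. Conversely each listed point comes with the second linear factor. Existence
    arguments by dimension count are replaced by eliminants with computed leading coefficients. The
    members found all have [c = 1]. There Se_3 is governed by h = (1+e)(1+f) and k = (1-e)(1-f):
    Se_4 is h = 4, Se_6 is h = -4, Se_10 is (h, k) = (4, -4) and Se_18 is (4, 4). This explains the
    constants of the conditions. In the record, linearity in one argument is enough because the two
    transpositions generate all permutations. *)

Record triform (K : fieldType) := Triform {
  tri :> 'rV[K]_4 -> 'rV[K]_4 -> 'rV[K]_4 -> K;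
  tri_linear : forall v w, scalar (fun u => tri u v w);
  triC12 : forall u v w, tri u v w = tri v u w;
  triC23 : forall u v w, tri u v w = tri u w v }.

Definition cub (K : fieldType) (a : triform K) v := a v v v.

Section TriformTheory.
Variables (K : fieldType) (a : triform K).
Implicit Types (u v w : 'rV[K]_4) (c : K).

Lemma triDl u u' v w : a (u + u') v w = a u v w + a u' v w.
Proof. by have := tri_linear a v w 1 u u'; rewrite scale1r mul1r. Qed.

Lemma tri0l v w : a 0 v w = 0.
Proof. by apply: (addrI (a 0 v w)); rewrite -triDl !addr0. Qed.

Lemma triZl c u v w : a (c *: u) v w = c * a u v w.
Proof. by have := tri_linear a v w c u 0; rewrite !addr0 tri0l addr0. Qed.

Lemma triDm u v v' w : a u (v + v') w = a u v w + a u v' w.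
Proof. by rewrite !(triC12 a u) triDl. Qed.

Lemma triZm c u v w : a u (c *: v) w = c * a u v w.
Proof. by rewrite !(triC12 a u) triZl. Qed.

Lemma triDr u v w w' : a u v (w + w') = a u v w + a u v w'.
Proof. by rewrite (triC23 a u v (w + w')) triDm !(triC23 a u _ v). Qed.

Lemma triZr c u v w : a u v (c *: w) = c * a u v w.
Proof. by rewrite (triC23 a u v (c *: w)) triZm (triC23 a u w). Qed.

Lemma triNl u v w : a (- u) v w = - a u v w.
Proof. by rewrite -scaleN1r triZl mulN1r. Qed.

Lemma triNm u v w : a u (- v) w = - a u v w.
Proof. by rewrite -scaleN1r triZm mulN1r. Qed.

Lemma triNr u v w : a u v (- w) = - a u v w.
Proof. by rewrite -scaleN1r triZr mulN1r. Qed.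

Lemma tri0m u w : a u 0 w = 0. Proof. by rewrite triC12 tri0l. Qed.
Lemma tri0r u v : a u v 0 = 0. Proof. by rewrite triC23 tri0m. Qed.

Definition triE := (triDl, triDm, triDr, triNl, triNm, triNr, triZl, triZm,
  triZr, tri0l, tri0m, tri0r).

Lemma triC13 u v w : a u v w = a w v u.
Proof. by rewrite triC12 triC23 triC12. Qed.

Lemma cubD u v :
  cub a (u + v) = cub a u + 3 * a u u v + 3 * a u v v + cub a v.
Proof.
rewrite /cub !triE (triC12 a v u u) (triC23 a u v u) (triC12 a v u v).
rewrite (triC23 a v v u) (triC12 a v u v); ring.
Qed.

Lemma cubZ c v : cub a (c *: v) = c ^+ 3 * cub a v.
Proof. rewrite /cub !triE; ring. Qed.

Lemma cubN v : cub a (- v) = - cub a v.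
Proof. rewrite /cub !triE; ring. Qed.

(** Polarization: as 6 is invertible, the values of the cubic determine the trilinear form, so that
    vanishing on a subspace passes from [cub a] to [a]. *)
Lemma polar21 u v : cub a (u + v) - cub a (u - v) - 2 * cub a v = 6 * a u u v.
Proof. rewrite !cubD cubN !triE; ring. Qed.

Lemma polar12 u v : cub a (u + v) + cub a (u - v) - 2 * cub a u = 6 * a u v v.
Proof. rewrite !cubD cubN !triE; ring. Qed.

Lemma polar111 u v w :
  cub a (u + v + w) - cub a (u + v) - cub a (u + w) - cub a (v + w)
  + cub a u + cub a v + cub a w = 6 * a u v w.
Proof. rewrite !cubD !triE (triC12 a v u w); ring. Qed.

Definition sing := exists2 v, v != 0 & forall u, a v v u = 0.

(* The section by the tangent plane at [v] is a cone with vertex [v], that is,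
   three concurrent lines. *)
Definition Eck v :=
  [/\ v != 0, cub a v = 0 & forall u, a v v u = 0 -> a v u u = 0].

End TriformTheory.

Section FromPolynomial.
Variable K : fieldType.
Hypothesis charK : [pchar K] =i pred0.
Implicit Types (F G : {mpoly K[4]}) (v : 'rV[K]_4).

Lemma natS_neq0 n : n.+1%:R != 0 :> K.
Proof. by have /pcharf0P -> := charK. Qed.

Lemma mderiv_homog n (R : nzRingType) d (G : {mpoly R[n]}) i :
  G \is d.+1.-homog -> G^`M(i) \is d.-homog.
Proof.
move=> hG; rewrite [G]mpolyE raddf_sum /= big_seq.
apply: rpred_sum => m mG; rewrite mderivZ mderivX; apply: rpredZ.
have [->|mi0] := eqVneq (m i) 0%N; first by rewrite scale0r rpred0.
apply: rpredZ; rewrite dhomogX /=.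
have le_im : (U_(i) <= m)%MM.
  by apply/mnm_lepP => j; rewrite mnm1E; case: eqP => // <-; rewrite lt0n.
have := congr1 mdeg (submK le_im); rewrite mdegD mdeg1 addn1.
by rewrite (dhomog_mf hG mG) => -[->].
Qed.

Lemma Euler_homog n (R : comNzRingType) d (G : {mpoly R[n]}) :
  G \is d.-homog -> \sum_i 'X_i * G^`M(i) = d%:R *: G.
Proof.
move=> hG; rewrite [in RHS](mpolyE G) scaler_sumr [in LHS](mpolyE G).
under eq_bigr => i _ do rewrite raddf_sum /= mulr_sumr.
rewrite exchange_big /= big_seq [RHS]big_seq; apply: eq_bigr => m mG.
rewrite -(dhomog_mf hG mG) /= mdegE natr_sum scalerA mulr_suml scaler_suml.
apply: eq_bigr => i _; rewrite mderivZ mderivX -!scalerAr scalerA mulrC.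
have [->|mi0] := eqVneq (m i) 0%N; first by rewrite !(mul0r, scale0r).
rewrite -mpolyXD addmC submK; first by rewrite mulrC.
by apply/mnm_lepP => j; rewrite mnm1E; case: eqP => // <-; rewrite lt0n.
Qed.

Lemma meval_homog0 n (R : comNzRingType) (G : {mpoly R[n]}) (v w : 'I_n -> R) :
  G \is 0.-homog -> G.@[v] = G.@[w].
Proof.
move=> hG; rewrite !mevalE !big_seq; apply: eq_bigr => m mG; congr (_ * _).
have /eqP := dhomog_mf hG mG; rewrite mdeg_eq0 => /eqP ->.
by apply: eq_bigr => i _; rewrite mnm0E !expr0.
Qed.

(** The third partial derivatives of a cubic form are constants, here evaluated at 0; divided by 6
    they are the coefficients of its polarization. Euler's identity in degrees 3, 2 and 1 recovers
    the form and its gradient. *)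
Lemma triform_of_homog F : F \is 3.-homog ->
  {a : triform K | forall v, F.@[v ord0] = cub a v /\
    forall i, F^`M(i).@[v ord0] = 3 * a v v (delta_mx 0 i)}.
Proof.
move=> hF; pose c i j k := F^`M(i)^`M(j)^`M(k).@[(0 : 'rV[K]_4) ord0].
pose t (u v w : 'rV[K]_4) := 6^-1 *
  \sum_i \sum_j \sum_k u ord0 i * v ord0 j * w ord0 k * c i j k.
have t_lin v w : scalar (fun u => t u v w).
  move=> x u u' /=; rewrite /t mulrCA -[RHS]mulrDr; congr (_ * _); rewrite mulr_sumr -big_split /=.
  apply: eq_bigr => i _; rewrite mulr_sumr -big_split /=; apply: eq_bigr => j _.
  rewrite mulr_sumr -big_split /=; apply: eq_bigr => k _ /=; rewrite !mxE; ring.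
have t12 u v w : t u v w = t v u w.
  rewrite /t exchange_big; congr (_ * _).
  apply: eq_bigr => i _; apply: eq_bigr => j _; apply: eq_bigr => k _.
  by rewrite /c [F^`M(_)^`M(_)]mderiv_comm [v _ _ * _]mulrC.
have t23 u v w : t u v w = t u w v.
  rewrite /t; congr (_ * _); apply: eq_bigr => i _; rewrite exchange_big /=.
  apply: eq_bigr => j _; apply: eq_bigr => k _.
  by rewrite /c [in LHS]mderiv_comm; congr (_ * _); rewrite mulrAC.
exists (Triform t_lin t12 t23) => v.
have Eul d (G : {mpoly K[4]}) : G \is d.-homog ->
    \sum_i v ord0 i * G^`M(i).@[v ord0] = d%:R * G.@[v ord0].
  move=> hG; rewrite -mevalZ -(Euler_homog hG) raddf_sum /=.
  by apply: eq_bigr => i _; rewrite mevalM mevalXU.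
have n2 : 2 != 0 :> K by exact: (natS_neq0 1).
have n3 : 3 != 0 :> K by exact: (natS_neq0 2).
have D1 i : F^`M(i).@[v ord0] =
    2^-1 * \sum_j \sum_k v ord0 j * v ord0 k * c i j k.
  apply: (mulfI n2); rewrite mulVKf // -(Eul 2%N) ?mderiv_homog //.
  apply: eq_bigr => j _; have := Eul 1%N (F^`M(i)^`M(j)).
  rewrite mul1r => <-; last by rewrite !mderiv_homog.
  rewrite mulr_sumr; apply: eq_bigr => k _; rewrite mulrA; congr (_ * _).
  by apply: meval_homog0; rewrite !mderiv_homog.
have e6 : 6 = 3 * 2 :> K by ring.
split=> [|i].
  apply: (mulfI n3); rewrite -(Eul 3%N) // /cub /= /t e6 invfM -mulrA mulVKf //.
  rewrite [RHS]mulr_sumr; apply: eq_bigr => i _; rewrite D1 mulrCA; congr (_ * _).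
  rewrite [LHS]mulr_sumr; apply: eq_bigr => j _; rewrite mulr_sumr.
  by apply: eq_bigr => k _; rewrite !mulrA.
rewrite /= t23 t12 D1 /t e6 invfM -mulrA mulVKf // [in RHS](bigD1 i) //= [X in _ + X]big1 ?addr0.
  congr (_ * _); apply: eq_bigr => j _; apply: eq_bigr => k _.
  by rewrite mxE !eqxx mul1r.
move=> j ji; rewrite big1 // => k _; rewrite big1 // => l _.
by rewrite mxE (negPf ji) andbF !mul0r.
Qed.
End FromPolynomial.

(** * Subspaces of K^4 *)

Section BinaryForms.
Variable K : closedFieldType.
Implicit Types (x y c : K).

Lemma binary_form_root n (c : nat -> K) : (0 < n)%N ->
  exists x y, (x != 0) || (y != 0) /\
    c n * x ^+ n + \sum_(i < n) c i * x ^+ i * y ^+ (n - i) = 0.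
Proof.
move=> n_gt0; have [cn0|cn0] := eqVneq (c n) 0.
  exists 1, 0; rewrite oner_eq0; split=> //; rewrite cn0 mul0r add0r big1 // => i _.
  by rewrite expr0n subn_eq0 leqNgt ltn_ord mulr0.
have [x Dx] := @solve_monicpoly K n (fun i => - c i / c n) n_gt0.
exists x, 1; rewrite oner_eq0 orbT; split=> //.
rewrite Dx mulr_sumr -big_split /= big1 // => i _.
by rewrite expr1n; field.
Qed.

Lemma quadratic_root c0 c1 c2 : exists x y, (x != 0) || (y != 0) /\
  c2 * x ^+ 2 + c1 * x * y + c0 * y ^+ 2 = 0.
Proof.
have [x [y [nz e]]] := @binary_form_root 2 (nth 0 [:: c0; c1; c2]) isT.
exists x, y; split=> //; rewrite -[RHS]e !big_ord_recr big_ord0 /=; ring.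
Qed.

Lemma cubic_root c0 c1 c2 c3 : exists x y, (x != 0) || (y != 0) /\
  c3 * x ^+ 3 + c2 * x ^+ 2 * y + c1 * x * y ^+ 2 + c0 * y ^+ 3 = 0.
Proof.
have [x [y [nz e]]] := @binary_form_root 3 (nth 0 [:: c0; c1; c2; c3]) isT.
exists x, y; split=> //; rewrite -[RHS]e !big_ord_recr big_ord0 /=; ring.
Qed.

End BinaryForms.

Section Subspaces.
Variable K : fieldType.
Local Notation V := 'rV[K]_4.
Implicit Types (u v w b : V) (L M U : {vspace V}).

Definition comb b1 b2 b3 b4 (x y z t : K) :=
  x *: b1 + y *: b2 + z *: b3 + t *: b4.

(** Independence is stated with four explicit scalars so that changes of coordinates become
    identities for [ring]; spanning follows by dimension. *)
Definition basis4 b1 b2 b3 b4 := forall x y z t,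
  comb b1 b2 b3 b4 x y z t = 0 -> [/\ x = 0, y = 0, z = 0 & t = 0].

Lemma dim_rV4 : \dim {:V} = 4%N.
Proof. by rewrite dimvf /dim /= mul1n. Qed.

Lemma basis4_free b1 b2 b3 b4 : basis4 b1 b2 b3 b4 -> free [:: b1; b2; b3; b4].
Proof.
move=> B; apply/(freeP (X := [tuple b1; b2; b3; b4])) => k; rewrite !big_ord_recl big_ord0 /=.
rewrite addr0 !addrA => /B[e1 e2 e3 e4] i.
have : (i == ord0) || (i == lift ord0 ord0) || (i == lift ord0 (lift ord0 ord0))
  || (i == lift ord0 (lift ord0 (lift ord0 ord0))).
  by case: i => -[|[|[|[|]]]].
by do 3?[case/orP]; move=> /eqP ->.
Qed.

Lemma basis4_span b1 b2 b3 b4 : basis4 b1 b2 b3 b4 ->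
  forall v, exists x y z t, v = comb b1 b2 b3 b4 x y z t.
Proof.
move=> /basis4_free F v.
have /eqP full : <<[:: b1; b2; b3; b4]>>%VS == fullv.
  by rewrite eqEdim subvf dim_rV4 (eqnP F).
have : v \in <<[:: b1; b2; b3; b4]>>%VS by rewrite full memvf.
rewrite !span_cons span_nil addv0.
case/memv_addP=> _ /vlineP[x ->] [_ /memv_addP[_ /vlineP[y ->]
  [_ /memv_addP[_ /vlineP[z ->] [_ /vlineP[t ->] ->]] ->]] ->].
by exists x, y, z, t; rewrite /comb !addrA.
Qed.

Lemma comb_neq0 b1 b2 b3 b4 x y z t : basis4 b1 b2 b3 b4 ->
  [|| x != 0, y != 0, z != 0 | t != 0] -> comb b1 b2 b3 b4 x y z t != 0.
Proof. by move=> B; apply: contraL => /eqP/B[-> -> -> ->]; rewrite eqxx. Qed.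

Lemma lin2_neq0 (u w : V) (x y : K) : free [:: u; w] ->
  (x != 0) || (y != 0) -> x *: u + y *: w != 0.
Proof.
move=> /(freeP (X := [tuple u; w])) F; apply: contraL => /eqP e.
have := F (fun i => nth 0 [:: x; y] i); rewrite !big_ord_recl big_ord0 /= addr0.
by move=> /(_ e) k0; have /= -> := k0 ord0; have := k0 (inord 1);
  rewrite inordK // => /= ->; rewrite eqxx.
Qed.

Lemma linear_kernel (phi : V -> K) : scalar phi ->
  {U : {vspace V} | forall v, (v \in U) = (phi v == 0) &
     (3 <= \dim U)%N /\ ((exists v, phi v != 0) -> \dim U = 3%N)}.
Proof.
move=> lin; pose c : 'cV[K]_4 := \col_i phi (delta_mx 0 i).
have phiE v : phi v = (v *m c) 0 0.
  have phiD x u w : phi (x *: u + w) = x * phi u + phi w := lin x u w.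
  have phi0 : phi 0 = 0.
    by have := phiD (-1) 0 0; rewrite scaler0 addr0 mulN1r addNr.
  rewrite [v in LHS]row_sum_delta !mxE.
  elim/big_rec2: _ => [|i y x _ <-]; first by rewrite phi0.
  by rewrite phiD mxE.
pose f : 'Hom(V, 'rV[K]_1) := linfun (mulmxr c).
have memf v : (v \in lker f) = (phi v == 0).
  rewrite memv_ker lfunE /= phiE; apply/eqP/eqP => [->|e]; first by rewrite mxE.
  by apply/matrixP => i j; rewrite !ord1 e mxE.
have := limg_ker_dim f fullv; rewrite capfv dim_rV4 => dimf.
have le1 : (\dim (f @: fullv) <= 1)%N.
  by rewrite (leq_trans (dimvS (subvf _))) // dimvf /dim /=.
move: dimf le1; set d1 := \dim (lker f); set d2 := \dim (f @: fullv) => dimf le1.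
exists (lker f) => //; rewrite -/d1; split; first by lia.
case=> v; rewrite -memf => nv; suff : d2 != 0%N by lia.
rewrite dimv_eq0; apply: contra nv => /eqP f0; rewrite memv_ker -memv0 -f0.
by rewrite memv_img ?memvf.
Qed.

Lemma dim2_basis L u : \dim L = 2%N -> u \in L -> u != 0 ->
  exists2 w, free [:: u; w] & L = <<[:: u; w]>>%VS.
Proof.
move=> dL uL u0.
have /subvPn[w wL wu] : ~~ (L <= <[u]>)%VS.
  by apply/negP => /dimvS; rewrite dim_vline u0 dL.
have F : free [:: u; w].
  rewrite (perm_free (permEl (perm_catC [:: u] [:: w]))) /= free_cons span_seq1 wu.
  by rewrite seq1_free u0.
exists w => //; apply/eqP; rewrite eq_sym eqEdim (eqnP F) dL leqnn andbT.
by apply/span_subvP => x; rewrite !inE => /orP[] /eqP ->.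
Qed.

Lemma mem_span2 u w v :
  reflect (exists x y, v = x *: u + y *: w) (v \in <<[:: u; w]>>%VS).
Proof.
rewrite span_cons span_seq1; apply: (iffP memv_addP).
  by case=> _ /vlineP[x ->] [_ /vlineP[y ->] ->]; exists x, y.
case=> x [y ->]; exists (x *: u); first by rewrite memvZ ?memv_line.
by exists (y *: w); first by rewrite memvZ ?memv_line.
Qed.

Lemma subspace_extend L U : (L <= U)%VS -> \dim U = (\dim L).+1 ->
  exists2 w, w \in U & w \notin L /\ U = (L + <[w]>)%VS.
Proof.
move=> LU dU; have /subvPn[w wU wL] : ~~ (U <= L)%VS.
  by apply/negP => /dimvS; rewrite dU ltnn.
exists w => //; split=> //; apply/eqP; rewrite eq_sym eqEdim subv_add LU /= dU.
rewrite -memvE wU /= ltnNge; apply: contra wL => le_d.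
suff /eqP -> : L == (L + <[w]>)%VS by rewrite memvE addvSr.
by rewrite eqEdim addvSl.
Qed.

(** Grassmann's formula; it serves for two lines in a plane and for a line and a plane in space. *)
Lemma lines_meet L M U : (L <= U)%VS -> (M <= U)%VS ->
  (\dim U < \dim L + \dim M)%N -> exists2 v, v != 0 & (v \in L) && (v \in M).
Proof.
move=> LU MU dU; have := dimv_sum_cap L M.
have : (\dim (L + M) <= \dim U)%N by apply: dimvS; rewrite subv_add LU.
have [z0|nz _ _] := eqVneq (L :&: M)%VS 0%VS.
  by rewrite z0 dimv0; lia.
by exists (vpick (L :&: M)); rewrite ?vpick0 // -memv_cap memv_pick.
Qed.

Lemma lines_join L M U : (L <= U)%VS -> (M <= U)%VS -> \dim L = 2%N ->
  \dim M = 2%N -> \dim U = 3%N -> L != M -> (L + M)%VS = U.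
Proof.
move=> LU MU dL dM dU LM; apply/eqP; rewrite eqEdim subv_add LU MU /= dU.
rewrite ltnNge; apply: contra LM => le_d.
have /eqP eL : L == (L + M)%VS by rewrite eqEdim addvSl dL.
have /eqP -> : M == (L + M)%VS by rewrite eqEdim addvSr dM.
by rewrite -eL.
Qed.

Lemma same_line L M u v : \dim L = 2%N -> \dim M = 2%N -> free [:: u; v] ->
  u \in L -> v \in L -> u \in M -> v \in M -> L = M.
Proof.
move=> dL dM F uL vL uM vM.
have eqL N : \dim N = 2%N -> u \in N -> v \in N -> <<[:: u; v]>>%VS = N.
  move=> dN uN vN; apply/eqP; rewrite eqEdim (eqnP F) dN leqnn andbT.
  by apply/span_subvP => x; rewrite !inE => /orP[] /eqP ->.
by rewrite -(eqL L) // (eqL M).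
Qed.

Lemma free2P u v : u != 0 -> reflect (forall c : K, v != c *: u) (free [:: u; v]).
Proof.
move=> u0; rewrite (perm_free (permEl (perm_catC [:: u] [:: v]))) /= free_cons span_seq1.
rewrite seq1_free u0 andbT; apply: (iffP idP) => [nv c|nv].
  by apply: contra nv => /eqP ->; rewrite memvZ ?memv_line.
by apply/vlineP => -[c e]; have := nv c; rewrite e eqxx.
Qed.

End Subspaces.

(** * Tritangent planes *)

Section Smooth.
Variables (K : closedFieldType) (a : triform K).
Hypothesis charK : [pchar K] =i pred0.
Local Notation V := 'rV[K]_4.
Implicit Types (u v w b : V) (L M U : {vspace V}).

Let natK n : n.+1%:R != 0 :> K := natS_neq0 charK n.

Lemma polar_vanish U : (forall v, v \in U -> cub a v = 0) ->
  forall u v w, u \in U -> v \in U -> w \in U -> a u v w = 0.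
Proof.
move=> z u v w uU vU wU; apply: (mulfI (natK 5)).
by rewrite -polar111 !z ?memvD // mulr0; ring.
Qed.

(** If [U] is tangent along [L], only one condition remains for a singular point, [a v v n = 0] with
    [n] outside [U]; on [L] it is a binary quadratic form, which has a root. *)
Lemma sing_flag U L : \dim U = 3%N -> \dim L = 2%N ->
  (forall v u, v \in L -> u \in U -> a v v u = 0) -> sing a.
Proof.
move=> dU dL z.
have [n _ [_ fullE]] := @subspace_extend K U fullv (subvf _) (etrans (dim_rV4 K) (esym (congr1 S dU))).
have L0 : vpick L != 0 by rewrite vpick0 -dimv_eq0 dL.
have [w F LE] := dim2_basis dL (memv_pick L) L0.
set u := vpick L in F LE.
have [x [y [nz e]]] := quadratic_root (a w w n) (2 * a u w n) (a u u n).
exists (x *: u + y *: w); first exact: lin2_neq0.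
move=> r; have : r \in (U + <[n]>)%VS by rewrite -fullE memvf.
case/memv_addP=> r1 r1U [_ /vlineP[c ->] ->]; rewrite triDr triZr z //; last first.
  by rewrite LE; apply/mem_span2; exists x, y.
rewrite !triE (triC12 a w u) add0r -[RHS](mulr0 c) -[in RHS]e; ring.
Qed.

Definition sline L := \dim L = 2%N /\ forall v, v \in L -> cub a v = 0.

Lemma sline_tangent L u v : sline L -> u \in L -> v \in L -> a v v u = 0.
Proof. by case=> _ z uL vL; apply: (polar_vanish z). Qed.

Definition tritan U L1 L2 L3 :=
  [/\ \dim U = 3%N, [/\ sline L1, sline L2 & sline L3],
      [/\ (L1 <= U)%VS, (L2 <= U)%VS & (L3 <= U)%VS],
      [/\ L1 != L2, L1 != L3 & L2 != L3]
    & forall v, v \in U -> cub a v = 0 -> [\/ v \in L1, v \in L2 | v \in L3]].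

Lemma tritan_swap23 U L1 L2 L3 : tritan U L1 L2 L3 -> tritan U L1 L3 L2.
Proof.
case=> dU [s1 s2 s3] [U1 U2 U3] [n12 n13 n23] z; split=> //.
  by split=> //; rewrite eq_sym.
by move=> v vU /(z v vU) [] vL; [constructor 1 | constructor 3 | constructor 2].
Qed.

Lemma tritan_swap12 U L1 L2 L3 : tritan U L1 L2 L3 -> tritan U L2 L1 L3.
Proof.
case=> dU [s1 s2 s3] [U1 U2 U3] [n12 n13 n23] z; split=> //.
  by split=> //; rewrite eq_sym.
by move=> v vU /(z v vU) [] vL; [constructor 2 | constructor 1 | constructor 3].
Qed.

Hypothesis smooth : ~ sing a.

Lemma tangent_plane v : v != 0 ->
  exists2 U, \dim U = 3%N & forall u, (u \in U) = (a v v u == 0).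
Proof.
move=> v0; have [|U memU [_ dU]] := @linear_kernel K (a v v).
  by move=> c u w; rewrite triDr triZr.
exists U => //; apply: dU; have [U3|U4] := leqP (\dim U) 3; last first.
  case: smooth; exists v => // u; apply/eqP; rewrite -memU.
  suff -> : U = fullv by rewrite memvf.
  by apply/eqP; rewrite eqEdim subvf dim_rV4.
have /subvPn[u _] : ~~ (fullv <= U)%VS.
  by apply/negP => /dimvS; rewrite dim_rV4 leqNgt ltnS U3.
by rewrite memU => nu; exists u.
Qed.

Lemma sub_line_dim2 U : (2 <= \dim U)%N -> exists2 L, (L <= U)%VS & \dim L = 2%N.
Proof.
move=> dU; have U0 : vpick U != 0 by rewrite vpick0 -dimv_eq0; lia.
have /subvPn[w wU wu] : ~~ (U <= <[vpick U]>)%VS.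
  by apply/negP => /dimvS; rewrite dim_vline U0; lia.
exists (<<[:: vpick U; w]>>)%VS.
  by apply/span_subvP => x; rewrite !inE => /orP[] /eqP -> //; exact: memv_pick.
apply/eqnP; rewrite -[2%N]/(size [:: vpick U; w]); apply/(free2P _ U0) => c.
by apply: contra wu => /eqP ->; rewrite memvZ ?memv_line.
Qed.

Lemma no_plane U : \dim U = 3%N -> ~ forall v, v \in U -> cub a v = 0.
Proof.
move=> dU z; have [|L LU dL] := @sub_line_dim2 U; first by rewrite dU.
apply/smooth/(sing_flag dU dL) => v u vL uU.
by apply: (polar_vanish z) => //; apply: (subvP LU).
Qed.

(** A factor vanishing on all of [U] would put the plane in the surface, and two factors with the
    same zero line would make [U] tangent along it; smoothness excludes both, so the three lines
    exist and are distinct. *)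
Lemma tritan_of_factors U (l1 l2 l3 : V -> K) : \dim U = 3%N ->
  scalar l1 -> scalar l2 -> scalar l3 ->
  (forall v, v \in U -> cub a v = l1 v * l2 v * l3 v) ->
  exists L1 L2 L3, tritan U L1 L2 L3 /\
    forall v, [/\ (v \in L1) = (v \in U) && (l1 v == 0),
      (v \in L2) = (v \in U) && (l2 v == 0)
      & (v \in L3) = (v \in U) && (l3 v == 0)].
Proof.
move=> dU s1 s2 s3 fU.
have dimL l : scalar l -> (forall v, v \in U -> l v = 0 -> cub a v = 0) ->
    {L | \dim L = 2%N & forall v, (v \in L) = (v \in U) && (l v == 0)}.
  move=> sl z; have [H memH [d3 dH]] := linear_kernel sl.
  exists (U :&: H)%VS; last by move=> v; rewrite memv_cap memH.
  have := dimv_sum_cap U H; have := dimvS (subvf (U + H)); rewrite dim_rV4 dU.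
  have : (\dim (U :&: H) != 3)%N.
    apply/eqP => d3'; apply: (no_plane dU) => v vU.
    have /eqP eU : (U :&: H)%VS == U by rewrite eqEdim capvSl dU d3'.
    by apply: z => //; apply/eqP; rewrite -memH; move: vU; rewrite -{1}eU memv_cap => /andP[].
  have := dimvS (capvSl U H); rewrite dU.
  set i := \dim (U :&: H); set j := \dim (U + H); set k := \dim H in d3 *; lia.
have [|L1 d1 m1] := dimL l1 s1.
  by move=> v vU e; rewrite fU // e !mul0r.
have [|L2 d2 m2] := dimL l2 s2.
  by move=> v vU e; rewrite fU // e mulr0 mul0r.
have [|L3 d3 m3] := dimL l3 s3.
  by move=> v vU e; rewrite fU // e mulr0.
exists L1, L2, L3; split; last by move=> v; rewrite m1 m2 m3.
have lD (l : V -> K) u v : scalar l -> l (u + v) = l u + l v.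
  by move=> sl; have := sl 1 u v; rewrite scale1r mul1r.
have l0 (l : V -> K) : scalar l -> l 0 = 0.
  by move=> sl; have := sl (-1) 0 0; rewrite scaler0 addr0 mulN1r addNr.
have lN (l : V -> K) v : scalar l -> l (- v) = - l v.
  by move=> sl; apply/eqP; rewrite -addr_eq0 -lD // addNr l0.
(* A line on which two of the factors vanish is double in the section, hence falls under
   [sing_flag]. *)
have sep L (l l' l'' : V -> K) : scalar l -> scalar l' -> scalar l'' -> \dim L = 2%N ->
    (forall v, v \in U -> cub a v = l v * l' v * l'' v) ->
    ~ forall v, v \in L -> [&& v \in U, l v == 0 & l' v == 0].
  move=> sl sl' sl'' dL fE z; apply/smooth/(sing_flag dU dL) => v u /z/and3P[vU /eqP lv /eqP l'v] uU.
  apply: (mulfI (natK 5)); rewrite -polar21 mulr0 !fE ?memvB ?memvD //.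
  by rewrite !lD // !lN // lv l'v; ring.
split=> //.
- by split; split=> // v; rewrite ?m1 ?m2 ?m3 => /andP[vU /eqP e]; rewrite fU // e; ring.
- by split; apply/subvP => v; rewrite ?m1 ?m2 ?m3 => /andP[].
- split; apply/eqP => e.
  + apply: (sep L1 l1 l2 l3) => // v vL; have := vL; rewrite m1 => /andP[-> ->].
    by move: vL; rewrite e m2 => /andP[].
  + apply: (sep L1 l1 l3 l2) => // [v vU|v vL]; first by rewrite fU //; ring.
    by have := vL; rewrite m1 => /andP[-> ->]; move: vL; rewrite e m3 => /andP[].
  + apply: (sep L2 l2 l3 l1) => // [v vU|v vL]; first by rewrite fU //; ring.
    by have := vL; rewrite m2 => /andP[-> ->]; move: vL; rewrite e m3 => /andP[].
move=> v vU; rewrite fU // => /eqP; rewrite !mulf_eq0 -orbA m1 m2 m3 vU /=.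
by case/or3P=> ->; [constructor 1 | constructor 2 | constructor 3].
Qed.

(** If the two meeting points differ, they span [M]. If they coincide, [U] is the tangent plane at
    that point, and this plane contains every line of the surface through it. *)
Lemma sline_meets_two U L1 L2 M v w : \dim U = 3%N -> sline L1 -> sline L2 ->
  (L1 <= U)%VS -> (L2 <= U)%VS -> L1 != L2 -> sline M ->
  v \in M -> v \in L1 -> v != 0 -> w \in M -> w \in L2 -> w != 0 -> (M <= U)%VS.
Proof.
move=> dU s1 s2 U1 U2 n12 sM vM v1 v0 wM w2 w0.
have [F|/(free2P _ v0)] := boolP (free [:: v; w]).
  have [w' _ ME] := dim2_basis sM.1 vM v0.
  suff -> : M = <<[:: v; w]>>%VS.
    by apply/span_subvP => x; rewrite !inE => /orP[] /eqP ->; [apply: (subvP U1) | apply: (subvP U2)].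
  apply/eqP; rewrite eq_sym eqEdim (eqnP F) sM.1 leqnn andbT.
  by apply/span_subvP => x; rewrite !inE => /orP[] /eqP ->.
move=> nc; have v2 : v \in L2.
  have [w2' _ L2E] := dim2_basis s2.1 w2 w0.
  have [c e] : exists c, w = c *: v.
    have /vlineP[c ->] : w \in <[v]>%VS; last by exists c.
    by apply/negPn/negP => nw; apply: nc => c; apply: contra nw => /eqP ->; rewrite memvZ ?memv_line.
  have c0 : c != 0 by apply: contra w0 => /eqP c0; rewrite e c0 scale0r.
  by rewrite -[v]scale1r -(mulVf c0) -scalerA -e memvZ.
have [T dT mT] := tangent_plane v0.
have TU : T = U.
  apply/eqP; rewrite eq_sym eqEdim dU dT leqnn andbT.
  rewrite -(lines_join U1 U2 s1.1 s2.1 dU n12) subv_add.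
  by apply/andP; split; apply/subvP => x xL; rewrite mT; apply/eqP;
    [apply: (sline_tangent s1) | apply: (sline_tangent s2)].
by rewrite -TU; apply/subvP => x xM; rewrite mT; apply/eqP; apply: (sline_tangent sM).
Qed.

End Smooth.

(** * L-sets *)

Section Lsets.
Variables (K : closedFieldType) (a : triform K).
Hypothesis charK : [pchar K] =i pred0.
Hypothesis smooth : ~ sing a.
Local Notation V := 'rV[K]_4.
Implicit Types (u v w b : V) (L M U A B C D E : {vspace V}).

Definition skew L M := forall v, v \in L -> v \in M -> v = 0.
Definition incident L M := exists2 v, v != 0 & (v \in L) && (v \in M).

Lemma skewC L M : skew L M -> skew M L.
Proof. by move=> s v vL vM; apply: s. Qed.

(** [C] always meets [A], both being in [U2]; if it met [B] too, it would lie in [U1] by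
    [sline_meets_two], and then [U2], spanned by [A] and [C], would be [U1]. *)
Lemma skew_of_planes U1 U2 A B C : \dim U1 = 3%N -> \dim U2 = 3%N -> U1 != U2 ->
  sline a A -> sline a B -> sline a C -> (A <= U1)%VS -> (B <= U1)%VS ->
  (A <= U2)%VS -> (C <= U2)%VS -> A != B -> A != C -> skew B C.
Proof.
move=> d1 d2 n12 sA sB sC A1 B1 A2 C2 AB AC v vB vC; apply/eqP/negPn/negP => v0.
have [|w w0 /andP[wA wC]] := lines_meet A2 C2; first by rewrite d2 sA.1 sC.1.
have C1 := sline_meets_two charK smooth d1 sA sB A1 B1 AB sC wC wA w0 vC vB v0.
case/eqP: n12; apply/eqP; rewrite eq_sym eqEdim d1 d2 leqnn andbT.
by rewrite -(lines_join A2 C2 sA.1 sC.1 d2 AC) subv_add A1.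
Qed.

(* The configuration of five lines (L-set) from which the basis giving the
   equation of [cubicS] is read off. *)
Definition Lset A B C D E :=
  [/\ [/\ sline a A, sline a B, sline a C, sline a D & sline a E],
      [/\ incident A B, incident A C, incident A D, incident B E & incident C E],
      [/\ skew A E, skew B C & skew B D] & skew C D /\ skew D E].

(** [E] is the line of [W] met by [C], which cannot be [B] because [B] and [C] are skew. In turn [E]
    meets one of the two lines other than [A] in [U3], and [D] is the other one: if [E] met both, it
    would lie in [U3] and meet [A]. *)
Lemma Lset_of_planes A B B' C C' D0 D1 E0 E1 U1 U2 U3 W :
  tritan a U1 A B B' -> tritan a U2 A C C' -> tritan a U3 A D0 D1 ->
  tritan a W B E0 E1 -> U1 != U2 -> U1 != U3 -> U2 != U3 -> U1 != W ->
  exists D E, (D = D0 \/ D = D1) /\ Lset A B C D E.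
Proof.
move=> [d1 [sA sB _] [A1 B1 _] [AB _ _] _] [d2 [_ sC _] [A2 C2 _] [AC _ _] _].
move=> t3 tW n12 n13 n23 n1W.
have sBC := skew_of_planes d1 d2 n12 sA sB sC A1 B1 A2 C2 AB AC.
have [E [F [tE CE]]] : exists E F, tritan a W B E F /\ incident C E.
  have [dW [_ _ _] _ _ zW] := tW.
  have [|v v0 /andP[vC vW]] := lines_meet (subvf C) (subvf W).
    by rewrite dim_rV4 sC.1 dW.
  case: (zW v vW (sC.2 v vC)) => vL; first by rewrite (sBC v vL vC) eqxx in v0.
    by exists E0, E1; split=> //; exists v; rewrite ?vC.
  by exists E1, E0; split; [apply: tritan_swap23 | exists v; rewrite ?vC].
have [dW [_ sE _] [BW EW _] [BE _ _] _] := tE.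
have BEm : incident B E by apply: (lines_meet BW EW); rewrite dW sB.1 sE.1.
have sAE : skew A E.
  move=> v vA vE; apply/eqP/negPn/negP => v0; have [w w0 /andP[wB wE]] := BEm.
  have E1' := sline_meets_two charK smooth d1 sA sB A1 B1 AB sE vE vA v0 wE wB w0.
  case/eqP: n1W; apply/eqP; rewrite eq_sym eqEdim d1 dW leqnn andbT.
  by rewrite -(lines_join BW EW sB.1 sE.1 dW BE) subv_add B1.
have [D [D' [DE tD ED']]] : exists D D', [/\ D = D0 \/ D = D1, tritan a U3 A D D' & incident E D'].
  have [d3 _ _ _ z3] := t3.
  have [|v v0 /andP[vE v3]] := lines_meet (subvf E) (subvf U3).
    by rewrite dim_rV4 sE.1 d3.
  case: (z3 v v3 (sE.2 v vE)) => vL; first by rewrite (sAE v vL vE) eqxx in v0.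
    exists D1, D0; split; [by right | exact: tritan_swap23 | by exists v; rewrite ?vE].
  by exists D0, D1; split; [left | | exists v; rewrite ?vE].
have [d3 [_ sD sD'] [A3 D3 D'3] [AD AD' DD'] _] := tD.
exists D, E; split=> //; split=> //.
- by split=> //; [apply: (lines_meet A1 B1); rewrite d1 sA.1 sB.1
    | apply: (lines_meet A2 C2); rewrite d2 sA.1 sC.1
    | apply: (lines_meet A3 D3); rewrite d3 sA.1 sD.1].
- by split=> //; apply: (skew_of_planes d1 d3 n13 sA sB sD).
split; first by apply: (skew_of_planes d2 d3 n23 sA sC sD).
move=> v vD vE; apply/eqP/negPn/negP => v0; have [w w0 /andP[wE wD']] := ED'.
have E3 := sline_meets_two charK smooth d3 sD sD' D3 D'3 DD' sE vE vD v0 wE wD' w0.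
have [|x x0 /andP[xA xE]] := lines_meet A3 E3; first by rewrite d3 sA.1 sE.1.
by rewrite (sAE x xA xE) eqxx in x0.
Qed.

(** The five spans are the lines [A], [B], [C], [E], [D] of an L-set, in this order. *)
Definition Lbasis e1 e2 e3 e4 :=
  basis4 e1 e2 e3 e4 /\ forall x y, [/\ cub a (x *: e3 + y *: e4) = 0,
    cub a (x *: e1 + y *: e4) = 0, cub a (x *: e2 + y *: e3) = 0,
    cub a (x *: (e1 + e4) + y *: (e2 + e3)) = 0
  & cub a (x *: (e1 + e2) + y *: (e3 - e4)) = 0].

Lemma skew_free L M v w : skew L M -> v \in L -> w \in M -> v != 0 -> w != 0 ->
  free [:: v; w].
Proof.
move=> s vL wM v0 w0; apply/(free2P _ v0) => c; apply: contra w0 => /eqP e.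
by rewrite (s w) // e memvZ.
Qed.

Lemma span2_line L v w : \dim L = 2%N -> free [:: v; w] -> v \in L -> w \in L ->
  L = <<[:: v; w]>>%VS.
Proof.
move=> dL F vL wL; apply/eqP; rewrite eq_sym eqEdim dL (eqnP F) leqnn andbT.
by apply/span_subvP => x; rewrite !inE => /orP[] /eqP ->.
Qed.

Lemma lin2_eq0 v w (x y : K) : free [:: v; w] -> x *: v + y *: w = 0 -> x = 0 /\ y = 0.
Proof.
move=> F e; have [/andP[/eqP -> /eqP ->] //|] := boolP ((x == 0) && (y == 0)).
by rewrite negb_and => /(lin2_neq0 F); rewrite e eqxx.
Qed.

Lemma basis_skew L M u v w r : skew L M -> free [:: u; v] -> free [:: w; r] ->
  u \in L -> v \in L -> w \in M -> r \in M -> basis4 u v w r.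
Proof.
move=> s F F' uL vL wM rM x y z t; rewrite /comb -addrA => /eqP.
rewrite addr_eq0 => /eqP e; have xy0 : x *: u + y *: v = 0.
  by apply: s; [|rewrite e memvN]; rewrite memvD ?memvZ.
have [-> ->] := lin2_eq0 F xy0.
move: e; rewrite xy0 => /esym/eqP; rewrite oppr_eq0 => /eqP e.
by have [-> ->] := lin2_eq0 F' e.
Qed.

Lemma Lset_basis A B C D E : Lset A B C D E ->
  exists e1 e2 e3 e4, [/\ Lbasis e1 e2 e3 e4,
    (e4 \in A) && (e4 \in B) & (e3 \in A) && (e3 \in C)].
Proof.
case=> [[sA sB sC sD sE] [[e4 n4 /andP[e4A e4B]] [e3 n3 /andP[e3A e3C]]
  [g ng /andP[gA gD]] [p np /andP[pB pE]] [q nq /andP[qC qE]]]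
  [sAE sBC sBD] [sCD sDE]].
have F34 : free [:: e3; e4] := skew_free (skewC sBC) e3C e4B n3 n4.
have Fpq : free [:: p; q] := skew_free sBC pB qC np nq.
have bas : basis4 p q e3 e4 := basis_skew (skewC sAE) Fpq F34 pE qE e3A e4A.
have [al [be gE]] : exists x y, g = x *: e3 + y *: e4.
  by apply/mem_span2; rewrite -(span2_line sA.1 F34 e3A e4A).
have al0 : al != 0.
  apply: contra ng => /eqP al0; rewrite (sBD g) // gE al0 scale0r add0r.
  by rewrite memvZ.
have be0 : be != 0.
  apply: contra ng => /eqP be0; rewrite (sCD g) // gE be0 scale0r addr0.
  by rewrite memvZ.
have [w Fgw DE] := dim2_basis sD.1 gD ng.
have wD : w \in D by rewrite DE memv_span ?inE ?eqxx ?orbT.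
have [a1 [b1 [c1 [d1 wE]]]] := basis4_span bas w.
have memB x y : x *: p + y *: e4 \in B by rewrite memvD ?memvZ.
have memC x y : x *: q + y *: e3 \in C by rewrite memvD ?memvZ.
have memE x y : x *: p + y *: q \in E by rewrite memvD ?memvZ.
have memD x y : x *: w + y *: g \in D by rewrite memvD ?memvZ.
have Dn0 x y : x *: w + y *: g = 0 -> x = 0 /\ y = 0.
  by rewrite addrC => /(lin2_eq0 Fgw)[].
(* The three scalars [a1], [b1] and [del] are nonzero because [D] is skew to [C], to [B] and to [E]
   respectively. *)
have a10 : a1 != 0.
  apply/eqP => a10; have := memC (be * b1) (be * c1 - d1 * al).
  have -> : (be * b1) *: q + (be * c1 - d1 * al) *: e3 = be *: w + (- d1) *: g.
    by rewrite wE gE a10 /comb; apply/rowP => i; rewrite !mxE; ring.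
  by move=> /(sCD _)/(_ (memD _ _))/Dn0[/eqP]; rewrite (negPf be0).
have b10 : b1 != 0.
  apply/eqP => b10; have := memB (al * a1) (al * d1 - c1 * be).
  have -> : (al * a1) *: p + (al * d1 - c1 * be) *: e4 = al *: w + (- c1) *: g.
    by rewrite wE gE b10 /comb; apply/rowP => i; rewrite !mxE; ring.
  by move=> /(sBD _)/(_ (memD _ _))/Dn0[/eqP]; rewrite (negPf al0).
have del0 : al * d1 - c1 * be != 0.
  apply/eqP => e; have := memE (al * a1) (al * b1).
  have -> : (al * a1) *: p + (al * b1) *: q = al *: w + (- c1) *: g.
    have dE : d1 = c1 * be / al by rewrite -(addr0 (c1 * be)) -e; field.
    by rewrite wE gE dE /comb; apply/rowP => i; rewrite !mxE; field.
  by move=> /(sDE _ (memD _ _))/Dn0[/eqP]; rewrite (negPf al0).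
set de := al * d1 - c1 * be in del0.
(* The vector [al *: w - c1 *: g] of [D] has no component on [e3] and component [de] on [e4];
   scaling by [r] turns that component into [2 * be], so that [p' + q' - 2 *: e4'] lies in [D]. *)
have [r rde r0] : exists2 r, 2 * be = r * de & r != 0.
  exists (2 * be / de); first by rewrite divfK.
  by rewrite !mulf_neq0 ?invr_eq0 ?(natS_neq0 charK 1).
pose p' := (r * al * a1) *: p; pose q' := (r * al * b1) *: q.
pose e3' := al *: e3; pose e4' := (- be) *: e4.
have spanD : p' + q' - 2 *: e4' = (r * al) *: w + (- r * c1) *: g.
  rewrite /p' /q' /e4' wE gE /comb; apply/rowP => i; rewrite !mxE.
  rewrite mulNr mulrN mulrA rde /de; ring.
have gE' : e3' - e4' = g.
  by rewrite /e3' /e4' gE scaleNr opprK.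
exists (p' - e4'), (q' - e3'), e3', e4'; split; last 2 first.
- by rewrite !memvZ.
- by rewrite !memvZ.
split.
  move=> x y z t; rewrite /comb.
  have -> : x *: (p' - e4') + y *: (q' - e3') + z *: e3' + t *: e4' =
      comb p q e3 e4 (x * (r * al * a1)) (y * (r * al * b1)) ((z - y) * al) ((x - t) * be).
    by rewrite /p' /q' /e3' /e4' /comb; apply/rowP => i; rewrite !mxE; ring.
  case/bas=> /eqP + /eqP + /eqP + /eqP; rewrite !mulf_eq0.
  rewrite (negPf r0) (negPf al0) (negPf a10) (negPf b10) (negPf be0) !orbF.
  by move=> /eqP -> /eqP -> /eqP/subr0_eq -> /eqP/subr0_eq <-.
move=> x y; split.
- by apply: sA.2; rewrite memvD ?memvZ ?memvN.
- apply: sB.2; have -> : x *: (p' - e4') + y *: e4' = (x * (r * al * a1)) *: p + ((x - y) * be) *: e4.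
    by rewrite /p' /e4'; apply/rowP => i; rewrite !mxE; ring.
  exact: memB.
- apply: sC.2; have -> : x *: (q' - e3') + y *: e3' = (x * (r * al * b1)) *: q + ((y - x) * al) *: e3.
    by rewrite /q' /e3'; apply/rowP => i; rewrite !mxE; ring.
  exact: memC.
- by apply: sE.2; rewrite !subrK memvD ?memvZ.
apply: sD.2; have -> : x *: (p' - e4' + (q' - e3')) + y *: (e3' - e4') =
    x *: (p' + q' - 2 *: e4') + (y - x) *: (e3' - e4').
  by apply/rowP => i; rewrite !mxE; ring.
by rewrite gE' spanD memvD ?memvZ //.
Qed.

End Lsets.

(** * The equation of the surface in the basis of an L-set *)

Definition cubic_value (K : fieldType) (p : params K) (x y z t : K) : K :=
  let: Params b c d e f := p in
  b * c * ((t - x) * (x * z + y * t)) + c ^+ 2 * ((z + t) * (x * z - y * t))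
  - c * d * ((y - z) * (x * z + y * t))
  + c * (e + f) * ((x - y) * (x * z - y * t))
  - e * f * (2 * x ^+ 2 * y - 2 * x * y ^+ 2 + x * z ^+ 2 - x * z * t
             + y * z * t - y * t ^+ 2).

Section CubComb.
Variables (K : fieldType) (a : triform K).
Implicit Types (u v w b : 'rV[K]_4).

Lemma cub_comb b1 b2 b3 b4 x y z t : cub a (comb b1 b2 b3 b4 x y z t) =
  x ^+ 3 * a b1 b1 b1 + y ^+ 3 * a b2 b2 b2 + z ^+ 3 * a b3 b3 b3
  + t ^+ 3 * a b4 b4 b4
  + 3 * (x ^+ 2 * y * a b1 b1 b2 + x ^+ 2 * z * a b1 b1 b3
       + x ^+ 2 * t * a b1 b1 b4 + x * y ^+ 2 * a b1 b2 b2
       + y ^+ 2 * z * a b2 b2 b3 + y ^+ 2 * t * a b2 b2 b4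
       + x * z ^+ 2 * a b1 b3 b3 + y * z ^+ 2 * a b2 b3 b3
       + z ^+ 2 * t * a b3 b3 b4 + x * t ^+ 2 * a b1 b4 b4
       + y * t ^+ 2 * a b2 b4 b4 + z * t ^+ 2 * a b3 b4 b4)
  + 6 * (x * y * z * a b1 b2 b3 + x * y * t * a b1 b2 b4
       + x * z * t * a b1 b3 b4 + y * z * t * a b2 b3 b4).
Proof.
rewrite /comb !cubD !cubZ /cub !triE !(triC12 a b2 b1) !(triC12 a b3 b1).
rewrite !(triC12 a b3 b2); ring.
Qed.

Lemma tri_comb_diag b1 b2 b3 b4 x y z t w :
  let v := comb b1 b2 b3 b4 x y z t in
  a v v w = x ^+ 2 * a b1 b1 w + y ^+ 2 * a b2 b2 w + z ^+ 2 * a b3 b3 w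
  + t ^+ 2 * a b4 b4 w + 2 * (x * y * a b1 b2 w + x * z * a b1 b3 w
  + x * t * a b1 b4 w + y * z * a b2 b3 w + y * t * a b2 b4 w
  + z * t * a b3 b4 w).
Proof.
rewrite /comb /= !triE !(triC12 a b2 b1) !(triC12 a b3 b1) !(triC12 a b3 b2).
rewrite !(triC12 a b4 b1) !(triC12 a b4 b2) !(triC12 a b4 b3); ring.
Qed.

Lemma sing_basis b1 b2 b3 b4 v : basis4 b1 b2 b3 b4 -> v != 0 ->
  a v v b1 = 0 -> a v v b2 = 0 -> a v v b3 = 0 -> a v v b4 = 0 -> sing a.
Proof.
move=> B v0 e1 e2 e3 e4; exists v => // u.
have [x [y [z [t ->]]]] := basis4_span B u.
by rewrite /comb !triDr !triZr e1 e2 e3 e4 !mulr0 !addr0.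
Qed.

End CubComb.

Section NormalForm.
Variables (K : closedFieldType) (a : triform K).
Hypothesis charK : [pchar K] =i pred0.
Hypothesis smooth : ~ sing a.

Let natK n : n.+1%:R != 0 :> K := natS_neq0 charK n.

Lemma eq_of_relation (c r x y : K) : r = 0 -> x - y = c * r -> x = y.
Proof. by move=> -> /eqP; rewrite mulr0 subr_eq0 => /eqP. Qed.

Lemma Vieta2 (s p : K) : exists e f, e + f = s /\ e * f = p.
Proof.
have [e] := @solve_monicpoly K 2%N (nth 0 [:: - p; s]) isT.
rewrite !big_ord_recl big_ord0 /= => De; exists e, (s - e); split; first by ring.
rewrite mulrBr -expr2 De /bump /= addn0; ring.
Qed.

Lemma vanish_span2 u v : (forall x y, cub a (x *: u + y *: v) = 0) ->
  [/\ a u u u = 0, a u u v = 0, a u v v = 0 & a v v v = 0].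
Proof.
move=> z; have zu : cub a u = 0 by have := z 1 0; rewrite scale1r scale0r addr0.
have zv : cub a v = 0 by have := z 0 1; rewrite scale1r scale0r add0r.
have zD : cub a (u + v) = 0 by have := z 1 1; rewrite !scale1r.
have zB : cub a (u - v) = 0 by have := z 1 (-1); rewrite scale1r scaleN1r.
split=> //; apply: (mulfI (natK 5)).
  by rewrite -polar21 zD zB zv; ring.
by rewrite -polar12 zD zB zu; ring.
Qed.

(** The lines [A], [B], [C] kill ten of the twenty coefficients, and [E], [D] impose five
    independent linear relations on the others. The remaining five parameters [A1], ..., [A5] are
    the coefficients of the five cubics of the family, and [A2] is scaled to 1. Once the others are
    fixed, [e] and [f] are known through their sum and product. The last two clauses are the
    conditions of [Lambda1] and [Lambda2] for [c = 1]. *)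
Lemma Lbasis_params e1 e2 e3 e4 : Lbasis a e1 e2 e3 e4 ->
  exists b d e f k, [/\ k != 0,
    forall x y z t, cub a (comb e1 e2 e3 e4 x y z t) =
       k * cubic_value (Params b 1 d e f) x y z t,
    a e1 e3 e4 = 0 -> b = - (1 + e * f) & a e2 e3 e4 = 0 -> d = 1 + e * f].
Proof.
case=> B z.
have [a333 a334 a344 a444] := vanish_span2 (fun x y => and5_rect (fun h _ _ _ _ => h) (z x y)).
have [a111 a114 a144 _] := vanish_span2 (fun x y => and5_rect (fun _ h _ _ _ => h) (z x y)).
have [a222 a223 a233 _] := vanish_span2 (fun x y => and5_rect (fun _ _ h _ _ => h) (z x y)).
have E x y : cub a (comb e1 e2 e3 e4 x y y x) = 0.
  have [_ _ _ <- _] := z x y; congr (cub a _).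
  by apply/rowP => i; rewrite !mxE; ring.
have D x y : cub a (comb e1 e2 e3 e4 x x y (- y)) = 0.
  have [_ _ _ _ <-] := z x y; congr (cub a _).
  by apply/rowP => i; rewrite !mxE; ring.
have cubE x y z' t := cub_comb a e1 e2 e3 e4 x y z' t.
have zs := (a333, a334, a344, a444, a111, a114, a144, a222, a223, a233).
have six (r s t : K) : s = 0 -> t = 0 -> 6 * r = s - t -> r = 0.
  by move=> -> -> e; apply: (mulfI (natK 5)); rewrite e; ring.
have LE1 : a e1 e1 e2 + a e1 e1 e3 + 2 * a e1 e2 e4 + 2 * a e1 e3 e4 + a e2 e4 e4 = 0.
  by apply: (six _ _ _ (E 1 1) (E 1 (-1))); rewrite !cubE !zs; ring.
have LE2 : a e1 e2 e2 + 2 * a e1 e2 e3 + a e1 e3 e3 + a e2 e2 e4 + 2 * a e2 e3 e4 = 0.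
  by apply: (six _ _ _ (E 1 1) (E (-1) 1)); rewrite !cubE !zs; ring.
have LD0 : a e1 e1 e2 + a e1 e2 e2 = 0.
  by apply: (six _ _ _ (D 1 0) (D (-1) 0)); rewrite !cubE !zs; ring.
have LD1 : a e1 e1 e3 + 2 * a e1 e2 e3 - 2 * a e1 e2 e4 - a e2 e2 e4 = 0.
  by apply: (six _ _ _ (D 1 1) (D 1 (-1))); rewrite !cubE !zs; ring.
have LD2 : a e1 e1 e2 + a e1 e2 e2 + a e1 e3 e3 + a e2 e4 e4 - 2 * a e1 e3 e4 - 2 * a e2 e3 e4 = 0.
  by apply: (six _ _ _ (D 1 1) (D (-1) 1)); rewrite !cubE !zs; ring.
have S122 : a e1 e2 e2 = - a e1 e1 e2 by apply/eqP; rewrite -addr_eq0 addrC LD0.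
have n2 : (2 : K) != 0 := natK 1.
have S244 : a e2 e4 e4 = 2 * a e1 e3 e4 + 2 * a e2 e3 e4 - a e1 e3 e3.
  by apply: (eq_of_relation (c := 1) LD2); rewrite S122; ring.
have S124 : a e1 e2 e4 = (a e1 e3 e3 - a e1 e1 e2 - a e1 e1 e3 - 4 * a e1 e3 e4 - 2 * a e2 e3 e4) / 2.
  by apply: (eq_of_relation (c := 2^-1) LE1); rewrite S244; field.
have S123 : a e1 e2 e3 = - a e1 e1 e3 / 2 - a e1 e3 e4 - a e2 e3 e4.
  have LE12 := congr2 +%R LE2 LD1; rewrite addr0 S122 S124 in LE12.
  by apply: (eq_of_relation (c := 4^-1) LE12); field; rewrite n2 (natK 3).
have S224 : a e2 e2 e4 = a e1 e1 e2 + a e1 e1 e3 + 2 * a e1 e3 e4 - a e1 e3 e3.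
  by apply: (eq_of_relation (c := - 1) LD1); rewrite S123 S124; field.
have n3 : (3 : K) != 0 := natK 2.
pose A5 := 3 * a e1 e1 e2 / 2; pose A2 := (3 * a e1 e3 e3 - 6 * a e2 e3 e4) / 2.
pose A1 := 6 * a e1 e3 e4 - A2 + A5; pose A3 := A2 + A5 - 3 * a e1 e3 e3.
pose A4 := 3 * a e1 e1 e3 + A1.
(* If [A2] vanished, the remaining gradient conditions on the line spanned by [e3] and [e4] would
   reduce to one linear equation in the point, giving a singular point there. *)
have A20 : A2 != 0.
  apply/eqP => A20; have D133 : a e1 e3 e3 = 2 * a e2 e3 e4.
    apply: (mulfI n3); rewrite -[LHS](subrK (6 * a e2 e3 e4)).
    have -> : 3 * a e1 e3 e3 - 6 * a e2 e3 e4 = 0 by apply: (mulIf (invr_neq0 n2)); rewrite mul0r.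
    ring.
  have [u [w [nz uw]]] : exists u w : K, (u != 0) || (w != 0) /\ a e1 e3 e3 * u + 2 * a e1 e3 e4 * w = 0.
    have [->|nz] := eqVneq (a e1 e3 e3) 0.
      by exists 1, 0; rewrite oner_eq0; split=> //; ring.
    by exists (- (2 * a e1 e3 e4)), (a e1 e3 e3); rewrite nz orbT; split=> //; ring.
  apply: smooth; apply: (sing_basis (v := comb e1 e2 e3 e4 0 0 u w) B).
  - by apply: comb_neq0 => //; rewrite eqxx.
  - rewrite tri_comb_diag !(triC13 a _ _ e1) !(triC23 a e1 e4 e3) !zs.
    rewrite -[RHS](mulr0 u) -[in RHS]uw; ring.
  - rewrite tri_comb_diag !(triC13 a _ _ e2) !(triC23 a e2 e4 e3) !zs S244 D133.
    rewrite D133 in uw; rewrite -[RHS](mulr0 w) -[in RHS]uw; ring.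
  - by rewrite tri_comb_diag (triC13 a e4 e4 e3) (triC23 a e3 e4 e3) !zs; ring.
  rewrite tri_comb_diag !zs; ring.
have [e [f [ef_s ef_p]]] := Vieta2 (A4 / A2) (- A5 / A2).
exists (A1 / A2), (- A3 / A2), e, f, A2; split=> //.
- move=> x y z' t; rewrite cubE !zs S122 S244 S124 S123 S224 /cubic_value ef_s ef_p.
  rewrite /A4 /A3 /A1.
  have -> : a e2 e3 e4 = (3 * a e1 e3 e3 - 2 * A2) / 6.
    by rewrite /A2; field; rewrite n2 (natK 5).
  by rewrite /A5; field; rewrite A20 n2 (natK 5).
- by move=> e0; rewrite ef_p /A1 e0; field.
move=> e0; rewrite ef_p /A3 /A2 e0 mulr0 subr0; field.
by move: A20; rewrite /A2 e0 mulr0 subr0 !mulf_eq0 !negb_or invr_eq0 => /andP[/andP[-> ->] _]; rewrite ?n2.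
Qed.
End NormalForm.

(** * Planes through a line *)

Section Conics.
Variable K : closedFieldType.
Hypothesis charK : [pchar K] =i pred0.
Let natK n : n.+1%:R != 0 :> K := natS_neq0 charK n.

(* [conic_disc] is half the determinant of the Hessian of the conic
   [al u^2 + be u z + ga u t + de z^2 + ep z t + ze t^2], and
   [conic_disc'] its derivative in the direction of the primed conic. *)
Definition conic_disc (R : pzRingType) (al be ga de ep ze : R) :=
  4 * al * de * ze + be * ep * ga - al * ep ^+ 2 - de * ga ^+ 2 - ze * be ^+ 2.

Definition conic_disc' (R : pzRingType) (al be ga de ep ze al' be' ga' de' ep' ze' : R) :=
  al' * (4 * de * ze - ep ^+ 2) + be' * (ga * ep - 2 * be * ze)
  + ga' * (be * ep - 2 * ga * de) + de' * (4 * al * ze - ga ^+ 2)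
  + ep' * (be * ga - 2 * al * ep) + ze' * (4 * al * de - be ^+ 2).

(** A singular point of the conic that also lies on the primed conic: in a pencil of plane sections,
    the latter is the missing derivative, transversal to the plane. *)
Definition conic_kernel al be ga de ep ze al' be' ga' de' ep' ze' (u z t : K) :=
  [/\ [|| u != 0, z != 0 | t != 0], 2 * al * u + be * z + ga * t = 0,
      be * u + 2 * de * z + ep * t = 0, ga * u + ep * z + 2 * ze * t = 0
    & al' * u ^+ 2 + be' * u * z + ga' * u * t + de' * z ^+ 2 + ep' * z * t
      + ze' * t ^+ 2 = 0].

(** In rank 2, a column of the adjugate of the Hessian spans the kernel, and the derivative of the
    determinant is the value of the primed conic there, up to a factor. In rank 1, the kernel is a
    plane, parametrized by [z] and [t], on which the primed conic is a binary quadratic form with a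
    root. *)
Lemma conic_kernel_aux al be ga de ep ze al' be' ga' de' ep' ze' :
  conic_disc al be ga de ep ze = 0 ->
  conic_disc' al be ga de ep ze al' be' ga' de' ep' ze' = 0 ->
  4 * de * ze - ep ^+ 2 != 0 \/ al != 0 /\ [/\ 4 * de * ze - ep ^+ 2 = 0,
    4 * al * ze - ga ^+ 2 = 0 & 4 * al * de - be ^+ 2 = 0] ->
  exists u z t, conic_kernel al be ga de ep ze al' be' ga' de' ep' ze' u z t.
Proof.
move=> D D' [A11|[al0 [A11 A22 A33]]].
  exists (4 * de * ze - ep ^+ 2), (ga * ep - 2 * be * ze), (be * ep - 2 * ga * de).
  split; first by rewrite A11.
  - by apply: (eq_of_relation (c := 2) D); rewrite /conic_disc; ring.
  - by ring.
  - by ring.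
  pose c := ep' * 2 * ep - de' * 4 * ze - ze' * 4 * de.
  rewrite -[RHS](addr0 0) -{1}(mulr0 (4 * de * ze - ep ^+ 2)) -{1}D' -(mulr0 c) -D.
  by rewrite /c /conic_disc /conic_disc'; ring.
have A23 : be * ga - 2 * al * ep = 0.
  apply/eqP; rewrite -sqrf_eq0; apply/eqP.
  rewrite -[RHS](addr0 0) -{1}(mulr0 (- 4 * al)) -{1}D -(mulr0 (4 * al * ze - ga ^+ 2)) -A33.
  by rewrite /conic_disc; ring.
have [z [t [nz e]]] := quadratic_root
  (al' * ga ^+ 2 - 2 * al * ga * ga' + 4 * al ^+ 2 * ze')
  (2 * al' * be * ga - 2 * al * (be * ga' + ga * be') + 4 * al ^+ 2 * ep')
  (al' * be ^+ 2 - 2 * al * be * be' + 4 * al ^+ 2 * de').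
exists (- (be * z + ga * t)), (2 * al * z), (2 * al * t); split.
- by rewrite !mulf_eq0 (negPf (natK 1)) (negPf al0) /= orbC nz.
- by ring.
- rewrite -[RHS](addr0 0) -{1}(mulr0 z) -{1}A33 -(mulr0 (- t)) -A23; ring.
- rewrite -[RHS](addr0 0) -{1}(mulr0 t) -{1}A22 -(mulr0 (- z)) -A23; ring.
by rewrite -[RHS]e; ring.
Qed.

(** Permuting the variables brings any nonzero principal minor, or else any nonzero diagonal
    coefficient, to the position required by [conic_kernel_aux]; if there is none, the conic is
    zero. *)
Lemma conic_double_kernel al be ga de ep ze al' be' ga' de' ep' ze' :
  conic_disc al be ga de ep ze = 0 ->
  conic_disc' al be ga de ep ze al' be' ga' de' ep' ze' = 0 ->
  exists u z t, conic_kernel al be ga de ep ze al' be' ga' de' ep' ze' u z t.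
Proof.
move=> D D'.
pose P1 := conic_kernel_aux D D'.
have D2 : conic_disc de be ep al ga ze = 0 by rewrite -D /conic_disc; ring.
have D2' : conic_disc' de be ep al ga ze de' be' ep' al' ga' ze' = 0.
  by rewrite -D' /conic_disc'; ring.
have P2 := conic_kernel_aux D2 D2'.
have D3 : conic_disc ze ep ga de be al = 0 by rewrite -D /conic_disc; ring.
have D3' : conic_disc' ze ep ga de be al ze' ep' ga' de' be' al' = 0.
  by rewrite -D' /conic_disc'; ring.
have P3 := conic_kernel_aux D3 D3'.
have {}P2 : 4 * al * ze - ga ^+ 2 != 0 \/ de != 0 /\ [/\ 4 * al * ze - ga ^+ 2 = 0,
    4 * de * ze - ep ^+ 2 = 0 & 4 * de * al - be ^+ 2 = 0] ->
    exists u z t, conic_kernel al be ga de ep ze al' be' ga' de' ep' ze' u z t.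
  move=> /P2[u [z [t [nz k1 k2 k3 k4]]]]; exists z, u, t; split.
  - by rewrite orbCA.
  - by rewrite -k2; ring.
  - by rewrite -k1; ring.
  - by rewrite -k3; ring.
  - by rewrite -k4; ring.
have {}P3 : 4 * de * al - be ^+ 2 != 0 \/ ze != 0 /\ [/\ 4 * de * al - be ^+ 2 = 0,
    4 * ze * al - ga ^+ 2 = 0 & 4 * ze * de - ep ^+ 2 = 0] ->
    exists u z t, conic_kernel al be ga de ep ze al' be' ga' de' ep' ze' u z t.
  move=> /P3[u [z [t [nz k1 k2 k3 k4]]]]; exists t, z, u; split.
  - by rewrite orbC -orbA orbCA.
  - by rewrite -k3; ring.
  - by rewrite -k2; ring.
  - by rewrite -k1; ring.
  - by rewrite -k4; ring.
have [A11|] := eqVneq (4 * de * ze - ep ^+ 2) 0; last by move=> h; apply: P1; left.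
have [A22|] := eqVneq (4 * al * ze - ga ^+ 2) 0; last by move=> h; apply: P2; left.
have [A33|] := eqVneq (4 * al * de - be ^+ 2) 0; last first.
  by move=> h; apply: P3; left; rewrite -mulrA [de * _]mulrC mulrA.
have [al0|h] := eqVneq al 0; last by apply: P1; right.
have [de0|h] := eqVneq de 0; last first.
  by apply: P2; right; split=> //; split=> //; rewrite -mulrA [de * _]mulrC mulrA.
have [ze0|h] := eqVneq ze 0; last first.
  apply: P3; right; split=> //; split; rewrite -mulrA; first by rewrite [de * _]mulrC mulrA.
    by rewrite [ze * _]mulrC mulrA.
  by rewrite [ze * _]mulrC mulrA.
move: A11 A22 A33; rewrite al0 de0 ze0 !(mulr0, sub0r) => /eqP + /eqP + /eqP.
rewrite !oppr_eq0 !sqrf_eq0 => /eqP -> /eqP -> /eqP ->.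
have [u [z [nz e]]] := quadratic_root de' be' al'.
exists u, z, 0; split; rewrite ?orbA ?nz //; try ring.
by rewrite -[RHS]e; ring.
Qed.

Lemma sqrt_exists (c : K) : exists m, m ^+ 2 = c.
Proof.
have [m] := @solve_monicpoly K 2%N (nth 0 [:: c; 0]) isT.
by rewrite !big_ord_recl big_ord0 /= => e; exists m; rewrite e mul0r !addr0 mulr1.
Qed.

Definition conic_splits (al be ga de ep ze : K) := exists p1 p2 p3 q1 q2 q3,
  forall u z t, al * u ^+ 2 + be * u * z + ga * u * t + de * z ^+ 2
    + ep * z * t + ze * t ^+ 2 =
  (p1 * u + p2 * z + p3 * t) * (q1 * u + q2 * z + q3 * t).

(** Completing the square, 4 al times the conic is the square of 2 al u + be z + ga t minus a binary
    quadratic form in z, t. The discriminant makes the latter a square (m z + n t)^2, and the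
    difference of squares factors. *)
Lemma conic_splits_aux al be ga de ep ze : al != 0 ->
  conic_disc al be ga de ep ze = 0 -> conic_splits al be ga de ep ze.
Proof.
move=> al0 D; have n4 := natK 3.
have DD : (be * ga - 2 * al * ep) ^+ 2 = (be ^+ 2 - 4 * al * de) * (ga ^+ 2 - 4 * al * ze).
  by apply: (eq_of_relation (c := - 4 * al) D); rewrite /conic_disc; ring.
have [m [n [m2 n2 mn]]] : exists m n, [/\ m ^+ 2 = be ^+ 2 - 4 * al * de,
    n ^+ 2 = ga ^+ 2 - 4 * al * ze & m * n = be * ga - 2 * al * ep].
  have [m m2] := sqrt_exists (be ^+ 2 - 4 * al * de).
  have [m0|m0] := eqVneq m 0.
    have [n n2] := sqrt_exists (ga ^+ 2 - 4 * al * ze).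
    exists m, n; split=> //; rewrite m0 mul0r; apply/esym/eqP; rewrite -sqrf_eq0 DD -m2 m0.
    by rewrite expr0n mul0r.
  exists m, ((be * ga - 2 * al * ep) / m); split=> //.
    by rewrite expr_div_n DD -m2 mulrC mulKf // sqrf_eq0.
  by rewrite mulrC divfK.
exists 1, ((be - m) / (2 * al)), ((ga - n) / (2 * al)), al, ((be + m) / 2), ((ga + n) / 2) => u z t.
have -> : de = (be ^+ 2 - m ^+ 2) / (4 * al) by rewrite m2; field; rewrite n4 al0.
have -> : ze = (ga ^+ 2 - n ^+ 2) / (4 * al) by rewrite n2; field; rewrite n4 al0.
have -> : ep = (be * ga - m * n) / (2 * al) by rewrite mn; field; rewrite (natK 1) al0.
by field; rewrite n4 (natK 1) al0.
Qed.

Lemma conic_split al be ga de ep ze :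
  conic_disc al be ga de ep ze = 0 -> conic_splits al be ga de ep ze.
Proof.
move=> D; have [al0|] := eqVneq al 0; last by move=> h; apply: conic_splits_aux.
have D2 : conic_disc de be ep al ga ze = 0 by rewrite -D /conic_disc; ring.
have [de0|h] := eqVneq de 0; last first.
  have [p1 [p2 [p3 [q1 [q2 [q3 E]]]]]] := conic_splits_aux h D2.
  exists p2, p1, p3, q2, q1, q3 => u z t.
  by apply: (etrans _ (etrans (E z u t) _)); ring.
have D3 : conic_disc ze ep ga de be al = 0 by rewrite -D /conic_disc; ring.
have [ze0|h] := eqVneq ze 0; last first.
  have [p1 [p2 [p3 [q1 [q2 [q3 E]]]]]] := conic_splits_aux h D3.
  exists p3, p2, p1, q3, q2, q1 => u z t.
  by apply: (etrans _ (etrans (E t z u) _)); ring.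
move: D; rewrite /conic_disc al0 de0 ze0 !(mulr0, mul0r, sub0r, subr0, add0r) => /eqP.
rewrite !mulf_eq0 => /orP[/orP[]|] /eqP e0.
- by exists 0, 0, 1, ga, ep, 0 => u z t; rewrite e0; ring.
- by exists 1, 0, 0, 0, be, ga => u z t; rewrite e0; ring.
- by exists 0, 1, 0, be, 0, ep => u z t; rewrite e0; ring.
Qed.

Lemma simple_roots (p : {poly K}) : p != 0 ->
  (forall x, root p x -> ~~ root p^`() x) ->
  exists r : seq K, [/\ uniq r, size r = (size p).-1 & forall x, x \in r -> root p x].
Proof.
move=> p0 simple; have [r Dp] := closed_field_poly_normal p.
exists r; have rp x : x \in r -> root p x.
  by move=> xr; rewrite Dp rootZ ?lead_coef_eq0 // root_prod_XsubC.
split=> //; last by rewrite Dp size_scale ?lead_coef_eq0 // size_prod_XsubC.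
rewrite -separable_prod_XsubC; apply/negPn/negP; rewrite unlock /coprimep => /closed_rootP[x].
rewrite root_gcd => /andP[qx q'x]; have := simple x.
by rewrite Dp derivZ !rootZ ?lead_coef_eq0 // q'x => /(_ qx).
Qed.

(** The coefficients of the conic have degrees 3, 2, 2, 1, 1, 1, so the discriminant is a quintic.
    Only its top two coefficients matter: they are the discriminant and its derivative at the plane
    at infinity of the pencil. *)
Lemma conic_disc_poly (al0 al1 al2 al3 be0 be1 be2 ga0 ga1 ga2 de0 de1 ep0 ep1 ze0 ze1 : K) :
  exists c0 c1 c2 c3 : K,
  conic_disc (al0%:P + al1%:P * 'X + al2%:P * 'X^2 + al3%:P * 'X^3)
    (be0%:P + be1%:P * 'X + be2%:P * 'X^2) (ga0%:P + ga1%:P * 'X + ga2%:P * 'X^2)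
    (de0%:P + de1%:P * 'X) (ep0%:P + ep1%:P * 'X) (ze0%:P + ze1%:P * 'X) =
  (((((conic_disc al3 be2 ga2 de1 ep1 ze1)%:P * 'X
  + (conic_disc' al3 be2 ga2 de1 ep1 ze1 al2 be1 ga1 de0 ep0 ze0)%:P) * 'X
  + c3%:P) * 'X + c2%:P) * 'X + c1%:P) * 'X + c0%:P.
Proof.
exists (4 * al0 * de0 * ze0 - al0 * ep0 ^+ 2 - be0 ^+ 2 * ze0 + be0 * ep0 * ga0 - de0 * ga0 ^+ 2).
exists (4 * al0 * de0 * ze1 + 4 * al0 * de1 * ze0 - 2 * al0 * ep0 * ep1 + 4 * al1 * de0 * ze0 - al1 * ep0 ^+ 2 - be0 ^+ 2 * ze1 - 2 * be0 * be1 * ze0 + be0 * ep1 * ga0 + be0 * ep0 * ga1 + be1 * ep0 * ga0 - de1 * ga0 ^+ 2 - 2 * de0 * ga0 * ga1).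
exists (4 * al0 * de1 * ze1 - al0 * ep1 ^+ 2 + 4 * al1 * de0 * ze1 + 4 * al1 * de1 * ze0 - 2 * al1 * ep0 * ep1 + 4 * al2 * de0 * ze0 - al2 * ep0 ^+ 2 - 2 * be0 * be1 * ze1 - 2 * be0 * be2 * ze0 + be0 * ep1 * ga1 + be0 * ep0 * ga2 - be1 ^+ 2 * ze0 + be1 * ep1 * ga0 + be1 * ep0 * ga1 + be2 * ep0 * ga0 - 2 * de1 * ga0 * ga1 - 2 * de0 * ga0 * ga2 - de0 * ga1 ^+ 2).
exists (4 * al1 * de1 * ze1 - al1 * ep1 ^+ 2 + 4 * al2 * de0 * ze1 + 4 * al2 * de1 * ze0 - 2 * al2 * ep0 * ep1 + 4 * al3 * de0 * ze0 - al3 * ep0 ^+ 2 - 2 * be0 * be2 * ze1 + be0 * ep1 * ga2 - be1 ^+ 2 * ze1 - 2 * be1 * be2 * ze0 + be1 * ep1 * ga1 + be1 * ep0 * ga2 + be2 * ep1 * ga0 + be2 * ep0 * ga1 - 2 * de1 * ga0 * ga2 - de1 * ga1 ^+ 2 - 2 * de0 * ga1 * ga2).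
rewrite /conic_disc /conic_disc'; ring.
Qed.
End Conics.

Section PlanesThroughLine.
Variables (K : closedFieldType) (a : triform K).
Hypothesis charK : [pchar K] =i pred0.
Local Notation V := 'rV[K]_4.
Implicit Types (u v w b : V) (L M U A B : {vspace V}).

Let natK n : n.+1%:R != 0 :> K := natS_neq0 charK n.

Lemma basis4_coords b1 b2 b3 b4 : basis4 b1 b2 b3 b4 ->
  exists f1 f2 f3 f4 : V -> K, [/\ [/\ scalar f1, scalar f2, scalar f3 & scalar f4],
    forall v, v = comb b1 b2 b3 b4 (f1 v) (f2 v) (f3 v) (f4 v)
  & forall x y z t, let v := comb b1 b2 b3 b4 x y z t in
      [/\ f1 v = x, f2 v = y, f3 v = z & f4 v = t]].
Proof.
move=> B; have F := basis4_free B; pose X := [tuple b1; b2; b3; b4].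
have full v : v \in <<X>>%VS.
  have [x [y [z [t ->]]]] := basis4_span B v.
  by rewrite /comb !memvD ?memvZ ?memv_span ?inE ?eqxx ?orbT.
have E v : v = comb b1 b2 b3 b4 (coord X (inord 0) v) (coord X (inord 1) v)
    (coord X (inord 2) v) (coord X (inord 3) v).
  rewrite {1}(coord_span (full v)) !big_ord_recl big_ord0 /comb addr0 !addrA /=.
  by congr (_ *: _ + _ *: _ + _ *: _ + _ *: _); congr (coord _ _ _); apply/val_inj; rewrite /= inordK.
exists (coord X (inord 0)), (coord X (inord 1)), (coord X (inord 2)), (coord X (inord 3)).
split=> //; first by split=> c u v; rewrite linearP.
move=> x y z t v; have := E v; rewrite {1}/v => /eqP; rewrite -subr_eq0 => /eqP e.
case: (B (x - coord X (inord 0) v) (y - coord X (inord 1) v) (z - coord X (inord 2) v)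
   (t - coord X (inord 3) v)).
  by rewrite -[RHS]e /comb; apply/rowP => i; rewrite !mxE; ring.
by do 4![move=> /subr0_eq <-].
Qed.

Section Line.
Variables (e3 e4 : V).
Hypothesis A0 : forall x y, cub a (x *: e3 + y *: e4) = 0.

Definition line_disc w := conic_disc (a w w w) (3 * a w w e3) (3 * a w w e4)
  (3 * a w e3 e3) (6 * a w e3 e4) (3 * a w e4 e4).
Definition line_disc' w w' := conic_disc' (a w w w) (3 * a w w e3) (3 * a w w e4)
  (3 * a w e3 e3) (6 * a w e3 e4) (3 * a w e4 e4) (3 * a w w w') (6 * a w w' e3)
  (6 * a w w' e4) (3 * a w' e3 e3) (6 * a w' e3 e4) (3 * a w' e4 e4).

(* The residual conic of the plane <w, e3, e4> degenerates to first order in the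
   direction w': its singular point is then a singular point of the surface. *)
Lemma double_plane_sing w w' : basis4 w w' e3 e4 -> line_disc w = 0 ->
  line_disc' w w' = 0 -> sing a.
Proof.
move=> B D D'; have [a333 a334 a344 a444] := vanish_span2 charK A0.
have [u [z [t [nz k1 k2 k3 k4]]]] := conic_double_kernel charK D D'.
have n3 : (3 : K) != 0 := natK 2.
apply: (sing_basis (v := comb w w' e3 e4 u 0 z t) B).
- by apply: comb_neq0 => //; rewrite eqxx.
- rewrite tri_comb_diag (triC13 a e3 e3 w) (triC13 a e4 e4 w) (triC23 a w e3 w).
  rewrite (triC23 a w e4 w) (triC13 a e3 e4 w) (triC23 a w e4 e3).
  apply: (mulfI (natK 5)); rewrite [RHS]mulr0.
  have := congr2 +%R (congr1 ( *%R (3 * u)) k1) (congr2 +%R (congr1 ( *%R z) k2) (congr1 ( *%R t) k3)).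
  by rewrite !mulr0 !addr0 => k; apply: (etrans _ k); ring.
- rewrite tri_comb_diag (triC13 a e3 e3 w') (triC13 a e4 e4 w') (triC23 a w e3 w').
  rewrite (triC23 a w e4 w') (triC13 a e3 e4 w') (triC23 a w' e4 e3).
  by apply: (mulfI n3); rewrite [RHS]mulr0; apply: (etrans _ k4); ring.
- rewrite tri_comb_diag (triC13 a e4 e4 e3) (triC23 a w e4 e3) (triC23 a e3 e4 e3).
  rewrite a333 a334 a344; apply: (mulfI n3); rewrite [RHS]mulr0.
  by have := congr1 ( *%R u) k2; rewrite mulr0 => k; apply: (etrans _ k); ring.
rewrite tri_comb_diag a334 a344 a444.
apply: (mulfI n3); rewrite [RHS]mulr0.
  by have := congr1 ( *%R u) k3; rewrite mulr0 => k; apply: (etrans _ k); ring.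
Qed.

Lemma line_disc_linear e1 e2 x :
  let P (c0 c1 : K) := c0%:P + c1%:P * 'X in
  let Q (c0 c1 c2 : K) := P c0 c1 + c2%:P * 'X^2 in
  let D := conic_disc (Q (a e1 e1 e1) (3 * a e1 e1 e2) (3 * a e1 e2 e2) + (a e2 e2 e2)%:P * 'X^3)
    (Q (3 * a e1 e1 e3) (6 * a e1 e2 e3) (3 * a e2 e2 e3))
    (Q (3 * a e1 e1 e4) (6 * a e1 e2 e4) (3 * a e2 e2 e4))
    (P (3 * a e1 e3 e3) (3 * a e2 e3 e3)) (P (6 * a e1 e3 e4) (6 * a e2 e3 e4))
    (P (3 * a e1 e4 e4) (3 * a e2 e4 e4)) in
  D.[x] = line_disc (e1 + x *: e2) /\ D^`().[x] = line_disc' (e1 + x *: e2) e2.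
Proof.
move=> P Q D; rewrite /line_disc /line_disc' !triE.
rewrite (triC12 a e2 e1) (triC23 a e1 e2 e1) (triC23 a e2 e2 e1) !(triC12 a e2 e1).
pose hE := (hornerD, hornerN, hornerM, hornerXn, hornerX, hornerC, hornerMn).
split.
  by rewrite /D /conic_disc /Q /P !expr2 !hE; ring.
rewrite /D /conic_disc /conic_disc' /Q /P !expr2 !derivE !hE; ring.
Qed.

End Line.

Lemma coords_plane b1 b2 b3 b4 : basis4 b1 b2 b3 b4 -> exists2 U : {vspace V},
  \dim U = 3%N & forall x y z t, (comb b1 b2 b3 b4 x y z t \in U) = (y == 0).
Proof.
move=> B; have [f1 [f2 [f3 [f4 [[_ s2 _ _] _ E]]]]] := basis4_coords B.
have [U mU [_ dU]] := linear_kernel s2.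
exists U; last by move=> x y z t; rewrite mU; have [_ -> _ _] := E x y z t.
apply: dU; exists (comb b1 b2 b3 b4 0 1 0 0).
by have [_ -> _ _] := E 0 1 0 0; rewrite oner_eq0.
Qed.

Hypothesis smooth : ~ sing a.

Lemma degenerate_plane A w e2 e3 e4 : sline a A -> A = <<[:: e3; e4]>>%VS ->
  basis4 w e2 e3 e4 -> line_disc e3 e4 w = 0 ->
  exists U B B', [/\ tritan a U A B B', w \in U & e2 \notin U].
Proof.
move=> sA AE Bas D.
have A0 x y : cub a (x *: e3 + y *: e4) = 0.
  by apply: sA.2; rewrite AE; apply/mem_span2; exists x, y.
have [a333 a334 a344 a444] := vanish_span2 charK A0.
have [U dU mU] := coords_plane Bas.
have [f1 [f2 [f3 [f4 [[s1 s2 s3 s4] E1 E2]]]]] := basis4_coords Bas.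
have [p1 [p2 [p3 [q1 [q2 [q3 Q]]]]]] := conic_split charK D.
have slin (f g h : V -> K) x y z : scalar f -> scalar g -> scalar h ->
    scalar (fun v => x * f v + y * g v + z * h v).
  move=> sf sg sh c u v; have /= -> := sf c u v; have /= -> := sg c u v.
  by have /= -> := sh c u v; ring.
have [] := @tritan_of_factors K a charK smooth U f1 (fun v => p1 * f1 v + p2 * f3 v + p3 * f4 v)
    (fun v => q1 * f1 v + q2 * f3 v + q3 * f4 v) dU s1 (slin _ _ _ _ _ _ s1 s3 s4) (slin _ _ _ _ _ _ s1 s3 s4).
  move=> v; rewrite {1 2}(E1 v) mU => /eqP f20.
  rewrite -mulrA -Q f20 cub_comb a333 a334 a344 a444; ring.
move=> L [B [B' [tL mL]]]; exists U, B, B'; split; last 2 first.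
- have -> : w = comb w e2 e3 e4 1 0 0 0 by rewrite /comb scale1r !scale0r !addr0.
  by rewrite mU.
- have -> : e2 = comb w e2 e3 e4 0 1 0 0 by rewrite /comb scale1r !scale0r !addr0 add0r.
  by rewrite mU oner_eq0.
suff -> : A = L by [].
have [_ [sL _ _] _ _ _] := tL.
apply/eqP; rewrite eqEdim sA.1 sL.1 leqnn andbT; apply/subvP => v.
rewrite AE => /mem_span2[x [y ->]]; have [-> _ _] := mL (x *: e3 + y *: e4).
have -> : x *: e3 + y *: e4 = comb w e2 e3 e4 0 0 x y by rewrite /comb !scale0r !add0r.
by rewrite mU eqxx; have [-> _ _ _] := E2 0 0 x y; rewrite eqxx.
Qed.

(** By smoothness the quintic discriminant has only simple roots, so at least four of them are
    finite. Three distinct planes suffice, since one of them differs from both [U1] and [U2]; these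
    two are arbitrary subspaces, and 0 may be given when there is nothing to avoid. *)
Lemma third_plane A U1 U2 : sline a A ->
  exists U B B', [/\ tritan a U A B B', U != U1 & U != U2].
Proof.
move=> sA; have A_n0 : vpick A != 0 by rewrite vpick0 -dimv_eq0 sA.1.
have [e4 F34 AE] := dim2_basis sA.1 (memv_pick A) A_n0.
set e3 := vpick A in F34 AE.
have dC : \dim (A^C)%VS = 2%N.
  by have := dimv_compl A; rewrite dim_rV4 sA.1 => ->.
have C_n0 : vpick (A^C)%VS != 0 by rewrite vpick0 -dimv_eq0 dC.
have [e2 F12 CE] := dim2_basis dC (memv_pick _) C_n0.
set e1 := vpick _ in F12 CE.
have Bas : basis4 e1 e2 e3 e4.
  apply: (@basis_skew _ (A^C)%VS A) => //.
  - move=> v vC vA; apply/eqP; rewrite -memv0 -(capv_compl A) memv_cap vA.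
    exact: vC.
  - by rewrite CE memv_span ?inE ?eqxx.
  - by rewrite CE memv_span ?inE ?eqxx ?orbT.
  - by rewrite AE memv_span ?inE ?eqxx.
  - by rewrite AE memv_span ?inE ?eqxx ?orbT.
have A0 x y : cub a (x *: e3 + y *: e4) = 0.
  by apply: sA.2; rewrite AE; apply/mem_span2; exists x, y.
have Basx x : basis4 (e1 + x *: e2) e2 e3 e4.
  move=> x1 y1 z1 t1 e; have := Bas x1 (y1 + x1 * x) z1 t1.
  rewrite -[comb e1 e2 _ _ _ _ _ _](_ : comb (e1 + x *: e2) e2 e3 e4 x1 y1 z1 t1 = _); last first.
    by rewrite /comb; apply/rowP => i; rewrite !mxE; ring.
  by case/(_ e) => -> + -> ->; rewrite mul0r addr0 => ->.
have Bas21 : basis4 e2 e1 e3 e4.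
  move=> x1 y1 z1 t1; rewrite /comb [x1 *: _ + _]addrC => /Bas[-> -> -> ->].
  by split.
move: (line_disc_linear e3 e4 e1 e2) => /=; set D := conic_disc _ _ _ _ _ _ => HD.
have [c0 [c1 [c2 [c3 DE]]]] := conic_disc_poly (a e1 e1 e1) (3 * a e1 e1 e2)
  (3 * a e1 e2 e2) (a e2 e2 e2) (3 * a e1 e1 e3) (6 * a e1 e2 e3) (3 * a e2 e2 e3)
  (3 * a e1 e1 e4) (6 * a e1 e2 e4) (3 * a e2 e2 e4)
  (3 * a e1 e3 e3) (3 * a e2 e3 e3) (6 * a e1 e3 e4) (6 * a e2 e3 e4)
  (3 * a e1 e4 e4) (3 * a e2 e4 e4).
rewrite -/D in DE.
(* The degree is at least 4: if the top two coefficients both vanished, the plane through [e2] would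
   be a double root at infinity. *)
have sD : (4 < size D)%N.
  rewrite DE; set p := _%:P * 'X + _%:P.
  have p0 : p != 0.
    apply/eqP => pz; apply: smooth; apply: (double_plane_sing A0 Bas21).
      have := congr1 (fun q : {poly K} => q`_1) pz.
      by rewrite coef0 /p coefD coefMX !coefC /= addr0.
    have := congr1 (fun q : {poly K} => q`_0) pz.
    rewrite coef0 /p coefD coefMX !coefC /= add0r => e; apply: (etrans _ e).
    rewrite /line_disc' (triC12 a e2 e1 e3) (triC12 a e2 e1 e4) (triC13 a e2 e2 e1).
    by [].
  have S (q : {poly K}) c : q != 0 -> size (q * 'X + c%:P) = (size q).+1 /\ q * 'X + c%:P != 0.
    move=> q0; have e : size (q * 'X + c%:P) = (size q).+1.
      by rewrite size_MXaddC (negPf q0).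
    by rewrite e -size_poly_eq0 e.
  have [e3' n3] := S _ c3 p0; have [e2' n2] := S _ c2 n3.
  have [e1' n1] := S _ c1 n2; have [e0 _] := S _ c0 n1.
  by rewrite e0 e1' e2' e3' !ltnS size_poly_gt0.
have D0 : D != 0 by rewrite -size_poly_gt0; lia.
have simpleD x : root D x -> ~~ root D^`() x.
  move=> /rootP Dx; apply/negP => /rootP D'x; apply: smooth.
  have [h h'] := HD x; apply: (double_plane_sing A0 (Basx x)); first by rewrite -h.
  by rewrite -h'.
have [r [ur sr rD]] := simple_roots D0 simpleD.
have plane x : x \in r -> exists U B B',
    [/\ tritan a U A B B', e1 + x *: e2 \in U & e2 \notin U].
  move=> /rD/rootP Dx; apply: (degenerate_plane sA AE (Basx x)).
  by have [<- _] := HD x.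
have diff x y U U' : x != y -> e1 + x *: e2 \in U -> e1 + y *: e2 \in U' ->
    e2 \notin U -> U != U'.
  move=> xy xU yU nU; apply: contra nU => /eqP UU'; rewrite -UU' in yU.
  have := memvB xU yU; rewrite opprD addrACA subrr add0r -scalerBl => mU.
  by rewrite -[e2]scale1r -(mulVf (_ : x - y != 0)) ?subr_eq0 // -scalerA memvZ.
have {sr} : (2 < size r)%N by rewrite sr; case: (size D) sD => // m /ltnW.
case: r ur rD plane => [|x0 [|x1 [|x2 r]]] //= + _ plane _.
rewrite !inE !negb_or => /and4P[/and3P[n01 n02 _] /andP[n12 _] _ _].
have [|U0 [B0 [B0' [t0 w0 nw0]]]] := plane x0; first by rewrite !inE eqxx.
have [|V1 [B1 [B1' [t1 w1 nw1]]]] := plane x1; first by rewrite !inE eqxx orbT.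
have [|V2 [B2 [B2' [t2 w2 nw2]]]] := plane x2; first by rewrite !inE eqxx !orbT.
have d01 := diff _ _ _ _ n01 w0 w1 nw0; have d02 := diff _ _ _ _ n02 w0 w2 nw0.
have d12 := diff _ _ _ _ n12 w1 w2 nw1.
have [/andP[h h']|] := boolP ((U0 != U1) && (U0 != U2)); first by exists U0, B0, B0'.
have [/andP[h h']|] := boolP ((V1 != U1) && (V1 != U2)); first by exists V1, B1, B1'.
have [/andP[h h']|] := boolP ((V2 != U1) && (V2 != U2)); first by exists V2, B2, B2'.
rewrite !negb_and !negbK => /orP[] /eqP E2 /orP[] /eqP E1 /orP[] /eqP E0.
all: by move: d01 d02 d12; rewrite E0 E1 E2 eqxx.
Qed.
End PlanesThroughLine.

(** * Existence of a line *)

Section LineExistence.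
Variables (K : closedFieldType) (a : triform K).
Hypothesis charK : [pchar K] =i pred0.
Hypothesis smooth : ~ sing a.
Local Notation V := 'rV[K]_4.
Implicit Types (u v w b : V) (L M U A B : {vspace V}).

Let natK n : n.+1%:R != 0 :> K := natS_neq0 charK n.
Let n3 : (3 : K) != 0 := natK 2.

(** A polynomial [p] without roots is a constant [c], and then its reversal [q] is [c *: 'X^n],
    which vanishes at 0. The second alternative is thus a root at infinity. *)
Lemma reciprocal_root (p q : {poly K}) n : (0 < n)%N ->
  (forall x, x != 0 -> p.[x] = x ^+ n * q.[x^-1]) ->
  (exists x, p.[x] = 0) \/ q.[0] = 0.
Proof.
move=> n0 pq; have [p1|] := boolP (size p != 1%N).
  by left; have [x /rootP] := closed_rootP _ p1; exists x.
rewrite negbK => /eqP p1; right; have pE := size1_polyC (eq_leq p1).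
set c := p`_0 in pE; suff qE : q = c *: 'X^n.
  by rewrite qE hornerZ hornerXn expr0n eqn0Ngt n0 mulr0.
apply/eqP; rewrite -subr_eq0; apply: contraT => d0.
have : (q - c *: 'X^n) * 'X != 0 by rewrite mulf_neq0 ?polyX_eq0.
move/closed_nonrootP=> [x]; rewrite /root hornerM hornerX hornerD hornerN hornerZ hornerXn.
rewrite mulf_eq0 negb_or => /andP[nz x0]; move: nz.
have := pq x^-1; rewrite invr_eq0 invrK pE hornerC => /(_ x0) ->.
by rewrite exprVn mulrAC mulVf ?expf_neq0 // mul1r subrr eqxx.
Qed.

Lemma sline_span2 u v : free [:: u; v] -> cub a u = 0 -> a u u v = 0 ->
  a u v v = 0 -> cub a v = 0 -> sline a <<[:: u; v]>>%VS.
Proof.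
move=> F u3 u2 u1 u0; split; first by rewrite (eqnP F).
move=> w /mem_span2[x [y ->]]; rewrite cubD !cubZ !triE u3 u2 u1 u0; ring.
Qed.

Lemma cub_zero_on_line L : \dim L = 2%N -> exists2 v, v != 0 & v \in L /\ cub a v = 0.
Proof.
move=> dL; have u0 : vpick L != 0 by rewrite vpick0 -dimv_eq0 dL.
have [w F LE] := dim2_basis dL (memv_pick L) u0; set u := vpick L in u0 F LE.
have [x [y [nz e]]] := cubic_root (cub a w) (3 * a u w w) (3 * a u u w) (cub a u).
exists (x *: u + y *: w); first exact: lin2_neq0.
split; first by rewrite LE; apply/mem_span2; exists x, y.
by rewrite cubD !cubZ !triE -[RHS]e; ring.
Qed.

Lemma flag_basis u v U : free [:: u; v] -> u \in U -> v \in U -> \dim U = 3%N ->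
  exists w n, [/\ w \in U, n \notin U & basis4 u v w n].
Proof.
move=> F uU vU dU; have LU : (<<[:: u; v]>> <= U)%VS.
  by apply/span_subvP => x; rewrite !inE => /orP[] /eqP ->.
have [|w wU [wL _]] := subspace_extend LU; first by rewrite (eqnP F).
have [|n _ [nU _]] := subspace_extend (subvf U); first by rewrite dim_rV4 dU.
exists w, n; split=> // x y z t; rewrite /comb => e.
have t0 : t = 0.
  apply: contraNeq nU => t0; rewrite -[n]scale1r -(mulVf t0) -scalerA memvZ //.
  move/eqP: e; rewrite addrC addr_eq0 => /eqP ->.
  by rewrite memvN !memvD ?memvZ.
rewrite t0 scale0r addr0 in e *; have z0 : z = 0.
  apply: contraNeq wL => z0; rewrite -[w]scale1r -(mulVf z0) -scalerA memvZ //.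
  move/eqP: e; rewrite addrC addr_eq0 => /eqP ->; rewrite memvN.
  by apply/mem_span2; exists x, y.
by rewrite z0 scale0r addr0 in e *; have [-> ->] := lin2_eq0 F e.
Qed.

Lemma tri_vanish_delta u v : (forall j, a u v (delta_mx 0 j) = 0) ->
  forall w, a u v w = 0.
Proof.
move=> z w; rewrite [w]row_sum_delta; elim/big_rec: _ => [|j x _ IH].
  by rewrite tri0r.
by rewrite triDr triZr z IH mulr0 addr0.
Qed.

Definition has_line := exists A, sline a A.

(* The tangent section at [v] is a rational cubic, parametrized by the lines
   through [v], and the Hessian has a zero on it. *)
Lemma parabolic_point : has_line \/ exists o w, [/\ o != 0, w != 0, cub a o = 0
  & forall u, a o w u = 0].
Proof.
have [|L _ dL] := @sub_line_dim2 K fullv; first by rewrite dim_rV4.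
have [v v0 [_ vS]] := cub_zero_on_line dL.
have [T dT mT] := tangent_plane smooth v0.
have vT : v \in T by rewrite mT; apply/eqP.
have /subvPn[b bT bv] : ~~ (T <= <[v]>)%VS.
  by apply/negP => /dimvS; rewrite dim_vline v0 dT.
have Fvb : free [:: v; b].
  by apply/(free2P _ v0) => c; apply: contra bv => /eqP ->; rewrite memvZ ?memv_line.
have [c [n [cT nT Bas]]] := flag_basis Fvb vT bT dT.
pose q y z := y ^+ 2 * a v b b + 2 * y * z * a v b c + z ^+ 2 * a v c c.
pose k y z := y ^+ 3 * cub a b + 3 * y ^+ 2 * z * a b b c + 3 * y * z ^+ 2 * a b c c
  + z ^+ 3 * cub a c.
(* On the line joining [v] to w = y b + z c, with parameters (l : m), tangency at [v] leaves the
   cubic m^2 (3 q l + k m); the third intersection is (-k : 3q). When [q] and [k] both vanish, the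
   whole line lies on the surface. *)
pose P y z := (- k y z) *: v + (3 * q y z * y) *: b + (3 * q y z * z) *: c.
have vv w : w \in T -> a v v w = 0 by rewrite mT => /eqP.
have qE y z : a v (y *: b + z *: c) (y *: b + z *: c) = q y z.
  by rewrite /q !triE (triC23 a v c b); ring.
have kE y z : cub a (y *: b + z *: c) = k y z.
  by rewrite /k cubD !cubZ !triE; ring.
have PE y z : P y z = (- k y z) *: v + (3 * q y z) *: (y *: b + z *: c).
  by rewrite /P scalerDr !scalerA addrA.
have mem y z : y *: b + z *: c \in T by rewrite memvD ?memvZ.
have PS y z : cub a (P y z) = 0.
  by rewrite PE cubD !cubZ !triZl !triZm !triZr vS (vv _ (mem y z)) qE kE; ring.
have Fvw y z : (y != 0) || (z != 0) -> free [:: v; y *: b + z *: c].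
  move=> yz; apply/(free2P _ v0) => x; apply: contraL yz => /eqP e.
  have [|_ -> -> _] := Bas (- x) y z 0; [|by rewrite eqxx].
  by rewrite /comb scale0r addr0 scaleNr -addrA e addNr.
have done_at y z : (y != 0) || (z != 0) -> \det (\matrix_(i, j) a (P y z) (delta_mx 0 i) (delta_mx 0 j)) = 0 ->
    has_line \/ exists o w, [/\ o != 0, w != 0, cub a o = 0 & forall u, a o w u = 0].
  move=> yz /eqP/det0P[w w0 Hw]; have [P0|P0] := eqVneq (P y z) 0.
    left; have := lin2_eq0 (Fvw y z yz) (etrans (esym (PE y z)) P0) => -[/eqP + /eqP].
    rewrite oppr_eq0 mulf_eq0 (negPf n3) /= => /eqP k0 /eqP q0.
    exists <<[:: v; (y *: b + z *: c)%R]>>%VS; apply: sline_span2.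
    - exact: Fvw.
    - exact: vS.
    - exact: vv.
    - by rewrite qE.
    - by rewrite kE.
  right; exists (P y z), w; split=> // u; apply: tri_vanish_delta => j.
  have := congr1 (fun M : 'rV_4 => M 0 j) Hw; rewrite !mxE => e; rewrite -[RHS]e.
  rewrite {1}[w]row_sum_delta (triC12 a (P y z)).
  elim/big_rec2: _ => [|i x1 x2 _ IH]; first by rewrite tri0l.
  by rewrite triDl triZl IH (triC12 a (delta_mx 0 i)) !mxE.
pose kp := (cub a b)%:P + (3 * a b b c)%:P * 'X + (3 * a b c c)%:P * 'X^2 + (cub a c)%:P * 'X^3.
pose qp := (a v b b)%:P + (2 * a v b c)%:P * 'X + (a v c c)%:P * 'X^2.
pose kr := (cub a c)%:P + (3 * a b c c)%:P * 'X + (3 * a b b c)%:P * 'X^2 + (cub a b)%:P * 'X^3.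
pose qr := (a v c c)%:P + (2 * a v b c)%:P * 'X + (a v b b)%:P * 'X^2.
pose d (i : 'I_4) : V := delta_mx 0 i.
(* The matrices of the polar quadric at [P] in the two charts (1 : x) and (x : 1). Their entries are
   cubic in x, hence the exponent 12 that relates the two determinants. *)
pose M1 := \matrix_(i < 4, j < 4) (- kp * (a v (d i) (d j))%:P + 3 * qp * (a b (d i) (d j))%:P
  + 3 * qp * 'X * (a c (d i) (d j))%:P).
pose M2 := \matrix_(i < 4, j < 4) (- kr * (a v (d i) (d j))%:P + 3 * qr * 'X * (a b (d i) (d j))%:P
  + 3 * qr * (a c (d i) (d j))%:P).
have hdet (M : 'M[{poly K}]_4) x : (\det M).[x] = \det (\matrix_(i, j) (M i j).[x]).
  by rewrite -horner_evalE -det_map_mx; congr (\det _); apply/matrixP => i j; rewrite !mxE.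
pose hE := (hornerD, hornerN, hornerM, hornerXn, hornerX, hornerC, hornerMn).
have E1 x : (\det M1).[x] = \det (\matrix_(i, j) a (P 1 x) (d i) (d j)).
  rewrite hdet; congr (\det _); apply/matrixP => i j; rewrite !mxE.
  by rewrite /P /kp /qp !hE !triE /k /q; ring.
have E2 x : (\det M2).[x] = \det (\matrix_(i, j) a (P x 1) (d i) (d j)).
  rewrite hdet; congr (\det _); apply/matrixP => i j; rewrite !mxE.
  by rewrite /P /kr /qr !hE !triE /k /q; ring.
have [|[x Dx]|D0] := @reciprocal_root (\det M1) (\det M2) 12 isT.
- move=> x x0; have -> : x ^+ 12 = (x ^+ 3) ^+ 4 by rewrite -exprM.
  rewrite E1 E2 -detZ; congr (\det _).
  by apply/matrixP => i j; rewrite !mxE /P !triE /k /q; field.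
- by apply: (done_at 1 x); rewrite ?oner_eq0 // -E1.
by apply: (done_at 0 1); rewrite ?oner_eq0 ?orbT // -E2.
Qed.
End LineExistence.

(** * Normal form at a cuspidal tangent section, and a line through it *)

Section CuspidalSection.
Variables (K : closedFieldType) (a : triform K).
Hypothesis charK : [pchar K] =i pred0.
Hypothesis smooth : ~ sing a.
Local Notation V := 'rV[K]_4.
Implicit Types (u v w b : V) (L M U A B : {vspace V}).

Let natK n : n.+1%:R != 0 :> K := natS_neq0 charK n.
Let n2 : (2 : K) != 0 := natK 1.
Let n3 : (3 : K) != 0 := natK 2.

(** As [a o w] vanishes identically, [w] is tangent at [o] and the tangent section is a cuspidal
    cubic with cusp [o] and cuspidal tangent the line [o w], here x^2 z = y^3, unless a line
    appears. *)
Lemma cusp_form : has_line a \/ exists e1 e2 e3 e4 g1 g2 g3 g4 g5 g6,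
  basis4 e1 e2 e3 e4 /\ forall x y z t, cub a (comb e1 e2 e3 e4 x y z t) =
    x ^+ 2 * z - y ^+ 3 + t * (z ^+ 2 + g1 * y * z + g2 * x ^+ 2 + g3 * x * y)
    + t ^+ 2 * (g4 * x + g5 * y) + g6 * t ^+ 3.
Proof.
case: (parabolic_point charK smooth) => [|[o [w [o0 w0 oS ow]]]]; first by left.
have Fow : free [:: o; w].
  apply/(free2P _ o0) => c; apply: contra_notN smooth => /eqP wE; exists o => // u.
  have c0 : c != 0 by apply: contra w0 => /eqP c0; rewrite wE c0 scale0r.
  by apply: (mulfI c0); rewrite mulr0 -triZm -wE ow.
have [T dT mT] := tangent_plane smooth o0.
have oT : o \in T by rewrite mT; apply/eqP.
have wT : w \in T by rewrite mT triC23 ow.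
have [u [n [uT nT Bas]]] := flag_basis Fow oT wT dT.
have oou : a o o u = 0 by apply/eqP; rewrite -mT.
have nu0 : a o o n != 0 by rewrite -mT.
(* In this case the tangent section is a cone with vertex [o], made of lines. The next case,
   [cub a w = 0], puts the line [o w] on the surface. *)
have [al0|al0] := eqVneq (a o u u) 0.
  left; have [x [y [nz e]]] := cubic_root (cub a u) (3 * a w u u) (3 * a w w u) (cub a w).
  exists <<[:: o; (x *: w + y *: u)%R]>>%VS; apply: sline_span2 => //.
  - apply/(free2P _ o0) => c; apply: contraL nz => /eqP c0.
    have [|_ -> -> _] := Bas (- c) x y 0; last by rewrite eqxx.
    by rewrite /comb scale0r addr0 scaleNr -addrA c0 addNr.
  - by rewrite triDr !triZr oou (triC23 a o o w) ow; ring.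
  - by rewrite !triE (triC23 a o u w) !ow al0; ring.
  - by rewrite cubD !cubZ !triE -[RHS]e; ring.
have [be0|be0] := eqVneq (cub a w) 0.
  left; exists <<[:: o; w]>>%VS; apply: sline_span2 => //.
  by rewrite triC23 ow.
right.
have owr x : a o x w = 0 by rewrite triC23 ow.
(* These corrections kill, in order, the terms x y^2, x^2 y and x^3 of the section, then x z t and
   y^2 t together, and finally z t^2. *)
have [u1 u1E] : {x : V | x = u + (- a w w u / cub a w) *: w} by eexists.
have [w1 w1E] : {x : V | x = w + (- a w u1 u1 / a o u u) *: o} by eexists.
have [u2 u2E] : {x : V | x = u1 + (- cub a u1 / (3 * a o u u)) *: o} by eexists.
have [n1 n1E] : {x : V | x = n + (- a o u2 n / a o u u) *: u2 + (- a w1 w1 n / cub a w) *: w1} by eexists.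
have [n2' n2'E] : {x : V | x = n1 + (- a o n1 n1 / (2 * a o o n)) *: o} by eexists.
have wwu1 : a w w u1 = 0 by rewrite u1E triDr triZr -/(cub a w); field.
have ou1 x : a o u1 x = a o u x by rewrite u1E triDm triZm ow mulr0 addr0.
have ou1u1 : a o u1 u1 = a o u u by rewrite ou1 triC23 ou1.
have oou1 : a o o u1 = 0 by rewrite triC23 ou1 triC23.
have ow1 x : a o w1 x = (- a w u1 u1 / a o u u) * a o o x.
  by rewrite w1E triDm triZm ow add0r.
have w1u1u1 : a w1 u1 u1 = 0 by rewrite w1E triDl triZl ou1u1; field.
have w1w1u1 : a w1 w1 u1 = 0.
  by rewrite w1E !triE (triC12 a w o) !ow oou1 wwu1; ring.
have ooo : a o o o = 0 := oS.
have cw1 : cub a w1 = cub a w.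
  by rewrite w1E cubD cubZ !triE (triC13 a w w o) (triC13 a w o o) ow owr oS; ring.
have oow1 : a o o w1 = 0 by rewrite triC23 ow1 ooo mulr0.
have w1w1o : a w1 w1 o = 0 by rewrite triC13 ow1 oow1 mulr0.
have w1oo : a w1 o o = 0 by rewrite triC13.
have w1u1o : a w1 u1 o = 0 by rewrite triC13 (triC23 a o u1 w1) ow1 oou1 mulr0.
have w1w1u2 : a w1 w1 u2 = 0 by rewrite u2E triDr triZr w1w1u1 w1w1o mulr0 addr0.
have w1u2u2 : a w1 u2 u2 = 0.
  by rewrite u2E !triE w1u1u1 w1u1o (triC23 a w1 o u1) w1u1o w1oo; ring.
have u1u1o : a u1 u1 o = a o u u by rewrite triC13.
have cu2 : cub a u2 = 0.
  by rewrite u2E cubD cubZ !triE u1u1o (triC13 a u1) oou1 oS; field; rewrite n3 al0.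
have ou2 x : a o u2 x = a o u x + (- cub a u1 / (3 * a o u u)) * a o o x.
  by rewrite u2E triDm triZm ou1.
have oou2 : a o o u2 = 0 by rewrite u2E triDr triZr oou1 ooo; ring.
have ou2u2 : a o u2 u2 = a o u u.
  by rewrite ou2 oou2 (triC23 a o u u2) ou2 oou; ring.
have ou2w1 : a o u2 w1 = 0 by rewrite (triC23 a o u2 w1) ow1 oou2 mulr0.
have oon1 : a o o n1 = a o o n by rewrite n1E !triE oou2 oow1; ring.
have ou2n1 : a o u2 n1 = 0 by rewrite n1E !triE ou2u2 ou2w1 mulr0; field.
have w1w1n1 : a w1 w1 n1 = 0 by rewrite n1E !triE w1w1u2 -/(cub a w1) cw1 mulr0; field.
have oon2 : a o o n2' = a o o n by rewrite n2'E triDr triZr oon1 ooo; ring.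
have ou2n2 : a o u2 n2' = 0 by rewrite n2'E triDr triZr ou2n1 (triC23 a o u2 o) oou2; ring.
have w1w1n2 : a w1 w1 n2' = 0 by rewrite n2'E triDr triZr w1w1n1 w1w1o; ring.
have on2n2 : a o n2' n2' = 0.
  by rewrite n2'E !triE (triC23 a o n1 o) oon1 ooo; field; rewrite nu0 n2.
have [m m3] : exists m, m ^+ 3 = - (cub a w)^-1.
  have [m] := @solve_monicpoly K 3%N (nth 0 [:: - (cub a w)^-1; 0; 0]) isT.
  by rewrite !big_ord_recl big_ord0 /= => e; exists m; rewrite e !mul0r !addr0 mulr1.
have m0 : m != 0.
  by apply: contra_eq_neq m3 => ->; rewrite expr0n eq_sym oppr_eq0 invr_eq0.
(* The scalars [m], [ze] and [et] normalise the coefficients of y^3, x^2 z and z^2 t to -1, 1 and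
   1. *)
pose ze := (3 * a o u u)^-1; pose et := 3 * a o u u ^+ 2 / a o o n.
have ze0 : ze != 0 by rewrite invr_eq0 mulf_neq0.
have et0 : et != 0 by rewrite !mulf_neq0 ?invr_eq0 ?expf_neq0.
exists u2, (m *: w1), (ze *: o), (et *: n2'), (6 * (m * (ze * (et * a w1 o n2')))),
  (3 * (et * a u2 u2 n2')), (6 * (m * (et * a u2 w1 n2'))), (3 * (et * (et * a u2 n2' n2'))),
  (3 * (m * (et * (et * a w1 n2' n2')))), (et ^+ 3 * cub a n2').
split; last first.
  move=> x y z t; rewrite cub_comb !triZl !triZm !triZr.
  have -> : a u2 u2 u2 = 0 by exact: cu2.
  have -> : a w1 w1 w1 = cub a w by exact: cw1.
  rewrite ooo (triC13 a u2 u2 w1) w1u2u2 (triC13 a u2 u2 o) ou2u2.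
  rewrite (triC13 a u2 w1 w1) w1w1u2 w1w1o w1w1n2 (triC13 a u2 o o) oou2 w1oo oon2 on2n2.
  rewrite (triC13 a u2 w1 o) (triC23 a o w1 u2) ou2w1 (triC12 a u2 o) ou2n2.
  have -> : m * (m * (m * cub a w)) = -1.
    by rewrite mulrA mulrA -expr2 -exprSr m3 mulNr mulVf.
  rewrite /cub /et /ze; field; rewrite ?al0 ?nu0 ?n3 //.
have dE x y z t : comb u2 (m *: w1) (ze *: o) (et *: n2') x y z t =
  comb o w u n (x * (- cub a u1 / (3 * a o u u)) + y * m * (- a w u1 u1 / a o u u) + z * ze
    + t * et * ((- a o u2 n / a o u u) * (- cub a u1 / (3 * a o u u)) + (- a w1 w1 n / cub a w) * (- a w u1 u1 / a o u u) + (- a o n1 n1 / (2 * a o o n))))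
  (x * (- a w w u / cub a w) + y * m + t * et * ((- a o u2 n / a o u u) * (- a w w u / cub a w) + (- a w1 w1 n / cub a w)))
  (x + t * et * (- a o u2 n / a o u u)) (t * et).
  move: n2'E n1E u2E w1E u1E; set A := - a o u2 n / _; set B := - a w1 w1 n / _.
  set C := - a o n1 n1 / _; set D := - a w u1 u1 / _.
  set E := - cub a u1 / _; set F := - a w w u / _.
  move: A B C D E F => A B C D E F -> -> -> -> ->.
  by rewrite /comb; apply/rowP => i; rewrite !mxE; ring.
move=> x y z t; rewrite dE => /Bas[+ + + /eqP]; rewrite mulf_eq0 (negPf et0) orbF => + + + /eqP t0.
rewrite t0 !mul0r !addr0 => + + x0; rewrite x0 !mul0r !add0r => + /eqP.
rewrite mulf_eq0 (negPf m0) orbF => + /eqP y0; rewrite y0 !mul0r add0r => /eqP.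
by rewrite mulf_eq0 (negPf ze0) orbF => /eqP z0; split.
Qed.

(* [res23] is the resultant of [b2 y^2 + b1 y + b0] and of the cubic with
   elementary symmetric functions [e1], [e2], [e3]. *)
Definition res23 (R : pzRingType) (b0 b1 b2 e1 e2 e3 : R) :=
  b0 ^+ 3 + b0 ^+ 2 * b1 * e1 + b0 ^+ 2 * b2 * (e1 ^+ 2 - 2 * e2) + b0 * b1 ^+ 2 * e2
  + b0 * b1 * b2 * (e1 * e2 - 3 * e3) + b0 * b2 ^+ 2 * (e2 ^+ 2 - 2 * e1 * e3)
  + b1 ^+ 3 * e3 + b1 ^+ 2 * b2 * e1 * e3 + b1 * b2 ^+ 2 * e2 * e3 + b2 ^+ 3 * e3 ^+ 2.

(** The resultant is the product of the values of the quadratic polynomial at the three roots of the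
    cubic, so one of these values is zero. *)
Lemma res23_root (b0 b1 b2 e1 e2 e3 : K) : res23 b0 b1 b2 e1 e2 e3 = 0 ->
  exists y, b2 * y ^+ 2 + b1 * y + b0 = 0 /\ y ^+ 3 = e1 * y ^+ 2 - e2 * y + e3.
Proof.
have [y1] := @solve_monicpoly K 3%N (nth 0 [:: e3; - e2; e1]) isT.
rewrite !big_ord_recl big_ord0 /= /bump /= => y1E.
have [y2 [y3 [s23 p23]]] := Vieta2 (e1 - y1) (y1 ^+ 2 - e1 * y1 + e2).
have E1 : e1 = y1 + y2 + y3 by rewrite -addrA s23; ring.
have E2 : e2 = y1 * y2 + y1 * y3 + y2 * y3 by rewrite p23 E1; ring.
have E3 : e3 = y1 * y2 * y3.
  have -> : e3 = y1 ^+ 3 - e1 * y1 ^+ 2 + e2 * y1 by rewrite y1E; ring.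
  by rewrite E1 E2; ring.
have -> : res23 b0 b1 b2 e1 e2 e3 = (b2 * y1 ^+ 2 + b1 * y1 + b0)
  * (b2 * y2 ^+ 2 + b1 * y2 + b0) * (b2 * y3 ^+ 2 + b1 * y3 + b0).
  by rewrite /res23 E1 E2 E3; ring.
move=> /eqP; rewrite !mulf_eq0 => /orP[/orP[]|] /eqP e; [exists y1 | exists y2 | exists y3].
all: by split=> //; rewrite E1 E2 E3; ring.
Qed.

(* The line joins the point (1, s, s^3, 0) of the cuspidal tangent section to
   (0, y, z, 1); eliminating [z] and [y] leaves a polynomial of degree 27 in [s]. *)
Lemma cusp_line (g1 g2 g3 g4 g5 g6 : K) : exists s y z,
  [/\ z - 3 * s ^+ 2 * y + (s ^+ 6 + g1 * s ^+ 4 + g3 * s + g2) = 0,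
     - 3 * s * y ^+ 2 + (2 * s ^+ 3 * z + g1 * (s * z + s ^+ 3 * y) + g3 * y)
       + (g4 + g5 * s) = 0
   & - y ^+ 3 + (z ^+ 2 + g1 * y * z) + g5 * y + g6 = 0].
Proof.
pose c (x : K) := x%:P.
have [m mE] : {m | m = 'X^6 + c g1 * 'X^4 + c g3 * 'X + c g2} by eexists.
have [m' m'E] : {m | m = 1 + c g1 * 'X^2 + c g3 * 'X^5 + c g2 * 'X^6} by eexists.
(* The first equation gives z = 3 s^2 y - m(s); substituted in the others, it leaves a quadratic and
   a monic cubic in y. Here [p] is their resultant, and [q] is built from the reversed coefficients:
   the arguments of [res23] have weights 9, 5, 1, 4, 8, 12, for which it is homogeneous of weight
   27. *)
pose p := res23 (- 2 * 'X^3 * m - c g1 * 'X * m + c g4 + c g5 * 'X)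
  (6 * 'X^5 + 4 * c g1 * 'X^3 + c g3) (- 3 * 'X) (9 * 'X^4 + 3 * c g1 * 'X^2)
  (6 * 'X^2 * m + c g1 * m - c g5) (m ^+ 2 + c g6).
pose q := res23 (- 2 * m' - c g1 * 'X^2 * m' + c g4 * 'X^9 + c g5 * 'X^8)
  (6 + 4 * c g1 * 'X^2 + c g3 * 'X^5) (- 3) (9 + 3 * c g1 * 'X^2)
  (6 * m' + c g1 * 'X^2 * m' - c g5 * 'X^8) (m' ^+ 2 + c g6 * 'X^12).
pose hE := (hornerD, hornerN, hornerM, hornerXn, hornerX, hornerC, hornerMn, horner_exp).
have hres (b0 b1 b2 e1 e2 e3 : {poly K}) x : (res23 b0 b1 b2 e1 e2 e3).[x] =
    res23 b0.[x] b1.[x] b2.[x] e1.[x] e2.[x] e3.[x].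
  by rewrite /res23 !hE.
have scale (s b0 b1 b2 e1 e2 e3 : K) : res23 (s ^+ 9 * b0) (s ^+ 5 * b1) (s * b2)
    (s ^+ 4 * e1) (s ^+ 8 * e2) (s ^+ 12 * e3) = s ^+ 27 * res23 b0 b1 b2 e1 e2 e3.
  by rewrite /res23; ring.
have res23_eq (b0 b1 b2 e1 e2 e3 b0' b1' b2' e1' e2' e3' : K) : b0 = b0' -> b1 = b1' -> b2 = b2' ->
    e1 = e1' -> e2 = e2' -> e3 = e3' -> res23 b0 b1 b2 e1 e2 e3 = res23 b0' b1' b2' e1' e2' e3'.
  by do 6!move=> ->.
have mm' x : x != 0 -> m.[x] = x ^+ 6 * m'.[x^-1] by move=> x0; rewrite mE m'E /c !hE; field.
have pq x : x != 0 -> p.[x] = x ^+ 27 * q.[x^-1].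
  move=> x0; rewrite !hres -scale /c !hE mm' //.
  move: m'.[_] => M; move: (x^-1) (mulfV x0) => i xi.
  by apply: res23_eq; ring: xi.
have [//|[s]|] := reciprocal_root _ pq; last first.
  (* This value is the coefficient of degree 27 of the eliminant: the root cannot escape to
     infinity. *)
  have -> : q.[0] = 1.
    by rewrite hres m'E /c !hE /res23; ring.
  by move/eqP; rewrite oner_eq0.
rewrite hres => /res23_root[y [e e']]; exists s, y, (3 * s ^+ 2 * y - m.[s]).
rewrite mE /c !hE in e e' *; split.
- by ring.
- by rewrite -[RHS]e; ring.
by rewrite e'; ring.
Qed.

Lemma line_exists : has_line a.
Proof.
case: cusp_form => // -[e1 [e2 [e3 [e4 [g1 [g2 [g3 [g4 [g5 [g6 [Bas F]]]]]]]]]]].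
have [s [y [z [E1 E2 E3]]]] := cusp_line g1 g2 g3 g4 g5 g6.
pose u := comb e1 e2 e3 e4 1 s (s ^+ 3) 0; pose v := comb e1 e2 e3 e4 0 y z 1.
have uv (x w : K) : x *: u + w *: v = comb e1 e2 e3 e4 x (x * s + w * y) (x * s ^+ 3 + w * z) w.
  by rewrite /u /v /comb; apply/rowP => i; rewrite !mxE; ring.
have uv0 (x w : K) : cub a (x *: u + w *: v) = 0.
  rewrite uv F; have := congr2 +%R (congr1 ( *%R (x ^+ 2 * w)) E1)
    (congr2 +%R (congr1 ( *%R (x * w ^+ 2)) E2) (congr1 ( *%R (w ^+ 3)) E3)).
  by rewrite !mulr0 !addr0 => e; apply: (etrans _ e); ring.
have u0 : u != 0 by apply: comb_neq0 => //; rewrite oner_eq0.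
have Fuv : free [:: u; v].
  apply/(free2P _ u0) => x; rewrite -subr_eq0; apply/eqP => e.
  have := uv (- x) 1; rewrite scale1r scaleNr addrC e => /esym/Bas[_ _ _ /eqP].
  by rewrite oner_eq0.
exists <<[:: u; v]>>%VS; split; first by rewrite (eqnP Fuv).
by move=> w /mem_span2[x [x' ->]].
Qed.
End CuspidalSection.

(** * Eckardt points *)

Section Eckardt.
Variables (K : closedFieldType) (a : triform K).
Hypothesis charK : [pchar K] =i pred0.
Hypothesis smooth : ~ sing a.
Local Notation V := 'rV[K]_4.
Implicit Types (u v w b : V) (L M U A B T : {vspace V}).

Let natK n : n.+1%:R != 0 :> K := natS_neq0 charK n.
Let n2 : (2 : K) != 0 := natK 1.
Let n3 : (3 : K) != 0 := natK 2.

(** Without multiple root, the cubic has two independent roots [s] and [r]; in this basis only the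
    terms x^2 y and x y^2 remain, both nonzero. *)
Lemma binary_cubic_split L : \dim L = 2%N ->
  (forall r, r \in L -> r != 0 -> ~ forall u, u \in L -> a r r u = 0) ->
  exists s r C, [/\ free [:: s; r], s \in L, r \in L, C != 0 &
    forall x y, cub a (x *: s + y *: r) = C * (x * y * (x + y))].
Proof.
move=> dL simple; have [s s0 [sL sS]] := cub_zero_on_line a dL.
have [t Fst LE] := dim2_basis dL sL s0.
have tL : t \in L by rewrite LE memv_span ?inE ?eqxx ?orbT.
have nz u v : free [:: u; v] -> u \in L -> v \in L -> cub a u = 0 -> a u u v != 0.
  move=> F uL vL uS; apply/eqP => e.
  have u0 : u != 0 by have := lin2_neq0 F (x := 1) (y := 0); rewrite scale1r scale0r addr0 oner_eq0 => ->.
  apply: (simple u uL u0) => w; rewrite (span2_line dL F uL vL) => /mem_span2[x [y ->]].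
  rewrite triDr !triZr e; have -> : a u u u = 0 by []. by ring.
have [x [y [xy e]]] := quadratic_root (cub a t) (3 * a s t t) (3 * a s s t).
have y0 : y != 0.
  apply: contraL xy => /eqP y0; move: e; rewrite y0 expr0n !mulr0 !addr0 => /eqP.
  by rewrite !mulf_eq0 (negPf n3) (negPf (nz _ _ Fst sL tL sS)) /= => /orP[] /eqP ->; rewrite eqxx.
pose r := x *: s + y *: t.
have rL : r \in L by rewrite memvD ?memvZ.
have rS : cub a r = 0.
  rewrite cubD !cubZ !triE sS; have := congr1 ( *%R y) e; rewrite mulr0 => e'.
  by rewrite -[RHS]e'; ring.
have Fsr : free [:: s; r].
  apply/(free2P _ s0) => c; rewrite -subr_eq0; apply/eqP => e'.
  have := lin2_neq0 Fst (x := x - c) (y := y); rewrite y0 orbT scalerBl addrAC => /(_ isT).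
  by rewrite e' eqxx.
have Frs : free [:: r; s] by rewrite (perm_free (permEl (perm_catC [:: r] [:: s]))).
have p0 := nz _ _ Fsr sL rL sS; have q0 := nz _ _ Frs rL sL rS.
(* Scaling each root vector by the coefficient belonging to the other makes the two remaining
   coefficients equal. *)
exists (a r r s *: s), (a s s r *: r), (3 * a s s r ^+ 2 * a r r s ^+ 2); split.
- have [h1 h2] : a r r s *: s != 0 /\ True by rewrite scaler_eq0 negb_or q0 s0.
  apply/(free2P _ h1) => c; rewrite scalerA -subr_eq0; apply/eqP => e'.
  have := lin2_neq0 Fsr (x := - (c * a r r s)) (y := a s s r).
  by rewrite p0 orbT scaleNr addrC e' eqxx => /(_ isT).
- by rewrite memvZ.
- by rewrite memvZ.
- by rewrite !mulf_neq0 ?expf_neq0.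
move=> x' y'; rewrite cubD !cubZ !triZl !triZm !triZr sS rS (triC13 a s r r); ring.
Qed.

Lemma Eck_polar v u w : Eck a v -> a v v u = 0 -> a v v w = 0 -> a v u w = 0.
Proof.
case=> _ _ E u0 w0; have := E (u + w); rewrite triDr u0 w0 addr0 => /(_ erefl).
rewrite !triE (E u u0) (E w w0) add0r addr0 (triC23 a v w u) => /eqP.
by rewrite -mulr2n -mulr_natl mulf_eq0 (negPf n2) => /eqP.
Qed.

(* The polar quadric of an Eckardt point splits into its tangent plane and the
   fixed plane of the harmonic homology centered at the point. *)
Lemma Eck_factor v : Eck a v -> exists2 m : V -> K, scalar m &
  forall u w, 2 * a v u w = a v v u * m w + a v v w * m u.
Proof.
move=> Ev; have [v0 _ _] := Ev.
have [w l0] : exists w, a v v w != 0.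
  have [T dT mT] := tangent_plane smooth v0.
  have /subvPn[w _] : ~~ (fullv <= T)%VS by apply/negP => /dimvS; rewrite dim_rV4 dT.
  by rewrite mT; exists w.
pose l := a v v w; pose g := a v w w.
pose m u := 2 * a v u w / l - a v v u * g / l ^+ 2.
exists m; first by move=> c u u'; rewrite /m !triE; ring.
move=> u u'; have := @Eck_polar v (u - (a v v u / l) *: w) (u' - (a v v u' / l) *: w) Ev.
rewrite !triE => /(_ _ _)/(congr1 ( *%R 2)); rewrite mulr0 -/l -/g (triC23 a v w u') => e.
apply/eqP; rewrite -subr_eq0 -[X in _ == X]e; last 2 first.
- by rewrite /l; field.
- by rewrite /l; field.
by apply/eqP; rewrite /m; field.
Qed.

(** The tangent section is the cone with vertex [v] over the cubic on a complementary line. A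
    multiple root [r] of that cubic would make the tangent plane tangent along the line [v r], so it
    has three distinct roots. *)
Lemma Eck_tritan v : Eck a v -> exists T L1 L2 L3, [/\ forall u, (u \in T) = (a v v u == 0),
  tritan a T L1 L2 L3 & [/\ v \in L1, v \in L2 & v \in L3]].
Proof.
move=> Ev; have [v0 vS E] := Ev; have [T dT mT] := tangent_plane smooth v0.
have vT : v \in T by rewrite mT; apply/eqP.
have polar u w : u \in T -> w \in T -> a v u w = 0.
  by rewrite !mT => /eqP uT /eqP wT; apply: Eck_polar.
have vv u : u \in T -> a v v u = 0 by rewrite mT => /eqP.
have /subvPn[b bT bv] : ~~ (T <= <[v]>)%VS.
  by apply/negP => /dimvS; rewrite dim_vline v0 dT.
have Fvb : free [:: v; b].
  by apply/(free2P _ v0) => c; apply: contra bv => /eqP ->; rewrite memvZ ?memv_line.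
have [c [n [cT nT Bas]]] := flag_basis Fvb vT bT dT.
have Fbc : free [:: b; c].
  have b0 : b != 0 by apply: contra bv => /eqP ->; rewrite mem0v.
  apply/(free2P _ b0) => x; rewrite -subr_eq0; apply/eqP => e.
  have [|_ _ /eqP] := Bas 0 (- x) 1 0; last by rewrite oner_eq0.
  by rewrite /comb !scale0r addr0 add0r scale1r scaleNr addrC.
have LT : (<<[:: b; c]>> <= T)%VS.
  by apply/span_subvP => x; rewrite !inE => /orP[] /eqP ->.
have [|r rL r0 rz|s [r [C [Fsr sL rL C0 F]]]] := @binary_cubic_split <<[:: b; c]>>%VS.
- by rewrite (eqnP Fbc).
- have rT := subvP LT _ rL; have Fvr : free [:: v; r].
    move/mem_span2: rL r0 => [x [y ->]] r0; apply/(free2P _ v0) => k.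
    rewrite -subr_eq0; apply: contra r0 => /eqP e.
    have [|_ -> -> _] := Bas (- k) x y 0; last by rewrite !scale0r addr0.
    by rewrite /comb scale0r addr0 scaleNr -addrA addrC.
  apply: smooth; apply: (sing_flag dT (L := <<[:: v; r]>>%VS)); first by rewrite (eqnP Fvr).
  move=> w u /mem_span2[x [y ->]] uT.
  have [x' [y' [z' [t' uE]]]] := basis4_span Bas u.
  have t0 : t' = 0.
    apply: contraNeq nT => t0; rewrite -[n]scale1r -(mulVf t0) -scalerA memvZ //.
    have -> : t' *: n = u - (x' *: v + y' *: b + z' *: c) by rewrite uE /comb [X in X - _]addrC addrK.
    by rewrite memvB // !memvD ?memvZ.
  have rru : a r r u = 0.
    rewrite uE t0 /comb scale0r addr0 !triDr !triZr (triC13 a r r v) polar // mulr0 add0r.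
    by rewrite !rz ?memv_span ?inE ?eqxx ?orbT // !mulr0 addr0.
  by rewrite !triE (vv u) // rru (triC12 a r v) polar //; ring.
have sT := subvP LT _ sL; have rT := subvP LT _ rL.
have Bas' : basis4 v s r n.
  move=> x y z t e; have t0 : t = 0.
    apply: contraNeq nT => t0; rewrite -[n]scale1r -(mulVf t0) -scalerA memvZ //.
    move/eqP: e; rewrite /comb addrC addr_eq0 => /eqP ->.
    by rewrite memvN !memvD ?memvZ.
  have yzL : y *: s + z *: r \in <<[:: b; c]>>%VS by rewrite memvD ?memvZ.
  move/mem_span2: (yzL) => [y' [z' yzE]]; move: e; rewrite /comb t0 -[_ + _ + z *: r]addrA yzE.
  rewrite addrA => /Bas[x0 y0 z0 _]; move: yzE; rewrite y0 z0 !scale0r addr0.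
  by move=> /(lin2_eq0 Fsr)[-> ->].
have [f1 [f2 [f3 [f4 [[s1 s2 s3 s4] E1 E2]]]]] := basis4_coords Bas'.
have mT4 u : u \in T -> f4 u = 0.
  move=> uT; apply: contraNeq nT => t0; rewrite -[n]scale1r -(mulVf t0) -scalerA memvZ //.
  have -> : f4 u *: n = u - (f1 u *: v + f2 u *: s + f3 u *: r) by rewrite {2}[u]E1 /comb [X in X - _]addrC addrK.
  by rewrite memvB // !memvD ?memvZ.
have [] := @tritan_of_factors K a charK smooth T f2 f3 (fun u => C * (f2 u + f3 u)) dT s2 s3.
- by move=> x u w; have /= -> := s2 x u w; have /= -> := s3 x u w; ring.
- move=> u uT; rewrite {1}[u]E1 /comb (mT4 u uT) scale0r addr0 -addrA cubD cubZ vS.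
  rewrite !triZl !triZm (vv _ _) ?polar ?memvD ?memvZ // F; ring.
move=> L1 [L2 [L3 [tL mL]]]; exists T, L1, L2, L3; split=> //.
have [-> -> ->] := mL v; rewrite vT /=.
have vE : v = comb v s r n 1 0 0 0 by rewrite /comb scale1r !scale0r !addr0.
have [_ f20 f30 _] := E2 1 0 0 0; move: f20 f30; rewrite -vE => -> ->.
by rewrite addr0 mulr0 eqxx.
Qed.

Lemma sline_through_Eck v T L1 L2 L3 M : (forall u, (u \in T) = (a v v u == 0)) ->
  tritan a T L1 L2 L3 -> v != 0 -> v \in L1 -> v \in L2 -> v \in L3 ->
  sline a M -> v \in M -> [\/ M = L1, M = L2 | M = L3].
Proof.
move=> mT [dT [s1 s2 s3] _ _ z] v0 v1 v2 v3 sM vM.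
have [u F ME] := dim2_basis sM.1 vM v0.
have uM : u \in M by rewrite ME memv_span ?inE ?eqxx ?orbT.
have uT : u \in T by rewrite mT (sline_tangent charK sM).
case: (z u uT (sM.2 u uM)) => uL.
- by constructor 1; apply: (same_line sM.1 s1.1 F).
- by constructor 2; apply: (same_line sM.1 s2.1 F).
- by constructor 3; apply: (same_line sM.1 s3.1 F).
Qed.

End Eckardt.

(** * Commuting homologies: at most two Eckardt points *)

Section FewEckardtPoints.
Variables (K : closedFieldType) (a : triform K).
Hypothesis charK : [pchar K] =i pred0.
Hypothesis smooth : ~ sing a.
Local Notation V := 'rV[K]_4.
Implicit Types (u v w b P Q R : V) (L M U A B T : {vspace V}).

Let natK n : n.+1%:R != 0 :> K := natS_neq0 charK n.
Let n2 : (2 : K) != 0 := natK 1.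

Definition has_form (g : K -> K -> K -> K -> K) := exists e1 e2 e3 e4 k,
  [/\ basis4 e1 e2 e3 e4, k != 0 & forall x y z t,
      cub a (comb e1 e2 e3 e4 x y z t) = k * g x y z t].

Definition Eck_list (s : seq V) :=
  [/\ pairwise (fun u v => free [:: u; v]) s, forall v, v \in s -> Eck a v
    & forall v, Eck a v -> exists2 u, u \in s & v \in <[u]>%VS].

Lemma EckZ c v : c != 0 -> Eck a v -> Eck a (c *: v).
Proof.
move=> c0 [v0 vS E]; split; first by rewrite scaler_eq0 negb_or c0 v0.
  by rewrite cubZ vS mulr0.
move=> u; rewrite !triZl triZm => /eqP; rewrite !mulf_eq0 (negPf c0) /= => /eqP uT.
by rewrite E // mulr0.
Qed.

Lemma not_free2 u v : u != 0 -> ~~ free [:: u; v] -> v \in <[u]>%VS.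
Proof.
move=> u0; apply: contraNT => nv; apply/(free2P _ u0) => c.
by apply: contra nv => /eqP ->; rewrite memvZ ?memv_line.
Qed.

(** Commutation of the homologies is expressed by [a P P Q = 0]. Factoring both polar quadrics,
    a(P,Q,w) is a multiple of a(P,P,w) and of a(Q,Q,w). If it were not zero, these two forms would
    be proportional, and the gradient along the line PQ would be a quadratic form times a fixed
    covector: a root of the quadratic form is singular. *)
Lemma commuting_conj P Q : Eck a P -> Eck a Q -> free [:: P; Q] -> a P P Q = 0 ->
  forall w, a P Q w = 0.
Proof.
move=> EP EQ F PQ.
have QP : a Q Q P = 0 by rewrite triC13; have [_ _ ->] := EP.
have [m _ mE] := Eck_factor charK smooth EP; have [n _ nE] := Eck_factor charK smooth EQ.
have Pm w : 2 * a P Q w = a P P w * m Q by rewrite mE PQ mul0r add0r.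
have Qn w : 2 * a P Q w = a Q Q w * n P by rewrite triC12 nE QP mul0r add0r.
suff m0 : m Q = 0 by move=> w; apply: (mulfI n2); rewrite mulr0 Pm m0 mulr0.
apply/eqP/negPn/negP => m0; apply: smooth.
pose c := n P / m Q.
have lE w : a P P w = c * a Q Q w.
  by apply: (mulIf m0); rewrite -Pm Qn /c mulrAC divfK // mulrC.
have [x [y [nz e]]] := quadratic_root 1 (n P) c.
exists (x *: P + y *: Q); first exact: lin2_neq0.
move=> w; rewrite !triE (triC12 a Q P) lE; have := Qn w => e2.
have := congr1 ( *%R (a Q Q w)) e; rewrite mulr0 => e'; rewrite -[RHS]e'.
apply/eqP; rewrite -subr_eq0; apply/eqP.
have -> : x * (x * (c * a Q Q w)) + x * (y * a P Q w) + (y * (x * a P Q w) + y * (y * a Q Q w))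
  - a Q Q w * (c * x ^+ 2 + n P * x * y + 1 * y ^+ 2) = x * y * (2 * a P Q w - a Q Q w * n P) by ring.
by rewrite e2 subrr mulr0.
Qed.

(** A common tangent plane at [P] and [Q] would be tangent along the whole line joining them, by
    [commuting_conj]. *)
Lemma tangent_planes_neq P Q : Eck a P -> Eck a Q -> free [:: P; Q] -> a P P Q = 0 ->
  exists2 w, a P P w = 0 & a Q Q w != 0.
Proof.
move=> EP EQ F PQ; have PQ0 := commuting_conj EP EQ F PQ.
have [[P0 _ _] [Q0 _ _]] := (EP, EQ).
have [T dT mT] := tangent_plane smooth P0; have [T' dT' mT'] := tangent_plane smooth Q0.
have [|/subvPn[w]] := boolP (T <= T')%VS; last by rewrite mT mT' => /eqP; exists w.
move=> TT'; case: smooth; apply: (sing_flag dT (L := <<[:: P; Q]>>%VS)); first by rewrite (eqnP F).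
move=> v u /mem_span2[x [y ->]] uT; have := subvP TT' _ uT; rewrite mT' => /eqP uQ.
move: uT; rewrite mT => /eqP uP.
by rewrite !triE (triC12 a Q P) PQ0 uP uQ; ring.
Qed.

(** All mixed terms vanish by [commuting_conj]. If the points are collinear, this makes [P] or [Q]
    singular or [R] proportional to one of them; otherwise the plane that they span lies on the
    surface. *)
Lemma no_three_commuting P Q R : Eck a P -> Eck a Q -> Eck a R ->
  free [:: P; Q] -> free [:: P; R] -> free [:: Q; R] ->
  a P P Q = 0 -> a P P R = 0 -> a Q Q R = 0 -> False.
Proof.
move=> EP EQ ER FPQ FPR FQR PQ PR QR.
have PQ0 := commuting_conj EP EQ FPQ PQ; have PR0 := commuting_conj EP ER FPR PR.
have QR0 := commuting_conj EQ ER FQR QR.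
have [[P0 PS _] [Q0 QS _] [_ RS _]] := And3 EP EQ ER.
have [RL|RL] := boolP (R \in <<[:: P; Q]>>%VS).
  move/mem_span2: RL => [x [y RE]]; have [x0|x0] := eqVneq x 0.
    by move/(free2P _ Q0)/(_ y): FQR; rewrite RE x0 scale0r add0r eqxx.
  apply: smooth; exists P => // w; have := PR0 w; rewrite RE triDm !triZm PQ0 mulr0 addr0.
  by move=> /eqP; rewrite mulf_eq0 (negPf x0) => /eqP.
have dU : \dim (<<[:: P; Q]>> + <[R]>)%VS = 3%N.
  have : free [:: R; P; Q] by rewrite free_cons RL.
  by move=> /eqnP e; apply: (etrans _ e); rewrite [in RHS]span_cons addvC.
apply: (no_plane charK smooth dU) => v /memv_addP[_ /mem_span2[x [y ->]] [_ /vlineP[z ->] ->]].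
rewrite !cubD !cubZ !triE PS QS RS (triC12 a Q P) !PQ0 !PR0 !QR0.
rewrite PQ PR QR; ring.
Qed.

Lemma Lset_params A B B' C C' U1 U2 : tritan a U1 A B B' -> tritan a U2 A C C' ->
  U1 != U2 -> exists e1 e2 e3 e4, [/\ Lbasis a e1 e2 e3 e4,
    (e4 \in A) && (e4 \in B) & (e3 \in A) && (e3 \in C)].
Proof.
move=> t1 t2 n12; have [_ [sA sB _] _ _ _] := t1.
have [U3 [D [D' [t3 n31 n32]]]] := third_plane charK smooth U1 U2 sA.
have [W [E [E' [tW nW _]]]] := third_plane charK smooth U1 U1 sB.
have [] := Lset_of_planes charK smooth t1 t2 t3 tW n12; rewrite 1?eq_sym //.
by move=> D0 [E0 [_ /(Lset_basis charK)]].
Qed.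

(* Eckardt points whose homologies commute lie on a common line of the surface,
   and three of them never commute pairwise. *)
Lemma few_Eckardt (s3 s5 : K) : (forall P Q, Eck a P -> Eck a Q -> a P P Q = 0) ->
  exists s p, [/\ (size s <= 2)%N, Eck_list s, pc p = 1
    & has_form (cubic_value (Lambda s3 s5 (size s) p))].
Proof.
move=> comm; have eck_S P u v : Eck a P -> a P P u = 0 -> a P P v = 0 -> a P u v = 0.
  by move=> EP; apply: Eck_polar.
have line_eq A B u v : sline a A -> sline a B -> A != B -> u \in A -> u \in B ->
    v \in A -> v \in B -> u != 0 -> v != 0 -> exists2 c : K, c != 0 & v = c *: u.
  move=> sA sB AB uA uB vA vB u0 v0.
  have /vlineP[c vE] : v \in <[u]>%VS.
    apply: not_free2 => //; apply: contra AB => F.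
    by apply/eqP; apply: (same_line sA.1 sB.1 F).
  by exists c => //; apply: contra v0 => /eqP c0; rewrite vE c0 scale0r.
have Lb e1 e2 e3 e4 : Lbasis a e1 e2 e3 e4 -> [/\ a e4 e4 e1 = 0, a e4 e4 e3 = 0,
    a e3 e3 e2 = 0 & a e3 e3 e4 = 0].
  case=> _ z; have [_ h1 h2 _] := vanish_span2 charK (fun x y => and5_rect (fun h _ _ _ _ => h) (z x y)).
  have [_ _ h3 _] := vanish_span2 charK (fun x y => and5_rect (fun _ h _ _ _ => h) (z x y)).
  have [_ _ h4 _] := vanish_span2 charK (fun x y => and5_rect (fun _ _ h _ _ => h) (z x y)).
  by rewrite (triC13 a e4 e4 e1) (triC13 a e4 e4 e3) (triC13 a e3 e3 e2).
have bas_neq0 (e1 e2 e3 e4 : V) : basis4 e1 e2 e3 e4 -> e3 != 0 /\ e4 != 0.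
  move=> B; split; apply/eqP => e0.
    have [|_ _ /eqP] := B 0 0 1 0; last by rewrite oner_eq0.
    by rewrite /comb e0 scaler0 !scale0r !addr0.
  have [|_ _ _ /eqP] := B 0 0 0 1; last by rewrite oner_eq0.
  by rewrite /comb e0 scaler0 !scale0r !addr0.
have [[P EP]|noE] := classic (exists P, Eck a P); last first.
  have [A sA] := line_exists charK smooth.
  have [U1 [B [B' [t1 _ _]]]] := third_plane charK smooth 0 0 sA.
  have [U2 [C [C' [t2 n12 _]]]] := third_plane charK smooth U1 U1 sA.
  have [|e1 [e2 [e3 [e4 [LB _ _]]]]] := Lset_params t1 t2; first by rewrite eq_sym.
  have [b [d [e [f [k [k0 F _ _]]]]]] := Lbasis_params charK smooth LB.
  exists [::], (Params b 1 d e f); split=> //; first by split=> // v Ev; case: noE; exists v.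
  by exists e1, e2, e3, e4, k; split=> //; have [] := LB.
have [P0 _ _] := EP.
have [T [A [B [B' [mT tT [PA PB PB']]]]]] := Eck_tritan charK smooth EP.
have [_ [sA sB _] _ [AB _ _] _] := tT.
have [[Q EQ FPQ]|oneE] := classic (exists2 Q, Eck a Q & free [:: P; Q]); last first.
  (* The L-set is chosen with [A] and [B] two of the lines through [P], so that [e4] represents [P];
     being an Eckardt point, it satisfies [a e1 e3 e4 = 0], the condition of [Lambda1]. *)
  have [U2 [C [C' [t2 n12 _]]]] := third_plane charK smooth T T sA.
  have [|e1 [e2 [e3 [e4 [LB /andP[e4A e4B] _]]]]] := Lset_params tT t2; first by rewrite eq_sym.
  have [Bas _] := LB; have [_ e40] := bas_neq0 _ _ _ _ Bas.
  have [c c0 e4E] := line_eq _ _ _ _ sA sB AB PA PB e4A e4B P0 e40.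
  have [h1 h3 _ _] := Lb _ _ _ _ LB.
  have E4 : Eck a e4 by rewrite e4E; apply: EckZ.
  have [b [d [e [f [k [k0 F bE _]]]]]] := Lbasis_params charK smooth LB.
  exists [:: P], (Params b 1 d e f); split=> //.
    split=> // [v|v Ev]; first by rewrite inE => /eqP ->.
    exists P; rewrite ?inE //; apply: not_free2 => //.
    by apply/negP => F'; case: oneE; exists v.
  exists e1, e2, e3, e4, k; split=> // x y z t; rewrite F bE /=.
    by rewrite expr1n divr1.
  by rewrite triC13 triC23; apply: eck_S.
have PQ := comm P Q EP EQ; have [Q0 _ _] := EQ.
(* The line PQ now plays the part of [A], while [B] and [C] are taken in the tangent planes at [P]
   and [Q]. Then [e4] and [e3] represent [P] and [Q], and both extra conditions hold. *)
have sPQ : sline a <<[:: P; Q]>>%VS.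
  have [_ PS E] := EP; have [_ QS _] := EQ.
  by apply: sline_span2 => //; apply: E.
have PL : P \in <<[:: P; Q]>>%VS by rewrite memv_span ?inE ?eqxx.
have QL : Q \in <<[:: P; Q]>>%VS by rewrite memv_span ?inE ?eqxx ?orbT.
have planeL R : Eck a R -> R \in <<[:: P; Q]>>%VS -> exists U B0 B1,
    [/\ forall u, (u \in U) = (a R R u == 0), tritan a U <<[:: P; Q]>>%VS B0 B1 & R \in B0].
  move=> ER RL; have [R0 _ _] := ER.
  have [U [L1 [L2 [L3 [mU tU [R1 R2 R3]]]]]] := Eck_tritan charK smooth ER.
  case: (sline_through_Eck charK mU tU R0 R1 R2 R3 sPQ RL) => ->.
  - by exists U, L2, L3.
  - by exists U, L1, L3; split=> //; apply: tritan_swap12.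
  - by exists U, L1, L2; split=> //; apply: tritan_swap12; apply: tritan_swap23.
have [U1 [B0 [B1 [m1 t1 PB0]]]] := planeL P EP PL.
have [U2 [C0 [C1 [m2 t2 QC0]]]] := planeL Q EQ QL.
have n12 : U1 != U2.
  have [w wP wQ] := tangent_planes_neq EP EQ FPQ PQ.
  by apply: contra wQ => /eqP U12; rewrite -m2 -U12 m1 wP.
have [e1 [e2 [e3 [e4 [LB /andP[e4A e4B] /andP[e3A e3C]]]]]] := Lset_params t1 t2 n12.
have [Bas _] := LB; have [e30 e40] := bas_neq0 _ _ _ _ Bas.
have [_ [_ sB0 _] _ [AB0 _ _] _] := t1; have [_ [_ sC0 _] _ [AC0 _ _] _] := t2.
have [c c0 e4E] := line_eq _ _ _ _ sPQ sB0 AB0 PL PB0 e4A e4B P0 e40.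
have [c' c'0 e3E] := line_eq _ _ _ _ sPQ sC0 AC0 QL QC0 e3A e3C Q0 e30.
have [h1 h3 h2 h4] := Lb _ _ _ _ LB.
have E4 : Eck a e4 by rewrite e4E; apply: EckZ.
have E3 : Eck a e3 by rewrite e3E; apply: EckZ.
have [b [d [e [f [k [k0 F bE dE]]]]]] := Lbasis_params charK smooth LB.
exists [:: P; Q], (Params b 1 d e f); split=> //.
  split=> [|v|v Ev]; first by rewrite /= FPQ.
    by rewrite !inE => /orP[] /eqP ->.
  have [FPv|] := boolP (free [:: P; v]); last first.
    by move=> nf; exists P; rewrite ?inE ?eqxx //; apply: not_free2.
  exists Q; rewrite ?inE ?eqxx ?orbT //; apply: not_free2 => //; apply/negP => FQv.
  exact: (no_three_commuting EP EQ Ev FPQ FPv FQv PQ (comm _ _ EP Ev) (comm _ _ EQ Ev)).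
exists e1, e2, e3, e4, k; split=> // x y z t; rewrite F bE ?dE /= ?expr1n ?divr1 //.
  by rewrite triC12; apply: eck_S.
by rewrite triC13 triC23; apply: eck_S.
Qed.
End FewEckardtPoints.

(** * Two non-commuting homologies *)

Section NonCommutingPair.
Variables (K : closedFieldType) (a : triform K).
Hypothesis charK : [pchar K] =i pred0.
Hypothesis smooth : ~ sing a.
Local Notation V := 'rV[K]_4.
Implicit Types (u v w b P Q R : V) (L M U A B T W : {vspace V}).

Let natK n : n.+1%:R != 0 :> K := natS_neq0 charK n.
Let n2 : (2 : K) != 0 := natK 1.
Let n3 : (3 : K) != 0 := natK 2.

Lemma cube_root_exists (c : K) : exists m, m ^+ 3 = c.
Proof.
have [m] := @solve_monicpoly K 3%N (nth 0 [:: c; 0; 0]) isT.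
by rewrite !big_ord_recl big_ord0 /= => e; exists m; rewrite e !mul0r !addr0 mulr1.
Qed.

(* [Nform h k] is the normal form of a surface with two non-commuting homologies:
   the third Eckardt point of their line is (1, -1, 0, 0). *)
Definition Nform (h k p q s r : K) :=
  p * q * (p + q + (k - 4) * s + (h - 4) * r) + 4 * h * k * (s * r * (s + r)).

Definition split_form (l : K -> K -> K) (g : K -> K -> K) (p q z t : K) :=
  p * q * (p + q + l z t) + g z t.

(** [W] is the intersection of the two tangent planes. For w in [W], the terms a(P,P,w), a(Q,Q,w),
    a(P,w,w) and a(Q,w,w) all vanish, so the only term mixing [W] with the line PQ is p q l(w). A
    multiple root of the cubic on [W] would be a singular point. *)
Lemma noncommuting_split P Q : Eck a P -> Eck a Q -> a P P Q != 0 ->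
  exists P' Q' (W : {vspace V}), [/\ \dim W = 2%N,
    forall s r, free [:: s; r] -> s \in W -> r \in W -> basis4 P' Q' s r /\
      forall p q x y, cub a (comb P' Q' s r p q x y) =
        split_form (fun x y => 6 * a P' Q' s * x + 6 * a P' Q' r * y)
                   (fun x y => cub a (x *: s + y *: r)) p q x y
    & forall r, r \in W -> r != 0 -> ~ forall u, u \in W -> a r r u = 0].
Proof.
move=> EP EQ al0; have [[P0 PS PE] [Q0 QS QE]] := (EP, EQ).
have be0 : a P Q Q != 0.
  by apply: contra al0 => /eqP e; apply/eqP; have := QE P; rewrite (triC13 a Q Q P) (triC13 a Q P P) => ->.
pose al := a P P Q; pose be := a P Q Q.
(* With y = al x / be, this makes the coefficients of p^2 q and p q^2 both equal to 1 ([E1] and [E2]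
   below). *)
have [x x3] := cube_root_exists (be / (3 * al ^+ 2)).
have x0 : x != 0.
  apply: contra_eq_neq x3 => ->; rewrite expr0n eq_sym.
  by rewrite mulf_neq0 ?invr_eq0 ?mulf_neq0 ?expf_neq0.
pose y := al * x / be; have y0 : y != 0 by rewrite !mulf_neq0 ?invr_eq0.
have [T dT mT] := tangent_plane smooth P0; have [T' dT' mT'] := tangent_plane smooth Q0.
have TT' : T != T'.
  apply: contra al0 => /eqP TT'; have := mT P; rewrite TT' mT'.
  have -> : a P P P = 0 by []. by rewrite eqxx (triC13 a Q Q P) (negPf be0).
pose W := (T :&: T')%VS.
have dW : \dim W = 2%N.
  have := dimv_sum_cap T T'; have := dimvS (subvf (T + T')); rewrite dim_rV4 dT dT' -/W.
  have : (\dim W != 3)%N.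
    apply: contra TT' => /eqP d3; have /eqP WT : W == T by rewrite eqEdim capvSl dT d3.
    have /eqP WT' : W == T' by rewrite eqEdim capvSr dT' d3.
    by rewrite -{1}WT WT'.
  have := dimvS (capvSl T T'); rewrite dT -/W.
  set i := \dim W; set j := \dim (T + T'); lia.
have mW w : w \in W -> a P P w = 0 /\ a Q Q w = 0.
  by rewrite memv_cap mT mT' => /andP[/eqP -> /eqP ->].
have mW2 w : w \in W -> a P w w = 0 /\ a Q w w = 0.
  by move=> /mW[h1 h2]; rewrite PE // QE.
have FPQ : free [:: P; Q].
  apply/(free2P _ P0) => c; apply: contra al0 => /eqP ->; rewrite triZr.
  have -> : a P P P = 0 by []. by rewrite mulr0.
exists (x *: P), (y *: Q), W; split=> //; last first.
  move=> r rW r0 z; apply: smooth; exists r => // u.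
  have [s Frs WE] := dim2_basis dW rW r0; have sW : s \in W by rewrite WE memv_span ?inE ?eqxx ?orbT.
  have Bas : basis4 P Q r s.
    apply: (@basis_skew _ <<[:: P; Q]>>%VS W) => //.
    - move=> _ /mem_span2[c [d ->]] /mW; rewrite !triDr !triZr.
      have -> : a P P P = 0 by []. have -> : a Q Q Q = 0 by [].
      rewrite !mulr0 add0r addr0 (triC13 a Q Q P) => -[/eqP + /eqP].
      rewrite !mulf_eq0 (negPf al0) (negPf be0) !orbF => /eqP -> /eqP ->.
      by rewrite !scale0r addr0.
    - by rewrite memv_span ?inE ?eqxx.
    - by rewrite memv_span ?inE ?eqxx ?orbT.
  have [x1 [y1 [z1 [t1 ->]]]] := basis4_span Bas u.
  have [h1 h2] := mW2 _ rW.
  by rewrite /comb !triDr !triZr (triC13 a r r P) (triC13 a r r Q) h1 h2 !z // !mulr0 !addr0.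
move=> s r F sW rW.
have Bas : basis4 (x *: P) (y *: Q) s r.
  apply: (@basis_skew _ <<[:: P; Q]>>%VS W) => //.
  - move=> _ /mem_span2[c [d ->]] /mW; rewrite !triDr !triZr.
    have -> : a P P P = 0 by []. have -> : a Q Q Q = 0 by [].
    rewrite !mulr0 add0r addr0 (triC13 a Q Q P) => -[/eqP + /eqP].
    rewrite !mulf_eq0 (negPf al0) (negPf be0) !orbF => /eqP -> /eqP ->.
    by rewrite !scale0r addr0.
  - have x0' : x *: P != 0 by rewrite scaler_eq0 negb_or x0 P0.
    apply/(free2P _ x0') => c; rewrite scalerA -subr_eq0; apply/eqP => e.
    have := lin2_eq0 FPQ (x := - (c * x)) (y := y); rewrite scaleNr addrC => /(_ e)[_ /eqP].
    by rewrite (negPf y0).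
  - by rewrite memvZ // memv_span ?inE ?eqxx.
  - by rewrite memvZ // memv_span ?inE ?eqxx ?orbT.
split=> // p q z t; rewrite /split_form /comb -addrA.
have [w wE] : {w : V | w = z *: s + t *: r} by eexists.
rewrite -wE; have wW : w \in W by rewrite wE memvD ?memvZ.
have [h1 h2] := mW _ wW; have [h3 h4] := mW2 _ wW.
rewrite !cubD !cubZ PS QS !triZl !triZm !triZr.
have -> : a (p *: (x *: P) + q *: (y *: Q)) (p *: (x *: P) + q *: (y *: Q)) w =
    2 * (p * q) * a (x *: P) (y *: Q) w.
  by rewrite !triE h1 h2 (triC12 a Q P); ring.
have -> : a (p *: (x *: P) + q *: (y *: Q)) w w = 0 by rewrite !triE h3 h4; ring.
have E1 : 3 * (x ^+ 2 * y * al) = 1.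
  rewrite /y; have -> : 3 * (x ^+ 2 * (al * x / be) * al) = x ^+ 3 * (3 * al ^+ 2 / be) by ring.
  by rewrite x3; field; rewrite ?al0 ?be0 ?n3.
have E2 : 3 * (x * y ^+ 2 * be) = 1.
  rewrite -[RHS]E1 /y; field.
  exact: be0.
have -> : a (x *: P) (y *: Q) w = z * a (x *: P) (y *: Q) s + t * a (x *: P) (y *: Q) r.
  by rewrite wE triDr !triZr.
rewrite -/al -/be wE cubD !cubZ !triZl !triZm !triZr.
have -> : 3 * (p * (x * (p * (x * (q * (y * al)))))) = p ^+ 2 * q * (3 * (x ^+ 2 * y * al)) by ring.
have -> : 3 * (p * (x * (q * (y * (q * (y * be)))))) = p * q ^+ 2 * (3 * (x * y ^+ 2 * be)) by ring.
by rewrite E1 E2; ring.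
Qed.

Lemma has_form_subst2 (g g' : K -> K -> K -> K -> K) (al be ga de : K) :
  al * de - be * ga != 0 ->
  (forall p q s r, g p q (al * s + be * r) (ga * s + de * r) = g' p q s r) ->
  has_form a g -> has_form a g'.
Proof.
move=> D E [e1 [e2 [e3 [e4 [k [Bas k0 F]]]]]].
exists e1, e2, (al *: e3 + ga *: e4), (be *: e3 + de *: e4), k.
have cE x y z t : comb e1 e2 (al *: e3 + ga *: e4) (be *: e3 + de *: e4) x y z t =
    comb e1 e2 e3 e4 x y (al * z + be * t) (ga * z + de * t).
  by rewrite /comb; apply/rowP => i; rewrite !mxE; ring.
split=> // [x y z t|x y z t]; last by rewrite cE F E.
rewrite cE => /Bas[-> -> h1 h2]; split=> //; apply: (mulIf D); rewrite mul0r.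
  by rewrite -[RHS](subrr 0) -{1}(mulr0 de) -{1}h1 -(mulr0 be) -h2; ring.
by rewrite -[RHS](subrr 0) -{1}(mulr0 al) -{1}h2 -(mulr0 ga) -h1; ring.
Qed.

(** Scaling s and r by m requires m al = k - 4, m be = h - 4 and C m^3 = 4 h k, a cubic equation in
    m. Its constant term comes from 64, so m is nonzero, and then so are h and k. *)
Lemma split_form_Nform (al be C : K) : C != 0 ->
  has_form a (fun p q s r => p * q * (p + q + al * s + be * r) + C * (s * r * (s + r))) ->
  exists h k, [/\ h != 0, k != 0 & has_form a (Nform h k)].
Proof.
move=> C0 F; have [m] := @solve_monicpoly K 3%N (nth 0 [:: 64 / C; 16 * (al + be) / C; 4 * al * be / C]) isT.
rewrite !big_ord_recl big_ord0 /= /bump /= => mE.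
have m3 : C * m ^+ 3 = 4 * (4 + m * al) * (4 + m * be) by rewrite mE; field.
have m0 : m != 0.
  apply/eqP => m0; move/eqP: m3; rewrite m0 expr0n mulr0 !mul0r !addr0 eq_sym.
  by rewrite !mulf_eq0 !(negPf (natK 3)).
have hk0 : 4 * (4 + m * al) * (4 + m * be) != 0 by rewrite -m3 mulf_neq0 ?expf_neq0.
move: (hk0); rewrite !mulf_eq0 !negb_or => /andP[/andP[_ k0] h0].
exists (4 + m * be), (4 + m * al); split=> //.
apply: (has_form_subst2 (al := m) (be := 0) (ga := 0) (de := m)) F; first by rewrite mul0r subr0 mulf_neq0.
move=> p q s r; rewrite /Nform.
have -> : 4 * (4 + m * be) * (4 + m * al) = C * m ^+ 3 by rewrite m3; ring.
by ring.
Qed.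

(** For [c = 1], the substitution in [cE] identifies the two equations. Since h - k = 2 (e + f) and
    h + k = 2 (1 + e f), every pair (h, k) with k nonzero is reached. *)
Lemma Nform_cubic_value (b d e f : K) : (1 - e) * (1 - f) != 0 ->
  has_form a (Nform ((1 + e) * (1 + f)) ((1 - e) * (1 - f))) ->
  has_form a (cubic_value (Lambda3 (Params b 1 d e f))).
Proof.
set h := (1 + e) * _; set k := (1 - e) * _ => k0 [e1 [e2 [e3 [e4 [c [Bas c0 F]]]]]].
exists (- k^-1 *: e1 - (2 * k)^-1 *: e3), (2^-1 *: e2 + (4 * k)^-1 *: e4), (- (4 * k)^-1 *: e4), (k^-1 *: e1).
exists (c / (- 4 * k ^+ 2)).
have cE x y z t : comb (- k^-1 *: e1 - (2 * k)^-1 *: e3) (2^-1 *: e2 + (4 * k)^-1 *: e4)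
   (- (4 * k)^-1 *: e4) (k^-1 *: e1) x y z t =
   comb e1 e2 e3 e4 ((t - x) / k) (y / 2) (- x / (2 * k)) ((y - z) / (4 * k)).
  by rewrite /comb; apply/rowP => i; rewrite !mxE; ring.
split.
- move=> x y z t; rewrite cE => /Bas[]; have n4 := natK 3.
  move=> /eqP; rewrite mulf_eq0 invr_eq0 (negPf k0) orbF => /eqP/subr0_eq -> /eqP.
  rewrite mulf_eq0 invr_eq0 (negPf n2) orbF => /eqP -> /eqP.
  rewrite mulf_eq0 invr_eq0 mulf_eq0 (negPf n2) (negPf k0) !orbF oppr_eq0 => /eqP -> /eqP.
  by rewrite mulf_eq0 invr_eq0 mulf_eq0 (negPf n4) (negPf k0) !orbF sub0r oppr_eq0 => /eqP ->.
- by rewrite mulf_neq0 ?c0 // invr_eq0 mulf_neq0 ?expf_neq0 // oppr_eq0 (natK 3).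
move=> x y z t; rewrite cE F /Nform /cubic_value /Lambda3 /Lambda1 /h; move: k0; rewrite /k => k0.
field; rewrite n2 (natK 3) oppr_eq0 (natK 3) oner_eq0 /=; move: k0; rewrite mulf_eq0 negb_or => /andP[-> ->].
done.
Qed.
End NonCommutingPair.

(** * Enumeration of the Eckardt points *)

Section Coordinates.
Variables (K : closedFieldType) (a : triform K).
Hypothesis charK : [pchar K] =i pred0.
Hypothesis smooth : ~ sing a.
Local Notation V := 'rV[K]_4.

Let natK n : n.+1%:R != 0 :> K := natS_neq0 charK n.

Local Notation quad := (K * K * K * K)%type.

Definition qadd (u v : quad) : quad :=
  let: (x, y, z, t) := u in let: (x', y', z', t') := v in (x + x', y + y', z + z', t + t').

Definition qeval (g : K -> K -> K -> K -> K) (u : quad) := let: (x, y, z, t) := u in g x y z t.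

(** Six times the polarization, computed from values alone, so that it makes sense for any explicit
    function [g] and is expanded by [ring]. *)
Definition polar_form g (u v w : quad) :=
  qeval g (qadd (qadd u v) w) - qeval g (qadd u v) - qeval g (qadd u w)
  - qeval g (qadd v w) + qeval g u + qeval g v + qeval g w.

Variables (e1 e2 e3 e4 : V) (k : K) (g : K -> K -> K -> K -> K).
Hypothesis Bas : basis4 e1 e2 e3 e4.
Hypothesis k0 : k != 0.
Hypothesis F : forall x y z t, cub a (comb e1 e2 e3 e4 x y z t) = k * g x y z t.

Definition qcomb (u : quad) := let: (x, y, z, t) := u in comb e1 e2 e3 e4 x y z t.

Lemma qcombD u v : qcomb (qadd u v) = qcomb u + qcomb v.
Proof.
case: u v => [[[x y] z] t] [[[x' y'] z'] t']; rewrite /= /comb.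
by apply/rowP => i; rewrite !mxE; ring.
Qed.

Lemma qcomb_surj v : exists u, v = qcomb u.
Proof. by have [x [y [z [t ->]]]] := basis4_span Bas v; exists (x, y, z, t). Qed.

Lemma cub_qcomb u : cub a (qcomb u) = k * qeval g u.
Proof. by case: u => [[[x y] z] t]; apply: F. Qed.

Lemma tri_qcomb u v w : 6 * a (qcomb u) (qcomb v) (qcomb w) = k * polar_form g u v w.
Proof. by rewrite -polar111 -!qcombD !cub_qcomb /polar_form; ring. Qed.

Lemma qcomb_eq0 x y z t : qcomb (x, y, z, t) = 0 -> [/\ x = 0, y = 0, z = 0 & t = 0].
Proof. exact: Bas. Qed.

Lemma sing_qcomb u : qcomb u != 0 ->
  (forall w, polar_form g u u w = 0) -> sing a.
Proof.
move=> u0 z; exists (qcomb u) => // v; have [w ->] := qcomb_surj v.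
by apply: (mulfI (natK 5)); rewrite tri_qcomb z !mulr0.
Qed.

Lemma Eck_coords u : Eck a (qcomb u) -> qeval g u = 0 /\ exists L m : quad -> K,
  forall v w, 2 * polar_form g u v w = L v * m w + L w * m v.
Proof.
move=> Eu; have [_ S _] := Eu; split.
  by apply: (mulfI k0); rewrite -cub_qcomb S mulr0.
have [m _ mE] := Eck_factor charK smooth Eu.
exists (fun v => 6 / k * a (qcomb u) (qcomb u) (qcomb v)), (fun v => m (qcomb v)) => v w.
apply: (mulfI k0); have -> : k * (2 * polar_form g u v w) = 2 * (k * polar_form g u v w) by ring.
rewrite -tri_qcomb mulrCA mE; by field.
Qed.

(** The factor [m] is a certificate: the polar quadric visibly contains the tangent plane. *)
Lemma coords_Eck u (m : quad -> K) : qcomb u != 0 -> qeval g u = 0 ->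
  (forall v, polar_form g u v v = polar_form g u u v * m v) -> Eck a (qcomb u).
Proof.
move=> u0 gu D; split=> //; first by rewrite cub_qcomb gu mulr0.
move=> w; have [v ->] := qcomb_surj w => e; apply: (mulfI (natK 5)).
by rewrite tri_qcomb D mulrA -tri_qcomb e mulr0 mul0r.
Qed.

Definition qminor (u v : quad) := let: (x, y, z, t) := u in let: (x', y', z', t') := v in
  [\/ x * y' - y * x' != 0, x * z' - z * x' != 0, x * t' - t * x' != 0
    | [\/ y * z' - z * y' != 0, y * t' - t * y' != 0 | z * t' - t * z' != 0]].

Lemma qminor_free u v : qminor u v -> free [:: qcomb u; qcomb v].
Proof.
case: u v => [[[x y] z] t] [[[x' y'] z'] t'] Dm.
have u0 : qcomb (x, y, z, t) != 0.
  apply/eqP => /qcomb_eq0[h1 h2 h3 h4]; move: Dm; rewrite /= h1 h2 h3 h4.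
  by rewrite !mul0r subr0 eqxx; case=> //; case.
apply/(free2P _ u0) => c; rewrite -subr_eq0; apply/eqP => e.
have [|/subr0_eq h1 /subr0_eq h2 /subr0_eq h3 /subr0_eq h4] :=
    @qcomb_eq0 (x' - c * x) (y' - c * y) (z' - c * z) (t' - c * t).
  by apply: (etrans _ e); rewrite /= /comb; apply/rowP => i; rewrite !mxE; ring.
move: Dm; rewrite /= h1 h2 h3 h4 => -[| | |[]].
all: by move/eqP; apply; ring.
Qed.

Lemma qcombZ c x y z t : qcomb (c * x, c * y, c * z, c * t) = c *: qcomb (x, y, z, t).
Proof. by rewrite /= /comb; apply/rowP => i; rewrite !mxE; ring. Qed.

Fixpoint qminors u (s : seq quad) :=
  if s is v :: s' then qminor u v /\ qminors u s' else True.

Fixpoint qpairwise (s : seq quad) :=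
  if s is u :: s' then qminors u s' /\ qpairwise s' else True.

Lemma qpairwise_free s : qpairwise s ->
  pairwise (fun u v => free [:: u; v]) (map qcomb s).
Proof.
elim: s => //= u s IH [us /IH ->]; rewrite andbT.
by elim: s us {IH} => //= v s IH [/qminor_free -> /IH].
Qed.

Definition Eck_cert u := [/\ qcomb u != 0, qeval g u = 0
  & exists m : quad -> K, forall v, polar_form g u v v = polar_form g u u v * m v].

Lemma Eck_list_qcomb (s : seq quad) : (forall u, u \in s -> Eck_cert u) ->
  qpairwise s ->
  (forall x y z t, Eck a (qcomb (x, y, z, t)) -> exists c x' y' z' t',
     [/\ (x', y', z', t') \in s, x = c * x', y = c * y', z = c * z' & t = c * t']) ->
  Eck_list a (map qcomb s).
Proof.
move=> HE Hm HC; split.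
- exact: qpairwise_free.
- by move=> _ /mapP[u us ->]; have [u0 gu [m D]] := HE u us; apply: coords_Eck D.
move=> v; have [[[[x y] z] t] ->] := qcomb_surj v => /HC[c [x' [y' [z' [t' [us -> -> -> ->]]]]]].
exists (qcomb (x', y', z', t')); first exact: map_f.
by rewrite qcombZ memvZ ?memv_line.
Qed.

End Coordinates.

Definition Cform (K : fieldType) (g0 g1 g2 g3 p q z t : K) :=
  p * q * (p + q + z) + (g0 * z ^+ 3 + g1 * z ^+ 2 * t + g2 * z * t ^+ 2 + g3 * t ^+ 3).

Section CformPoints.
Variables (K : closedFieldType) (a : triform K).
Hypothesis charK : [pchar K] =i pred0.
Hypothesis smooth : ~ sing a.
Local Notation V := 'rV[K]_4.

Let natK n : n.+1%:R != 0 :> K := natS_neq0 charK n.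
Let n2 : (2 : K) != 0 := natK 1.

Local Notation quad := (K * K * K * K)%type.

Variables (e1 e2 e3 e4 : V) (k g0 g1 g2 g3 : K).
Hypothesis k0 : k != 0.
Hypothesis F : forall x y z t, cub a (comb e1 e2 e3 e4 x y z t) = k * Cform g0 g1 g2 g3 x y z t.
Local Notation qcomb := (qcomb e1 e2 e3 e4).

Let mulI2 (x y : K) : 2 * x = 2 * y -> x = y.
Proof. exact: mulfI. Qed.

(* [6 Z g0 + 2 T g1], [2 Z g1 + 2 T g2], [2 Z g2 + 6 T g3] are the entries of the
   Hessian of the binary cubic; the three cases are: the polar quadric involves
   both t-coefficients of its linear factors, or one, or none. *)
Lemma Cform_Eck P Q Z T : Eck a (qcomb (P, Q, Z, T)) ->
  Cform g0 g1 g2 g3 P Q Z T = 0 /\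
  [\/ [/\ P = 0, Q = 0 & Z = 0],
      [/\ Z != 0, 2 * g2 * Z + 6 * g3 * T != 0,
          4 * (2 * g1 * Z + 2 * g2 * T) ^+ 2 =
            (2 * g2 * Z + 6 * g3 * T) * (Z + 4 * (6 * g0 * Z + 2 * g1 * T))
        & [\/ P = 0 /\ 2 * Q = - Z, 2 * P = - Z /\ Q = 0 | 2 * P = - Z /\ 2 * Q = - Z]]
    | [/\ 2 * g1 * Z + 2 * g2 * T = 0, 2 * g2 * Z + 6 * g3 * T = 0
        & (6 * g0 * Z + 2 * g1 * T) * (4 * P * Q - (2 * P + 2 * Q + Z) ^+ 2)
          + 2 * P * Q * (P + Q + Z) = 0]].
Proof.
move=> /(Eck_coords charK smooth k0 F)[S [L [m H]]]; split=> //.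
pose u1 : quad := (1, 0, 0, 0); pose u2 : quad := (0, 1, 0, 0).
pose u3 : quad := (0, 0, 1, 0); pose u4 : quad := (0, 0, 0, 1).
set D33 := 6 * g0 * Z + 2 * g1 * T; set D34 := 2 * g1 * Z + 2 * g2 * T.
set D44 := 2 * g2 * Z + 6 * g3 * T.
have E11 : 2 * Q = L u1 * m u1.
  by apply: mulI2; rewrite [RHS]mulr_natl [RHS]mulr2n -H /polar_form /Cform /=; ring.
have E22 : 2 * P = L u2 * m u2.
  by apply: mulI2; rewrite [RHS]mulr_natl [RHS]mulr2n -H /polar_form /Cform /=; ring.
have E12 : 2 * (2 * P + 2 * Q + Z) = L u1 * m u2 + L u2 * m u1.
  by rewrite -H /polar_form /Cform /=; ring.
have E13 : 2 * Q = L u1 * m u3 + L u3 * m u1.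
  by rewrite -H /polar_form /Cform /=; ring.
have E23 : 2 * P = L u2 * m u3 + L u3 * m u2.
  by rewrite -H /polar_form /Cform /=; ring.
have E14 : 0 = L u1 * m u4 + L u4 * m u1.
  by rewrite -H /polar_form /Cform /=; ring.
have E24 : 0 = L u2 * m u4 + L u4 * m u2.
  by rewrite -H /polar_form /Cform /=; ring.
have E33 : D33 = L u3 * m u3.
  by apply: mulI2; rewrite [RHS]mulr_natl [RHS]mulr2n -H /polar_form /Cform /D33 /=; ring.
have E34 : 2 * D34 = L u3 * m u4 + L u4 * m u3.
  by rewrite -H /polar_form /Cform /D34 /=; ring.
have E44 : D44 = L u4 * m u4.
  by apply: mulI2; rewrite [RHS]mulr_natl [RHS]mulr2n -H /polar_form /Cform /D44 /=; ring.
move: (L u1) (L u2) (L u3) (L u4) (m u1) (m u2) (m u3) (m u4) E11 E22 E12 E13 E23 E14 E24 E33 E34 E44.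
move=> {H} {}u1 {}u2 {}u3 {}u4 v1 v2 v3 v4 E11 E22 E12 E13 E23 E14 E24 E33 E34 E44.
have PQZ : u1 * v1 = 0 -> u2 * v2 = 0 -> u1 * v2 + u2 * v1 = 0 -> [/\ P = 0, Q = 0 & Z = 0].
  rewrite -E11 -E22 -E12 => /eqP + /eqP; rewrite !mulf_eq0 (negPf n2) /= => /eqP Q0 /eqP P0 /eqP.
  by rewrite mulf_eq0 (negPf n2) P0 Q0 !mulr0 !add0r => /eqP.
(* Neither factor involves t, so the t-entries of the polar quadric vanish, and the last equation is
   the vanishing of its determinant in p, q, z. *)
have third : u4 = 0 -> v4 = 0 -> [/\ D34 = 0, D44 = 0 &
    D33 * (4 * P * Q - (2 * P + 2 * Q + Z) ^+ 2) + 2 * P * Q * (P + Q + Z) = 0].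
  move=> u40 v40; split.
  - by apply: mulI2; rewrite E34 u40 v40; ring.
  - by rewrite E44 u40 mul0r.
  apply: (mulfI (natK 3)); rewrite mulr0.
  have -> : 4 * (D33 * (4 * P * Q - (2 * P + 2 * Q + Z) ^+ 2) + 2 * P * Q * (P + Q + Z))
    = D33 * (4 * (2 * P) * (2 * Q) - (2 * (2 * P + 2 * Q + Z)) ^+ 2)
    + (2 * P) * (2 * Q) * (2 * (2 * P + 2 * Q + Z))
    - (2 * P) * (2 * Q) ^+ 2 - (2 * P) ^+ 2 * (2 * Q) by ring.
  have -> : (2 * P) * (2 * Q) ^+ 2 = (u2 * v2) * (u1 * v3 + u3 * v1) ^+ 2 by rewrite -E22 -E13.
  have -> : (2 * P) ^+ 2 * (2 * Q) = (u2 * v3 + u3 * v2) ^+ 2 * (u1 * v1) by rewrite -E23 -E11.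
  have -> : (2 * P) * (2 * Q) * (2 * (2 * P + 2 * Q + Z)) = (u2 * v3 + u3 * v2) * (u1 * v3 + u3 * v1) * (u1 * v2 + u2 * v1).
    by rewrite -E23 -E13 -E12.
  by rewrite E33 E12 E22 E11; ring.
have [D0|D0] := eqVneq D44 0.
  have : u4 * v4 == 0 by rewrite -E44 D0.
  rewrite mulf_eq0 => /orP[/eqP u40|/eqP v40].
    have [v40|v40] := eqVneq v4 0; first by constructor 3; apply: third.
    constructor 1; have u10 : u1 = 0.
      by apply: (mulIf v40); rewrite mul0r [RHS]E14 u40 mul0r addr0.
    have u20 : u2 = 0 by apply: (mulIf v40); rewrite mul0r [RHS]E24 u40 mul0r addr0.
    by apply: PQZ; rewrite ?u10 ?u20 ?mul0r ?addr0.
  have [u40|u40] := eqVneq u4 0; first by constructor 3; apply: third.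
  constructor 1; have v10 : v1 = 0.
    by apply: (mulfI u40); rewrite mulr0 [RHS]E14 v40 mulr0 add0r.
  have v20 : v2 = 0 by apply: (mulfI u40); rewrite mulr0 [RHS]E24 v40 mulr0 add0r.
  by apply: PQZ; rewrite ?v10 ?v20 ?mulr0 ?addr0.
have : u4 * v4 != 0 by rewrite -E44.
rewrite mulf_eq0 negb_or => /andP[u40 v40].
(* The polar quadric has no p t or q t entry, hence [E14] and [E24] force (v1, v2) = -c (u1, u2).
   The p z and q z entries then give d = -c u1 when u1 is nonzero and d = -c u2 when u2 is: either
   one of u1, u2 is zero or they are equal, which are the three cases of the second alternative. *)
pose c := v4 / u4; have c0 : c != 0 by rewrite mulf_neq0 ?invr_eq0.
have v4E : v4 = c * u4 by rewrite /c divfK.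
have v1E : v1 = - c * u1.
  apply: (mulfI u40); apply/eqP; rewrite -subr_eq0; apply/eqP/esym/(etrans E14).
  by rewrite v4E; ring.
have v2E : v2 = - c * u2.
  apply: (mulfI u40); apply/eqP; rewrite -subr_eq0; apply/eqP/esym/(etrans E24).
  by rewrite v4E; ring.
have [d dE] : exists d, d = v3 - c * u3 by eexists.
have v3E : v3 = d + c * u3 by rewrite dE; ring.
have A1 : u1 != 0 -> d = - c * u1.
  move=> u10; apply: (mulfI u10); apply: (etrans (y := 2 * Q)).
    by rewrite E13 v1E v3E; ring.
  by rewrite E11 v1E; ring.
have A2 : u2 != 0 -> d = - c * u2.
  move=> u20; apply: (mulfI u20); apply: (etrans (y := 2 * P)).
    by rewrite E23 v2E v3E; ring.
  by rewrite E22 v2E; ring.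
have cond (w : K) : w != 0 -> d = - c * w -> Z = c * w ^+ 2 ->
    Z != 0 /\ 4 * D34 ^+ 2 = D44 * (Z + 4 * D33).
  move=> w0 dw ZE; split; first by rewrite ZE mulf_neq0 ?expf_neq0.
  have -> : 4 * D34 ^+ 2 = (2 * D34) ^+ 2 by ring.
  by rewrite E34 E33 E44 v4E v3E dw ZE; ring.
have [u10|u10] := eqVneq u1 0.
  have [u20|u20] := eqVneq u2 0.
    by constructor 1; apply: PQZ; rewrite ?u10 ?u20 ?mul0r ?addr0.
  have Q0 : Q = 0 by apply: mulI2; rewrite E11 u10 mul0r mulr0.
  have PZ : 2 * P = - Z.
    apply: mulI2; apply/eqP; rewrite -subr_eq0; apply/eqP; apply: (etrans (y := 2 * (2 * P + 2 * Q + Z))).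
      by rewrite Q0; ring.
    by rewrite E12 v1E u10; ring.
  have [|Z0 cnd] := cond u2 u20 (A2 u20); last by constructor 2; split=> //; constructor 2.
  by apply: oppr_inj; rewrite -PZ E22 v2E; ring.
have [u20|u20] := eqVneq u2 0.
  have P0 : P = 0 by apply: mulI2; rewrite E22 u20 mul0r mulr0.
  have QZ : 2 * Q = - Z.
    apply: mulI2; apply/eqP; rewrite -subr_eq0; apply/eqP; apply: (etrans (y := 2 * (2 * P + 2 * Q + Z))).
      by rewrite P0; ring.
    by rewrite E12 v2E u20; ring.
  have [|Z0 cnd] := cond u1 u10 (A1 u10); last by constructor 2; split=> //; constructor 1.
  by apply: oppr_inj; rewrite -QZ E11 v1E; ring.
have u12 : u1 = u2.
  by apply: (mulfI (_ : - c != 0)); rewrite ?oppr_eq0 // -A1 // -A2.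
have PQ : 2 * P = 2 * Q by rewrite E22 E11 v1E v2E u12.
have QZ : 2 * Q = - Z.
  apply: mulI2; apply/eqP; rewrite -subr_eq0; apply/eqP.
  apply: (etrans (y := 2 * (2 * P + 2 * Q + Z) - 2 * (2 * Q))); first by rewrite PQ; ring.
  by rewrite E12 E11 v1E v2E u12; ring.
have [|Z0 cnd] := cond u1 u10 (A1 u10); last by constructor 2; split=> //; constructor 3; rewrite PQ.
by apply: oppr_inj; rewrite -QZ E11 v1E; ring.
Qed.
End CformPoints.

(** The tactics below prove independence by looking, among the six minors, for one equal to a value
    known to be nonzero. *)
Ltac nonzero_by c H := rewrite (_ : _ - _ = c); [exact H | ring].
Ltac minor_is c H := solve [constructor 1; nonzero_by c H | constructor 2; nonzero_by c H
  | constructor 3; nonzero_by c H | constructor 4; solve [constructor 1; nonzero_by c H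
  | constructor 2; nonzero_by c H | constructor 3; nonzero_by c H]].

Section EckardtCounts.
Variables (K : closedFieldType) (a : triform K).
Hypothesis charK : [pchar K] =i pred0.
Hypothesis smooth : ~ sing a.
Local Notation V := 'rV[K]_4.

Let natK n : n.+1%:R != 0 :> K := natS_neq0 charK n.
Let n2 : (2 : K) != 0 := natK 1.
Let n3 : (3 : K) != 0 := natK 2.

Local Notation quad := (K * K * K * K)%type.

Variables (e1 e2 e3 e4 : V) (k : K).
Hypothesis Bas : basis4 e1 e2 e3 e4.
Hypothesis k0 : k != 0.
Local Notation qcomb := (qcomb e1 e2 e3 e4).
Local Notation Eck_cert := (Eck_cert e1 e2 e3 e4).

Let Nn (c : K) : c != 0 -> - c != 0. Proof. by rewrite oppr_eq0. Qed.
Let n1 : (1 : K) != 0 := oner_neq0 K.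
Let n1N := Nn n1.
Let n2N := Nn n2.

Ltac num := first [minor_is (1 : K) n1 | minor_is (- 1 : K) n1N
  | minor_is (2 : K) n2 | minor_is (- 2 : K) n2N].

Lemma qcomb_neq0 x y z t : [|| x != 0, y != 0, z != 0 | t != 0] -> qcomb (x, y, z, t) != 0.
Proof. exact: comb_neq0. Qed.

Definition line_points : seq quad := [:: (1, 0, 0, 0); (0, 1, 0, 0); (1, -1, 0, 0)].

Lemma line_points_Eck g0 g1 g2 g3 u : u \in line_points -> Eck_cert (Cform g0 g1 g2 g3) u.
Proof.
rewrite !inE => /or3P[] /eqP ->; (split; [by rewrite qcomb_neq0 ?n1 ?orbT | by rewrite /= /Cform; ring | ]).
- exists (fun v => let: (p, q, z, t) := v in 2 * p + q + z) => -[[[p q] z] t].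
  by rewrite /polar_form /= /Cform; ring.
- exists (fun v => let: (p, q, z, t) := v in p + 2 * q + z) => -[[[p q] z] t].
  by rewrite /polar_form /= /Cform; ring.
exists (fun v => let: (p, q, z, t) := v in p - q) => -[[[p q] z] t].
by rewrite /polar_form /= /Cform; ring.
Qed.

Lemma line_points_complete (P Q : K) : 2 * P * Q * (P + Q) = 0 ->
  exists c x y, (x, y, 0, 0) \in line_points /\ P = c * x /\ Q = c * y.
Proof.
move=> /eqP; rewrite !mulf_eq0 (negPf n2) /= => /orP[/orP[]|] /eqP e.
- by exists Q, 0, 1; rewrite !inE eqxx orbT e mulr0 mulr1.
- by exists P, 1, 0; rewrite !inE eqxx e mulr0 mulr1.
exists P, 1, (-1); rewrite !inE eqxx !orbT mulr1; split=> //; split=> //.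
by rewrite mulrN1; apply/eqP; rewrite -addr_eq0 addrC e.
Qed.

(** The candidates of the second alternative of [Cform_Eck], scaled to z = 2. They are permuted by
    the S_3 that permutes p, q and -(p + q + z) with z and t fixed. *)
Definition side_points (T : K) : seq quad := [:: (0, -1, 2, T); (-1, 0, 2, T); (-1, -1, 2, T)].

(* The factors of the polar quadric of [(0, -1, 2, T)] are read off its tangent
   plane: [u] and [v] are the z- and t-derivatives of the binary cubic at [(2, T)]. *)
Lemma side_points_Eck g0 g1 g2 g3 T u v w :
  8 * g0 + 4 * g1 * T + 2 * g2 * T ^+ 2 + g3 * T ^+ 3 = 0 ->
  12 * g0 + 4 * g1 * T + g2 * T ^+ 2 = u -> 4 * g1 + 4 * g2 * T + 3 * g3 * T ^+ 2 = v ->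
  12 * g0 + 2 * g1 * T = 2 * u * (1 + u) -> 4 * g1 + 2 * g2 * T = v * (1 + 2 * u) ->
  4 * g2 + 6 * g3 * T = 2 * v ^+ 2 ->
  w \in side_points T -> Eck_cert (Cform g0 g1 g2 g3) w.
Proof.
move=> S u1 v1 D33 D34 D44.
rewrite !inE => /or3P[] /eqP ->; (split; [by rewrite qcomb_neq0 ?n2 ?orbT
  | by apply: (etrans _ S); rewrite /= /Cform; ring | ]).
- exists (fun x => let: (p, q, z, t) := x in p + (1 + u) * z + v * t) => -[[[p q] z] t].
  rewrite [LHS](_ : _ = -2 * p ^+ 2 - 2 * p * z + (12 * g0 + 2 * g1 * T) * z ^+ 2
    + 2 * (4 * g1 + 2 * g2 * T) * z * t + (4 * g2 + 6 * g3 * T) * t ^+ 2);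
    last by rewrite /polar_form /= /Cform; ring.
  rewrite [X in _ = X * _](_ : _ = 2 * (- p + (12 * g0 + 4 * g1 * T + g2 * T ^+ 2) * z
    + (4 * g1 + 4 * g2 * T + 3 * g3 * T ^+ 2) * t)); last by rewrite /polar_form /= /Cform; ring.
  by rewrite u1 v1 D33 D34 D44; ring.
- exists (fun x => let: (p, q, z, t) := x in q + (1 + u) * z + v * t) => -[[[p q] z] t].
  rewrite [LHS](_ : _ = -2 * q ^+ 2 - 2 * q * z + (12 * g0 + 2 * g1 * T) * z ^+ 2
    + 2 * (4 * g1 + 2 * g2 * T) * z * t + (4 * g2 + 6 * g3 * T) * t ^+ 2);
    last by rewrite /polar_form /= /Cform; ring.
  rewrite [X in _ = X * _](_ : _ = 2 * (- q + (12 * g0 + 4 * g1 * T + g2 * T ^+ 2) * z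
    + (4 * g1 + 4 * g2 * T + 3 * g3 * T ^+ 2) * t)); last by rewrite /polar_form /= /Cform; ring.
  by rewrite u1 v1 D33 D34 D44; ring.
exists (fun x => let: (p, q, z, t) := x in - (p + q - u * z - v * t)) => -[[[p q] z] t].
rewrite [LHS](_ : _ = -2 * (p + q) ^+ 2 - 2 * (p + q) * z + (12 * g0 + 2 * g1 * T) * z ^+ 2
    + 2 * (4 * g1 + 2 * g2 * T) * z * t + (4 * g2 + 6 * g3 * T) * t ^+ 2);
    last by rewrite /polar_form /= /Cform; ring.
rewrite [X in _ = X * _](_ : _ = 2 * (p + q + z + (12 * g0 + 4 * g1 * T + g2 * T ^+ 2) * z
    + (4 * g1 + 4 * g2 * T + 3 * g3 * T ^+ 2) * t)); last by rewrite /polar_form /= /Cform; ring.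
by rewrite u1 v1 D33 D34 D44; ring.
Qed.

Definition multiple_in (s : seq quad) (P Q Z T : K) := exists c x' y' z' t',
  [/\ (x', y', z', t') \in s, P = c * x', Q = c * y', Z = c * z' & T = c * t'].

Lemma multiple_in_cat s s' P Q Z T : multiple_in s P Q Z T \/ multiple_in s' P Q Z T ->
  multiple_in (s ++ s') P Q Z T.
Proof.
by case=> -[c [x [y [z [t [m *]]]]]]; exists c, x, y, z, t; rewrite mem_cat m ?orbT.
Qed.

Lemma Cform_Eck_cases g0 g1 g2 g3 P Q Z T :
  (forall x y z t, cub a (comb e1 e2 e3 e4 x y z t) = k * Cform g0 g1 g2 g3 x y z t) ->
  Eck a (qcomb (P, Q, Z, T)) ->
  [\/ g3 = 0 /\ multiple_in [:: (0, 0, 0, 1)] P Q Z T,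
      exists tau, [/\ multiple_in (side_points tau) P Q Z T,
        8 * g0 + 4 * g1 * tau + 2 * g2 * tau ^+ 2 + g3 * tau ^+ 3 = 0,
        4 * g2 + 6 * g3 * tau != 0 &
        4 * (4 * g1 + 2 * g2 * tau) ^+ 2 =
          (4 * g2 + 6 * g3 * tau) * (2 + 4 * (12 * g0 + 2 * g1 * tau))],
      [/\ Z = 0, T = 0 & multiple_in line_points P Q Z T]
    | [/\ 2 * g1 * Z + 2 * g2 * T = 0, 2 * g2 * Z + 6 * g3 * T = 0, (Z != 0) || (T != 0)
        & (6 * g0 * Z + 2 * g1 * T) * (4 * P * Q - (2 * P + 2 * Q + Z) ^+ 2)
          + 2 * P * Q * (P + Q + Z) = 0]].
Proof.
move=> F EV; have [S C] := Cform_Eck charK smooth k0 F EV.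
have [v0 _ _] := EV.
case: C => [[P0 Q0 Z0]|[Z0 D C PQ]|[D34 D44 det]].
- constructor 1; split; last by exists T, 0, 0, 0, 1; rewrite inE eqxx !mulr0 mulr1.
  move: S; rewrite /Cform P0 Q0 Z0 => S; apply/eqP; move: S => /eqP.
  rewrite !mul0r !add0r !expr0n /= !mulr0 !mul0r !add0r mulf_eq0 expf_eq0 /=.
  case/orP=> // /eqP T0; move: v0.
  by rewrite P0 Q0 Z0 T0 /= /comb !scale0r !addr0 eqxx.
- have hZ : Z = Z / 2 * 2 by field.
  have c0 : Z / 2 != 0 by rewrite mulf_neq0 ?invr_eq0.
  have [tau tE] : exists tau, T = Z / 2 * tau by exists (T / (Z / 2)); rewrite mulrC divfK.
  constructor 2; exists tau; move: hZ c0 tE S D C PQ; move: (Z / 2) => c -> c0 -> S D C PQ.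
  have G : c ^+ 3 * (8 * g0 + 4 * g1 * tau + 2 * g2 * tau ^+ 2 + g3 * tau ^+ 3) = 0.
    apply: (mulfI (natK 3)); rewrite mulr0 -[RHS](mulr0 4) -S /Cform.
    case: PQ => -[h1 h2].
    - by rewrite h1; ring.
    - by rewrite h2; ring.
    have P1 : P = - c by apply: (mulfI n2); rewrite h1; ring.
    have Q1 : Q = - c by apply: (mulfI n2); rewrite h2; ring.
    by rewrite P1 Q1; ring.
  split.
  - case: PQ => -[h1 h2].
    + exists c, 0, (-1), 2, tau; rewrite inE eqxx h1 mulr0; split=> //.
      by apply: (mulfI n2); rewrite h2; ring.
    + exists c, (-1), 0, 2, tau; rewrite !inE eqxx orbT h2 mulr0; split=> //.
      by apply: (mulfI n2); rewrite h1; ring.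
    exists c, (-1), (-1), 2, tau; rewrite !inE eqxx !orbT; split=> //;
      by apply: (mulfI n2); rewrite (h1, h2); ring.
  - by move/eqP: G; rewrite mulf_eq0 expf_eq0 (negPf c0) => /eqP.
  - by apply: contra D => /eqP e; apply/eqP; rewrite -[RHS](mulr0 c) -e; ring.
  apply: (mulfI (expf_neq0 2 c0)).
  rewrite [LHS](_ : _ = 4 * (2 * g1 * (c * 2) + 2 * g2 * (c * tau)) ^+ 2); last by ring.
  by rewrite C; ring.
have [/andP[/eqP Z0 /eqP T0]|nz] := boolP ((Z == 0) && (T == 0)).
  constructor 3; split=> //; have [|c [x [y [m [-> ->]]]]] := @line_points_complete P Q.
    by rewrite -[RHS]det Z0 T0; ring.
  by exists c, x, y, 0, 0; rewrite Z0 T0 mulr0.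
by constructor 4; split=> //; rewrite -negb_and.
Qed.

Lemma three_Eckardt g0 g1 g2 g3 :
  (forall x y z t, cub a (comb e1 e2 e3 e4 x y z t) = k * Cform g0 g1 g2 g3 x y z t) ->
  g3 != 0 ->
  (forall tau, 8 * g0 + 4 * g1 * tau + 2 * g2 * tau ^+ 2 + g3 * tau ^+ 3 = 0 ->
     4 * g2 + 6 * g3 * tau != 0 ->
     4 * (4 * g1 + 2 * g2 * tau) ^+ 2 =
       (4 * g2 + 6 * g3 * tau) * (2 + 4 * (12 * g0 + 2 * g1 * tau)) -> False) ->
  (forall z t, 2 * g1 * z + 2 * g2 * t = 0 -> 2 * g2 * z + 6 * g3 * t = 0 -> z = 0) ->
  Eck_list a (map qcomb line_points).
Proof.
move=> F g30 no2 no3; apply: (Eck_list_qcomb charK Bas F).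
- exact: line_points_Eck.
- by do ![split] => //; num.
move=> P Q Z T /(Cform_Eck_cases F)[[/eqP]|[tau [_ h1 h2 h3]]|[]|[D34 D44]] //.
- by rewrite (negPf g30).
- by case: (no2 tau).
have Z0 := no3 Z T D34 D44; move: D44; rewrite Z0 mulr0 add0r => /eqP.
by rewrite !mulf_eq0 (negPf g30) (negPf (natK 5)) eqxx => /= ->.
Qed.

(** Side points require two conditions on tau, and eliminating tau from them leaves 32 ga + 1 = 0,
    excluded here. *)
Lemma four_Eckardt ga :
  (forall x y z t, cub a (comb e1 e2 e3 e4 x y z t) = k * Cform ga 0 1 0 x y z t) ->
  32 * ga + 1 != 0 -> Eck_list a (map qcomb (line_points ++ [:: (0, 0, 0, 1)])).
Proof.
move=> F ga0; apply: (Eck_list_qcomb charK Bas F).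
- move=> u; rewrite mem_cat => /orP[|]; first exact: line_points_Eck.
  rewrite inE => /eqP ->; split; [by rewrite qcomb_neq0 ?n1 ?orbT | by rewrite /= /Cform; ring | ].
  exists (fun v => let: (p, q, z, t) := v in 2 * t) => -[[[p q] z] t].
  by rewrite /polar_form /= /Cform; ring.
- by do ![split] => //; num.
move=> P Q Z T /(Cform_Eck_cases F)[[_ m]|[tau [_ h1 h2 h3]]|[_ _ m]|[D34 D44]].
- by apply: multiple_in_cat; right.
- case/negP: ga0; apply/eqP; apply: (mulfI (natK 7)); rewrite mulr0.
  rewrite [LHS](_ : _ = 2 ^+ 3 * (8 * ga + 4 * 0 * tau + 2 * 1 * tau ^+ 2 + 0 * tau ^+ 3)
    + (4 * 1 + 6 * 0 * tau) * (2 + 4 * (12 * ga + 2 * 0 * tau)) - 4 * (4 * 0 + 2 * 1 * tau) ^+ 2);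
    last by ring.
  by rewrite h1 h3; ring.
- by apply: multiple_in_cat; left.
move: D34 D44; rewrite !mulr0 !mul0r add0r addr0 mulr1 => /eqP + /eqP.
by rewrite !mulf_eq0 (negPf n2) /= => -> ->.
Qed.

(** In the case excluded from [four_Eckardt], the condition on tau becomes tau^2 = 1/8: its two
    roots contribute three side points each. *)
Lemma ten_Eckardt ga T0 :
  (forall x y z t, cub a (comb e1 e2 e3 e4 x y z t) = k * Cform ga 0 1 0 x y z t) ->
  32 * ga + 1 = 0 -> 8 * T0 ^+ 2 = 1 ->
  Eck_list a (map qcomb (line_points ++ [:: (0, 0, 0, 1)] ++ side_points T0 ++ side_points (- T0))).
Proof.
move=> F ga0 T2.
have gaE : ga = - (T0 ^+ 2 / 4).
  apply: (mulfI (natK 31)); apply/eqP; rewrite -subr_eq0; apply/eqP.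
  transitivity (32 * ga + 1 + (8 * T0 ^+ 2 - 1)); first by field; rewrite (natK 3).
  by rewrite ga0 T2 subrr addr0.
have T00 : T0 != 0.
  by apply/eqP => e; move/eqP: T2; rewrite e expr0n mulr0 eq_sym oner_eq0.
have side w T : T ^+ 2 = T0 ^+ 2 -> w \in side_points T -> Eck_cert (Cform ga 0 1 0) w.
  move=> TT; apply: (@side_points_Eck _ _ _ _ T (- (2 * T0 ^+ 2)) (4 * T)); rewrite ?gaE.
  - by rewrite TT; field; rewrite (natK 3).
  - by rewrite TT; field; rewrite (natK 3).
  - by ring.
  - apply/eqP; rewrite -subr_eq0; apply/eqP.
    transitivity (T0 ^+ 2 * (1 - 8 * T0 ^+ 2)); first by field; rewrite (natK 3).
    by rewrite T2 subrr mulr0.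
  - apply/eqP; rewrite -subr_eq0; apply/eqP.
    transitivity (- (2 * T) * (1 - 8 * T0 ^+ 2)); first by ring.
    by rewrite T2 subrr mulr0.
  apply/eqP; rewrite -subr_eq0; apply/eqP; rewrite exprMn TT.
  transitivity (4 * (1 - 8 * T0 ^+ 2)); first by ring.
  by rewrite T2 subrr mulr0.
apply: (Eck_list_qcomb charK Bas F).
- move=> u; rewrite !mem_cat => /orP[|/orP[|/orP[]]]; first exact: line_points_Eck.
  + rewrite inE => /eqP ->; split; [by rewrite qcomb_neq0 ?n1 ?orbT | by rewrite /= /Cform; ring | ].
    exists (fun v => let: (p, q, z, t) := v in 2 * t) => -[[[p q] z] t].
    by rewrite /polar_form /= /Cform; ring.
  + exact: side.
  by apply: side; rewrite sqrrN.
- have n4T : - (4 * T0) != 0 by rewrite oppr_eq0 mulf_neq0 ?(natK 3).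
  by do ![split] => //; first [num | minor_is (- (4 * T0)) n4T].
move=> P Q Z T /(Cform_Eck_cases F)[[_ m]|[tau [m h1 h2 h3]]|[_ _ m]|[D34 D44]].
- by apply: multiple_in_cat; right; apply: multiple_in_cat; left.
- do 2![apply: multiple_in_cat; right]; apply: multiple_in_cat.
  have /eqP : (tau - T0) * (tau + T0) = 0.
    apply: (mulfI n2); rewrite mulr0 -[RHS]h1 gaE; by field; rewrite (natK 3).
  by rewrite mulf_eq0 subr_eq0 addr_eq0 => /orP[] /eqP <-; [left|right].
- by apply: multiple_in_cat; left.
move: D34 D44; rewrite !mulr0 !mul0r add0r addr0 mulr1 => /eqP + /eqP.
by rewrite !mulf_eq0 (negPf n2) /= => -> ->.
Qed.

(** Side points with tau = 0 always occur; any other tau would give 3 eta = 64 by elimination. At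
    that value the two linear forms of the last alternative of [Cform_Eck] are proportional, and a
    substitution brings the binary cubic to the form ga z^3 + t^3. *)
Lemma six_Eckardt eta :
  (forall x y z t, cub a (comb e1 e2 e3 e4 x y z t) = k * Cform 0 1 8 eta x y z t) ->
  eta != 0 -> 3 * eta != 64 -> Eck_list a (map qcomb (line_points ++ side_points 0)).
Proof.
move=> F eta0 eta1; apply: (Eck_list_qcomb charK Bas F).
- move=> u; rewrite mem_cat => /orP[|]; first exact: line_points_Eck.
  by apply: (@side_points_Eck _ _ _ _ 0 0 4); ring.
- by do ![split] => //; num.
move=> P Q Z T /(Cform_Eck_cases F)[[/eqP]|[tau [m h1 h2 h3]]|[_ _ m]|[D34 D44]].
- by rewrite (negPf eta0).
- apply: multiple_in_cat; right; have [<- //|t0] := eqVneq tau 0; case/negP: eta1; apply/eqP.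
  have h4 : 4 + 16 * tau + eta * tau ^+ 2 = 0.
    by apply: (mulfI t0); rewrite mulr0 -[RHS]h1; ring.
  have t1 : 1 + 4 * tau != 0.
    apply: contra eta0 => /eqP e; move/eqP: h4.
    rewrite (_ : _ + _ = 4 * (1 + 4 * tau) + eta * tau ^+ 2); last by ring.
    by rewrite e mulr0 add0r mulf_eq0 expf_eq0 (negPf t0) orbF.
  have h5 : 16 * tau ^+ 2 + 12 * tau + 3 = 0.
    apply: (mulfI t1); apply: (mulfI (natK 15)).
    transitivity (tau * (4 * (4 * 1 + 2 * 8 * tau) ^+ 2) - tau * ((4 * 8 + 6 * eta * tau) * (2 + 4 * (12 * 0 + 2 * 1 * tau)))
      + 12 * (1 + 4 * tau) * (4 + 16 * tau + eta * tau ^+ 2)); first by ring.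
    by rewrite h3 h4; ring.
  apply: (mulfI t1); apply/eqP; rewrite -subr_eq0; apply/eqP.
  transitivity (eta * (16 * tau ^+ 2 + 12 * tau + 3) - 16 * (4 + 16 * tau + eta * tau ^+ 2)).
    by ring.
  by rewrite h4 h5; ring.
- by apply: multiple_in_cat; left.
have Z8 : Z = - (8 * T).
  apply: (mulfI n2); apply/eqP; rewrite -subr_eq0; apply/eqP; apply: (etrans _ D34); ring.
have /eqP : 2 * (3 * eta - 64) * T = 0 by rewrite -[RHS]D44 Z8; ring.
rewrite !mulf_eq0 (negPf n2) subr_eq0 (negPf eta1) => /eqP T0.
by rewrite Z8 T0 mulr0 oppr0 eqxx.
Qed.

(** With z = 3, the linear forms p, q and -(p + q + z) have sum -3; increased by 1 they become B, w
    B and w^2 B, when w is a primitive cube root of 1. On such a point the equation reads B^3 = 1 +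
    27 ga, and the six points are the orderings of the three cube roots. *)
Definition cyclic_point (B w : K) : quad := (B - 1, w * B - 1, 3, 0).

Definition cyclic_points (w A : K) : seq quad :=
  [:: cyclic_point A w; cyclic_point A (w ^+ 2); cyclic_point (w * A) w;
      cyclic_point (w * A) (w ^+ 2); cyclic_point (w ^+ 2 * A) w; cyclic_point (w ^+ 2 * A) (w ^+ 2)].

Lemma cyclic_minor B w B' w' : (B != B') || (w * B != w' * B') ->
  qminor (cyclic_point B w) (cyclic_point B' w').
Proof.
case/orP; rewrite -subr_eq0 => nz.
  constructor 2; rewrite (_ : _ - _ = 3 * (B - B')); last by ring.
  by rewrite mulf_neq0.
constructor 4; constructor 1; rewrite (_ : _ - _ = 3 * (w * B - w' * B')); last by ring.
by rewrite mulf_neq0.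
Qed.

Lemma nine_Eckardt ga w A :
  (forall x y z t, cub a (comb e1 e2 e3 e4 x y z t) = k * Cform ga 0 0 1 x y z t) ->
  w ^+ 2 + w + 1 = 0 -> A ^+ 3 = 1 + 27 * ga -> A != 0 -> ga != 0 -> 24 * ga + 1 != 0 ->
  Eck_list a (map qcomb (line_points ++ cyclic_points w A)).
Proof.
move=> F w3 A3 A0 ga0 ga1.
have cyc B w' : B ^+ 3 = 1 + 27 * ga -> B != 0 -> w' ^+ 2 + w' + 1 = 0 ->
    Eck_cert (Cform ga 0 0 1) (cyclic_point B w').
  move=> B3 B0 w'3.
  have gaE : ga = (B ^+ 3 - 1) / 27 by rewrite B3; field; rewrite (natK 26).
  have w'2 : w' ^+ 2 = - (w' + 1) by apply/eqP; rewrite -addr_eq0 addrA w'3.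
  split; [by rewrite qcomb_neq0 ?n3 ?orbT | by rewrite gaE /qeval /= /Cform; field: w'2; rewrite (natK 26) | ].
  exists (fun x => let: (p, q, z, t) := x in (1 - w') / (3 * B) * p - (1 + 2 * w') / (3 * B) * q
    + (1 - w' / B) / 3 * z) => -[[[p q] z] t].
  apply/eqP; rewrite -subr_eq0; apply/eqP.
  rewrite /polar_form /= /Cform gaE.
  by field: w'2; rewrite n3 B0 (natK 26).
have w2 : w ^+ 2 = - (w + 1) by apply/eqP; rewrite -addr_eq0 addrA w3.
have w0 : w != 0.
  by apply/eqP => e; move/eqP: w3; rewrite e expr0n !add0r oner_eq0.
have w20 : w ^+ 2 != 0 by rewrite expf_neq0.
have w3' : (w ^+ 2) ^+ 2 + w ^+ 2 + 1 = 0 by ring: w2.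
have Aw : (w * A) ^+ 3 = A ^+ 3 by ring: w2.
have Aw2 : (w ^+ 2 * A) ^+ 3 = A ^+ 3 by ring: w2.
have w1 : w != 1.
  by apply/eqP => e; move/eqP: w3; rewrite e expr1n (_ : 1 + 1 + 1 = 3) ?(negPf n3) //; ring.
have h1 : A != w * A by rewrite -{1}[A]mul1r (inj_eq (mulIf A0)) eq_sym.
have h2 : A != w ^+ 2 * A.
  rewrite -{1}[A]mul1r (inj_eq (mulIf A0)); apply: contra w1 => /eqP e.
  by apply/eqP; transitivity (w * w ^+ 2); [rewrite -e mulr1 | ring: w2].
have h3 : w * A != w ^+ 2 * A by rewrite expr2 -mulrA (inj_eq (mulfI w0)).
have h4 : w * (w * A) != w ^+ 2 * (w * A) by rewrite (inj_eq (mulIf (mulf_neq0 w0 A0))) expr2 -{1}[w]mulr1 (inj_eq (mulfI w0)) eq_sym.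
have h5 : w * (w ^+ 2 * A) != w ^+ 2 * (w ^+ 2 * A) by rewrite (inj_eq (mulIf (mulf_neq0 w20 A0))) expr2 -{1}[w]mulr1 (inj_eq (mulfI w0)) eq_sym.
apply: (Eck_list_qcomb charK Bas F).
- move=> u; rewrite mem_cat => /orP[|]; first exact: line_points_Eck.
  by rewrite !inE; do ![case/orP]; move=> /eqP ->; apply: cyc; rewrite ?Aw ?Aw2 ?mulf_neq0.
- by do ![split] => //; first [minor_is (3 : K) n3 | num | apply: cyclic_minor; rewrite ?h1 ?h2 ?h3 ?h4 ?h5 ?orbT].
move=> P Q Z T EV; have [S _] := Cform_Eck charK smooth k0 F EV.
case: (Cform_Eck_cases F EV) => [[/eqP]|[tau [_ h6 h7 h8]]|[_ _ m]|[_ D44 nz det]].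
- by rewrite oner_eq0.
(* Side points would need 24 ga + 1 = 0, the value that gives the Fermat surface. *)
- case/negP: ga1; apply/eqP; apply: (mulfI h7); apply: (mulfI n2).
  by transitivity ((4 * 0 + 6 * 1 * tau) * (2 + 4 * (12 * ga + 2 * 0 * tau))); [ring|rewrite -h8; ring].
- by apply: multiple_in_cat; left.
apply: multiple_in_cat; right.
have T0 : T = 0.
  by move/eqP: D44; rewrite mulr0 mul0r add0r mulr1 mulf_eq0 (negPf (natK 5)) => /eqP.
move: nz; rewrite T0 eqxx orbF => Z0.
have [c [B [B' [ZE PE QE]]]] : exists c B B', [/\ Z = c * 3, P = c * (B - 1) & Q = c * (B' - 1)].
  have Z3 : Z / 3 != 0 by rewrite mulf_neq0 ?invr_eq0.
  exists (Z / 3), (P / (Z / 3) + 1), (Q / (Z / 3) + 1); rewrite !addrK divfK //; split=> //.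
    by rewrite mulrC divfK.
  by rewrite mulrC divfK.
have c0 : c != 0 by apply: contra Z0; rewrite ZE => /eqP ->; rewrite mul0r.
(* In the centred coordinates, the determinant condition and the equation of the surface combine to
   this, so B'/B is a primitive cube root of 1. *)
have E1 : B ^+ 2 + B * B' + B' ^+ 2 = 0.
  apply: (mulfI (expf_neq0 3 c0)); apply: (mulfI (natK 71)); apply: (mulfI ga0).
  rewrite !mulr0; transitivity (2 * Cform ga 0 0 1 P Q Z T
    - ((6 * ga * Z + 2 * 0 * T) * (4 * P * Q - (2 * P + 2 * Q + Z) ^+ 2) + 2 * P * Q * (P + Q + Z)));
    first by rewrite /Cform PE QE ZE T0; ring.
  by rewrite S det; ring.
have E2 : B ^+ 3 = A ^+ 3.
  rewrite A3; apply: (mulfI (expf_neq0 3 c0)).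
  transitivity (c ^+ 3 * (1 + 27 * ga) + c ^+ 3 * ((B + B') - 1) * (B ^+ 2 + B * B' + B' ^+ 2) - c ^+ 3 * B' * (B ^+ 2 + B * B' + B' ^+ 2) - Cform ga 0 0 1 P Q Z T).
    by rewrite /Cform PE QE ZE T0; ring.
  by rewrite S E1; ring.
have /eqP : (B - A) * ((B - w * A) * (B - w ^+ 2 * A)) = 0.
  by transitivity (B ^+ 3 - A ^+ 3); [ring: w2 | rewrite E2 subrr].
have /eqP : (B' - w * B) * (B' - w ^+ 2 * B) = 0.
  by rewrite -[RHS]E1; ring: w2.
rewrite !mulf_eq0 !subr_eq0 => /orP[] /eqP B'E /or3P[] /eqP BE; rewrite PE QE ZE B'E BE.
- exists c, (A - 1), (w * A - 1), 3, 0; rewrite mulr0; split=> //.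
  exact: (mem_nth (0, 0, 0, 0) (s := cyclic_points w A) (n := 0) isT).
- exists c, (w * A - 1), (w * (w * A) - 1), 3, 0; rewrite mulr0; split=> //.
  exact: (mem_nth (0, 0, 0, 0) (s := cyclic_points w A) (n := 2) isT).
- exists c, (w ^+ 2 * A - 1), (w * (w ^+ 2 * A) - 1), 3, 0; rewrite mulr0; split=> //.
  exact: (mem_nth (0, 0, 0, 0) (s := cyclic_points w A) (n := 4) isT).
- exists c, (A - 1), (w ^+ 2 * A - 1), 3, 0; rewrite mulr0; split=> //.
  exact: (mem_nth (0, 0, 0, 0) (s := cyclic_points w A) (n := 1) isT).
- exists c, (w * A - 1), (w ^+ 2 * (w * A) - 1), 3, 0; rewrite mulr0; split=> //.
  exact: (mem_nth (0, 0, 0, 0) (s := cyclic_points w A) (n := 3) isT).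
- exists c, (w ^+ 2 * A - 1), (w ^+ 2 * (w ^+ 2 * A) - 1), 3, 0; rewrite mulr0; split=> //.
  exact: (mem_nth (0, 0, 0, 0) (s := cyclic_points w A) (n := 5) isT).
Qed.

End EckardtCounts.

(** * The Fermat surface *)

Definition fermat (K : fieldType) (x y z t : K) := x ^+ 3 + y ^+ 3 + z ^+ 3 + t ^+ 3.

Section FermatPoints.
Variables (K : closedFieldType) (a : triform K).
Hypothesis charK : [pchar K] =i pred0.
Hypothesis smooth : ~ sing a.
Local Notation V := 'rV[K]_4.

Let natK n : n.+1%:R != 0 :> K := natS_neq0 charK n.

Local Notation quad := (K * K * K * K)%type.

Variables (e1 e2 e3 e4 : V) (k w : K).
Hypothesis Bas : basis4 e1 e2 e3 e4.
Hypothesis k0 : k != 0.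
Hypothesis w3 : w ^+ 2 + w + 1 = 0.
Hypothesis F : forall x y z t, cub a (comb e1 e2 e3 e4 x y z t) = k * fermat x y z t.
Local Notation qcomb := (qcomb e1 e2 e3 e4).

Let w2 : w ^+ 2 = - (w + 1). Proof. by apply/eqP; rewrite -addr_eq0 addrA w3. Qed.

(** One point on each edge of the coordinate tetrahedron; the three cube roots of 1 in the place of
    [c] make 18. *)
Definition fermat_block (c : K) : seq quad :=
  [:: (1, - c, 0, 0); (1, 0, - c, 0); (1, 0, 0, - c);
      (0, 1, - c, 0); (0, 1, 0, - c); (0, 0, 1, - c)].

Definition fermat_points := fermat_block 1 ++ fermat_block w ++ fermat_block (w ^+ 2).

Lemma fermat_block_Eck c u : c ^+ 3 = 1 -> u \in fermat_block c ->
  Eck_cert e1 e2 e3 e4 (@fermat K) u.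
Proof.
move=> c3; have c4 : c ^+ 4 = c by rewrite exprS c3 mulr1.
rewrite !inE; do ![case/orP]; move=> /eqP ->; (split; [by rewrite comb_neq0 ?oner_eq0 ?orbT
  | by rewrite /= /fermat; ring: c3 | ]);
  [ exists (fun v => let: (x, y, z, t) := v in x - c ^+ 2 * y)
  | exists (fun v => let: (x, y, z, t) := v in x - c ^+ 2 * z)
  | exists (fun v => let: (x, y, z, t) := v in x - c ^+ 2 * t)
  | exists (fun v => let: (x, y, z, t) := v in y - c ^+ 2 * z)
  | exists (fun v => let: (x, y, z, t) := v in y - c ^+ 2 * t)
  | exists (fun v => let: (x, y, z, t) := v in z - c ^+ 2 * t) ];
  by case=> [[[x y] z] t]; rewrite /polar_form /= /fermat; ring: c4.
Qed.

Lemma sum_cubes_eq0 (x y : K) : x ^+ 3 + y ^+ 3 = 0 ->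
  exists2 c, c \in [:: 1; w; w ^+ 2] & y = x * - c.
Proof.
move=> e; have /eqP : (y + x) * ((y + w * x) * (y + w ^+ 2 * x)) = 0.
  by rewrite -[RHS]e; ring: w2.
rewrite !mulf_eq0 !addr_eq0 => /or3P[] /eqP ->; [exists 1 | exists w | exists (w ^+ 2)];
  rewrite ?inE ?eqxx ?orbT //; ring.
Qed.

(** The polar quadric is diagonal with entries proportional to X, Y, Z, T. A product of two linear
    forms has rank at most 2, so any three of these have product zero. *)
Lemma fermat_Eck_coords X Y Z T : Eck a (qcomb (X, Y, Z, T)) ->
  [/\ fermat X Y Z T = 0, X * Y * Z = 0, X * Y * T = 0, X * Z * T = 0 & Y * Z * T = 0].
Proof.
move=> /(Eck_coords charK smooth k0 F)[S [L [m H]]].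
have three (u v r : quad) x y z : polar_form (@fermat K) (X, Y, Z, T) u u = 6 * x ->
    polar_form (@fermat K) (X, Y, Z, T) v v = 6 * y ->
    polar_form (@fermat K) (X, Y, Z, T) r r = 6 * z ->
    polar_form (@fermat K) (X, Y, Z, T) u v = 0 ->
    polar_form (@fermat K) (X, Y, Z, T) v r = 0 ->
    polar_form (@fermat K) (X, Y, Z, T) r u = 0 -> x * y * z = 0.
  move=> xE yE zE uv vr ru.
  have n2 := natK 1; have n6 := natK 5.
  have x' : 6 * x = L u * m u.
    by apply: (mulfI n2); rewrite -xE H; ring.
  have y' : 6 * y = L v * m v.
    by apply: (mulfI n2); rewrite -yE H; ring.
  have z' : 6 * z = L r * m r.
    by apply: (mulfI n2); rewrite -zE H; ring.
  have e1' : L u * m v = - (L v * m u) by apply/eqP; rewrite -addr_eq0 -H uv mulr0.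
  have e2' : L v * m r = - (L r * m v) by apply/eqP; rewrite -addr_eq0 -H vr mulr0.
  have e3' : L r * m u = - (L u * m r) by apply/eqP; rewrite -addr_eq0 -H ru mulr0.
  apply: (mulfI (expf_neq0 3 n6)); apply: (mulfI n2); rewrite !mulr0.
  transitivity ((6 * x) * (6 * y) * (6 * z) + (6 * x) * (6 * y) * (6 * z)); first by ring.
  rewrite x' y' z'.
  transitivity ((L u * m v) * (L v * m r) * (L r * m u) + (L v * m u) * (L r * m v) * (L u * m r)); first by ring.
  by rewrite e1' e2' e3'; ring.
by split=> //; [apply: (three (1,0,0,0) (0,1,0,0) (0,0,1,0)) | apply: (three (1,0,0,0) (0,1,0,0) (0,0,0,1))
  | apply: (three (1,0,0,0) (0,0,1,0) (0,0,0,1)) | apply: (three (0,1,0,0) (0,0,1,0) (0,0,0,1))];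
  rewrite /polar_form /= /fermat; ring.
Qed.

Lemma eighteen_Eckardt : Eck_list a (map qcomb fermat_points).
Proof.
have w0 : w != 0 by apply/eqP => e; move/eqP: w3; rewrite e expr0n !add0r oner_eq0.
have w1 : 1 - w != 0.
  rewrite subr_eq0; apply/eqP => e; move/eqP: w3; rewrite -e expr1n (_ : 1 + 1 + 1 = 3); last by ring.
  by rewrite (negPf (natK 2)).
have w12 : 1 - w ^+ 2 != 0.
  rewrite (_ : _ - _ = (1 - w) * - w ^+ 2); first by rewrite mulf_neq0 ?oppr_eq0 ?expf_neq0.
  by ring: w2.
have ww2 : w - w ^+ 2 != 0.
  by rewrite (_ : _ - _ = (1 - w) * w); [rewrite mulf_neq0 | ring].
have c3 : w ^+ 3 = 1 by rewrite exprS w2; ring: w2.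
apply: (Eck_list_qcomb charK Bas F).
- move=> u; rewrite !mem_cat => /orP[|/orP[]]; apply: fermat_block_Eck => //; first by rewrite expr1n.
  by rewrite -exprM mulnC exprM c3 expr1n.
- have N c : c != 0 -> - c != 0 by rewrite oppr_eq0.
  have [n1 nw nw2] : [/\ - 1 != 0 :> K, - w != 0 & - w ^+ 2 != 0].
    by rewrite !N ?expf_neq0 ?oner_eq0.
  have o1 := oner_neq0 K.
  do ![split] => //; first [minor_is (1 : K) o1 | minor_is (- 1 : K) n1 | minor_is (- w) nw
    | minor_is (- w ^+ 2) nw2 | minor_is (1 - w) w1 | minor_is (1 - w ^+ 2) w12 | minor_is (w - w ^+ 2) ww2].
move=> X Y Z T EV; have [v0 _ _] := EV; have [S h1 h2 h3 h4] := fermat_Eck_coords EV.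
have mem c u : c \in [:: 1; w; w ^+ 2] -> u \in fermat_block c -> u \in fermat_points.
  by rewrite /fermat_points !mem_cat !inE => /or3P[] /eqP -> ->; rewrite ?orbT.
have Z2 : [\/ X = 0 /\ Y = 0, X = 0 /\ Z = 0, X = 0 /\ T = 0 | [\/ Y = 0 /\ Z = 0, Y = 0 /\ T = 0 | Z = 0 /\ T = 0]].
  have [X0|X0] := eqVneq X 0.
    move/eqP: h4; rewrite !mulf_eq0 => /orP[/orP[]|] /eqP; [by constructor 1|by constructor 2|by constructor 3].
  move: h1 h2 h3 => /eqP + /eqP + /eqP; rewrite !mulf_eq0 (negPf X0) /=.
  have [Y0|Y0] /= := eqVneq Y 0; last by move=> /eqP Z0 /eqP T0; constructor 4; constructor 3.
  by move=> _ _ /orP[] /eqP; constructor 4; [constructor 1|constructor 2].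
move: S; rewrite /fermat; case: Z2 => [[-> ->]|[-> ->]|[-> ->]|[[-> ->]|[-> ->]|[-> ->]]];
  rewrite expr0n /= ?addr0 ?add0r => /sum_cubes_eq0[c cs ->].
- exists Z, 0, 0, 1, (- c); rewrite !mulr0 mulr1; split=> //.
  by apply: mem cs _; rewrite !inE eqxx ?orbT.
- exists Y, 0, 1, 0, (- c); rewrite !mulr0 mulr1; split=> //.
  by apply: mem cs _; rewrite !inE eqxx ?orbT.
- exists Y, 0, 1, (- c), 0; rewrite !mulr0 mulr1; split=> //.
  by apply: mem cs _; rewrite !inE eqxx ?orbT.
- exists X, 1, 0, 0, (- c); rewrite !mulr0 mulr1; split=> //.
  by apply: mem cs _; rewrite !inE eqxx ?orbT.
- exists X, 1, 0, (- c), 0; rewrite !mulr0 mulr1; split=> //.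
  by apply: mem cs _; rewrite !inE eqxx ?orbT.
exists X, 1, (- c), 0, 0; rewrite !mulr0 mulr1; split=> //.
by apply: mem cs _; rewrite !inE eqxx ?orbT.
Qed.
End FermatPoints.

(** * Reduction to the families *)

Section SpecialForms.
Variables (K : closedFieldType) (a : triform K).
Hypothesis charK : [pchar K] =i pred0.
Variables s3 s5 : K.
Hypothesis hs3 : s3 ^+ 2 = - 3.
Hypothesis hs5 : s5 ^+ 2 = 5.

Let natK n : n.+1%:R != 0 :> K := natS_neq0 charK n.
Let n2 : (2 : K) != 0 := natK 1.
Let n3 : (3 : K) != 0 := natK 2.
Let n4 : (4 : K) != 0 := natK 3.

Definition Se_form (n : nat) := exists2 p : params K, admissible s3 s5 n p &
  has_form a (cubic_value (Lambda s3 s5 n p)).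

Definition lin4 (c : K * K * K * K) (x y z t : K) :=
  let: (c1, c2, c3, c4) := c in c1 * x + c2 * y + c3 * z + c4 * t.

Lemma has_form_subst4 (g g' : K -> K -> K -> K -> K) c1 c2 c3 c4 :
  (forall x y z t, lin4 c1 x y z t = 0 -> lin4 c2 x y z t = 0 -> lin4 c3 x y z t = 0 ->
     lin4 c4 x y z t = 0 -> [/\ x = 0, y = 0, z = 0 & t = 0]) ->
  (forall x y z t, g (lin4 c1 x y z t) (lin4 c2 x y z t) (lin4 c3 x y z t) (lin4 c4 x y z t)
     = g' x y z t) ->
  has_form a g -> has_form a g'.
Proof.
case: c1 c2 c3 c4 => [[[a1 a2] a3] a4] [[[b1 b2] b3] b4] [[[c1 c2] c3] c4] [[[d1 d2] d3] d4] inj E.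
case=> [e1 [e2 [e3 [e4 [k [Bas k0 F]]]]]].
exists (comb e1 e2 e3 e4 a1 b1 c1 d1), (comb e1 e2 e3 e4 a2 b2 c2 d2),
  (comb e1 e2 e3 e4 a3 b3 c3 d3), (comb e1 e2 e3 e4 a4 b4 c4 d4), k.
have cE x y z t : comb (comb e1 e2 e3 e4 a1 b1 c1 d1) (comb e1 e2 e3 e4 a2 b2 c2 d2)
  (comb e1 e2 e3 e4 a3 b3 c3 d3) (comb e1 e2 e3 e4 a4 b4 c4 d4) x y z t =
  comb e1 e2 e3 e4 (lin4 (a1, a2, a3, a4) x y z t) (lin4 (b1, b2, b3, b4) x y z t)
    (lin4 (c1, c2, c3, c4) x y z t) (lin4 (d1, d2, d3, d4) x y z t).
  by rewrite /comb; apply/rowP => i; rewrite !mxE /=; ring.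
split=> // [x y z t|x y z t]; last by rewrite cE F E.
by rewrite cE => /Bas[]; apply: inj.
Qed.

Lemma Se_form3 h k : k != 0 -> has_form a (Nform h k) -> Se_form 3.
Proof.
move=> k0 H; have [e [f [De Df]]] := Vieta2 ((h - k) / 2) ((h + k) / 2 - 1).
have hE : h = (1 + e) * (1 + f).
  by transitivity (1 + (e + f) + e * f); [rewrite De Df; field | ring].
have kE : k = (1 - e) * (1 - f).
  by transitivity (1 - (e + f) + e * f); [rewrite De Df; field | ring].
(* The zeros in the places of [b] and [d] are placeholders, overwritten by [Lambda3]. *)
exists (Params 0 1 0 e f); first by split=> //; apply: oner_neq0.
by apply: Nform_cubic_value => //; rewrite -?hE -?kE.
Qed.

(** Phrased for the conditions that prescribe [f] by [e]: for [c = 1], those of [Lambda4] and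
    [Lambda6] say that (1+e)(1+f) is 4 and -4, and this equation determines f once 1 + e is
    nonzero. *)
Lemma Se_form_Nform h k : h != 0 -> k != 0 -> has_form a (Nform h k) ->
  exists e, 1 + e != 0 /\ forall f', (1 + e) * f' = h - 1 - e ->
    has_form a (cubic_value (Lambda3 (Params 0 1 0 e f'))).
Proof.
move=> h0 k0 H; have [e [f [De Df]]] := Vieta2 ((h - k) / 2) ((h + k) / 2 - 1).
have hE : h = (1 + e) * (1 + f).
  by transitivity (1 + (e + f) + e * f); [rewrite De Df; field | ring].
have kE : k = (1 - e) * (1 - f).
  by transitivity (1 - (e + f) + e * f); [rewrite De Df; field | ring].
have e0 : 1 + e != 0 by apply: contra h0 => /eqP e0; rewrite hE e0 mul0r.
exists e; split=> // f' f'E; have -> : f' = f.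
  by apply: (mulfI e0); rewrite f'E hE; ring.
by apply: Nform_cubic_value => //; rewrite -?hE -?kE.
Qed.

Lemma Se_form4_Nform k : k != 0 -> has_form a (Nform 4 k) -> Se_form 4.
Proof.
move=> k0 /(Se_form_Nform n4 k0)[e [e0 E]].
exists (Params 0 1 0 e 0); first by split=> //; apply: oner_neq0.
by apply: E; rewrite mulrC mulfVK //; ring.
Qed.

Lemma Se_form6_Nform k : k != 0 -> has_form a (Nform (-4) k) -> Se_form 6.
Proof.
move=> k0 H; have [|e [e0 E]] := Se_form_Nform _ k0 H; first by rewrite oppr_eq0.
exists (Params 0 1 0 e 0); first by split=> //; apply: oner_neq0.
by apply: E; rewrite mulrC mulfVK //; ring.
Qed.

Lemma Se_form10_Nform : has_form a (Nform 4 (-4)) -> Se_form 10.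
Proof.
have e0 : 3 - s5 != 0.
  apply/eqP => e; have : (3 - s5) * (3 + s5) = 4 by ring: hs5.
  by move/eqP; rewrite e mul0r eq_sym (negPf n4).
have e0' : 1 + (2 - s5) * 1 != 0 by rewrite mulr1 (_ : 1 + _ = 3 - s5) //; ring.
have fE : 1 * (3 * 1 - (2 - s5) * 1) / (1 + (2 - s5) * 1) = 2 + s5.
  by apply: (mulIf e0'); rewrite mulfVK //; ring: hs5.
have hE : (1 + (2 - s5) * 1) * (1 + (2 + s5)) = 4 by ring: hs5.
have kE : (1 - (2 - s5) * 1) * (1 - (2 + s5)) = - 4 by ring: hs5.
move=> H; exists (Params 0 1 0 0 0); first by split=> //; apply: oner_neq0.
apply: (@Nform_cubic_value K a charK 0 0 ((2 - s5) * 1) (1 * (3 * 1 - (2 - s5) * 1) / (1 + (2 - s5) * 1)));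
  by rewrite fE ?hE ?kE // oppr_eq0.
Qed.

Lemma Se_form18_Nform : has_form a (Nform 4 4) -> Se_form 18.
Proof.
have e0 : 1 + s3 * 1 != 0.
  apply/eqP => e; have : (1 + s3 * 1) * (1 - s3) = 4 by ring: hs3.
  by move/eqP; rewrite e mul0r eq_sym (negPf n4).
have fE : 1 * (3 * 1 - s3 * 1) / (1 + s3 * 1) = - s3.
  by apply: (mulIf e0); rewrite mulfVK //; ring: hs3.
have hE : (1 + s3 * 1) * (1 + (- s3)) = 4 by ring: hs3.
have kE : (1 - s3 * 1) * (1 - (- s3)) = 4 by ring: hs3.
move=> H; exists (Params 0 1 0 0 0); first by split=> //; apply: oner_neq0.
apply: (@Nform_cubic_value K a charK 0 0 (s3 * 1) (1 * (3 * 1 - s3 * 1) / (1 + s3 * 1)));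
  by rewrite fE ?hE ?kE.
Qed.

(** With z = (k - 4) s and t = c (r + s/2), completing the square turns z t^2 into 16 k s r (s + r)
    plus a multiple of s^3. The hypothesis on ga cancels this multiple against ga z^3. *)
Lemma Cform_Nform4 ga k : k != 0 -> k != 4 -> ga * (k - 4) ^+ 3 + 4 * k = 0 ->
  has_form a (Cform ga 0 1 0) -> has_form a (Nform 4 k).
Proof.
move=> k0 k4 E H; have k4' : k - 4 != 0 by rewrite subr_eq0.
have [c c2] := sqrt_exists (16 * k / (k - 4)).
have c0 : c != 0.
  by apply/eqP => c0; move/eqP: c2; rewrite c0 expr0n eq_sym !mulf_eq0 invr_eq0 (negPf k0) (negPf k4') (negPf (natK 15)).
apply: (has_form_subst2 (al := k - 4) (be := 0) (ga := c / 2) (de := c)) H.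
  by rewrite mul0r subr0 mulf_neq0.
move=> p q s r; rewrite /Cform /Nform.
have cE : (k - 4) * c ^+ 2 = 16 * k by rewrite c2; field.
transitivity (p * q * (p + q + (k - 4) * s) + (ga * (k - 4) ^+ 3 + 4 * k) * s ^+ 3
  + ((k - 4) * c ^+ 2 - 16 * k) * s ^+ 3 / 4 + (k - 4) * c ^+ 2 * (s * r * (s + r))).
  by field; rewrite ?n2 ?n4.
by rewrite E cE; field; rewrite ?n2 ?n4.
Qed.

Lemma Se_form4 ga : ga != 0 -> has_form a (Cform ga 0 1 0) -> Se_form 4.
Proof.
move=> ga0; have [m] := @solve_monicpoly K 3%N (nth 0 [:: - 16 / ga; - 4 / ga; 0]) isT.
rewrite !big_ord_recl big_ord0 /= /bump /= => mE.
have E : ga * (m + 4 - 4) ^+ 3 + 4 * (m + 4) = 0 by rewrite addrK mE; field.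
have k0 : m + 4 != 0.
  apply/eqP => e; move/eqP: E; rewrite e sub0r mulr0 addr0 mulf_eq0 (negPf ga0) expf_eq0 /=.
  by rewrite oppr_eq0 (negPf n4).
have k4 : m + 4 != 4.
  apply/eqP => e; move/eqP: E; rewrite e subrr expr0n mulr0 add0r.
  by rewrite mulf_eq0 (negPf n4).
by move=> H; apply: (Se_form4_Nform k0); apply: Cform_Nform4 k0 k4 E H.
Qed.

Lemma Se_form10 ga : 32 * ga + 1 = 0 -> has_form a (Cform ga 0 1 0) -> Se_form 10.
Proof.
move=> ga32 H; apply: Se_form10_Nform; apply: Cform_Nform4 H; rewrite ?oppr_eq0 //.
  by rewrite -subr_eq0 (_ : - 4 - 4 = - 8) ?oppr_eq0 ?(natK 7) //; ring.
by transitivity (- 16 * (32 * ga + 1)); [ring | rewrite ga32 mulr0].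
Qed.

(** The substitution z = (k-4) s - 8 r, t = -k s / 4 matches [Nform (-4) k] exactly when k^2 (16 -
    eta) = 256. At eta = 16 the binary cubic is t (z + 4t)^2. *)
Lemma Se_form6 eta : eta != 16 -> has_form a (Cform 0 1 8 eta) -> Se_form 6.
Proof.
move=> eta16 H; have d0 : 16 - eta != 0 by rewrite subr_eq0 eq_sym.
have [k k2] := sqrt_exists (256 / (16 - eta)).
have kE : k ^+ 2 * (16 - eta) = 256 by rewrite k2 mulfVK.
have k0 : k != 0.
  by apply/eqP => k0; move/eqP: kE; rewrite k0 expr0n mul0r eq_sym (negPf (natK 255)).
apply: (Se_form6_Nform k0).
apply: (has_form_subst2 (al := k - 4) (be := - 8) (ga := - k / 4) (de := 0)) H.
  by rewrite (_ : _ - _ = - (2 * k)); [rewrite oppr_eq0 mulf_neq0 | field].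
move=> p q s r; rewrite /Cform /Nform.
transitivity (p * q * (p + q + (k - 4) * s - 8 * r) - k * s * (16 * r ^+ 2 + 16 * s * r
  + (256 - k ^+ 2 * (16 - eta)) * s ^+ 2 / 64)); first by field; rewrite (natK 63).
by rewrite kE; field; rewrite ?n2 ?n4 ?(natK 63).
Qed.

Variable om : K.
Hypothesis s3E : s3 = 2 * om + 1.
Let om2 : om ^+ 2 = - (om + 1).
Proof.
apply: (mulfI n4); apply/eqP; rewrite -subr_eq0; apply/eqP; move: hs3; rewrite s3E => e.
by transitivity ((2 * om + 1) ^+ 2 + 3); [ring | rewrite e addNr].
Qed.

(** With z = -2m (s - om r), t = c (s - om^2 r) and c^3 = 8 ga m^3, the sum ga z^3 + t^3 is a
    difference of cubes equal to 24 s3 ga m^3 s r (s + r). The coefficients of s and r in z give k =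
    4 - 2m and h = 4 + 2 om m, and equality with 4 h k is the cubic equation [E] for m. *)
Lemma Se_form9 ga : ga != 0 -> has_form a (Cform ga 0 0 1) -> Se_form 9.
Proof.
move=> ga0 H.
have s30 : s3 != 0 by apply/eqP => e; move/eqP: hs3; rewrite e expr0n eq_sym oppr_eq0 (negPf n3).
have om0 : om != 0.
  by apply/eqP => e; move/eqP: om2; rewrite e expr0n add0r eq_sym oppr_eq0 oner_eq0.
have D0 : 3 * s3 * ga * om ^+ 2 != 0  by rewrite !mulf_neq0.
have [m] := @solve_monicpoly K 3%N (nth 0 [:: - 8 * (om + 1) / (3 * s3 * ga * om ^+ 2);
  4 * (om + 2) / (3 * s3 * ga * om ^+ 2); - 2 / (3 * s3 * ga * om ^+ 2)]) isT.
rewrite !big_ord_recl big_ord0 /= /bump /= => mE.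
have {mE} E : 3 * s3 * ga * om ^+ 2 * m ^+ 3 = 2 * (m - 2) * (2 * om + 2 - m).
  by rewrite mE; field; rewrite n3 s30 ga0 om0.
have m0 : m != 0.
  apply/eqP => m0; move/eqP: E; rewrite m0 expr0n mulr0 eq_sym.
  rewrite (_ : 2 * (0 - 2) * _ = 8 * om ^+ 2); last by ring: om2.
  by rewrite mulf_eq0 expf_eq0 (negPf om0) (negPf (natK 7)).
have m2 : m != 2.
  apply/eqP => m2; move/eqP: E; rewrite m2 subrr mulr0 mul0r mulf_eq0 (negPf D0).
  by rewrite expf_eq0 (negPf n2).
have [c c3] := cube_root_exists (8 * ga * m ^+ 3).
have c0 : c != 0.
  apply/eqP => c0; move/eqP: c3; rewrite c0 expr0n eq_sym !mulf_eq0.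
  by rewrite (negPf (natK 7)) (negPf ga0) (negPf m0).
have C : 24 * s3 * ga * m ^+ 3 = 4 * (4 + 2 * om * m) * (- (2 * (m - 2))).
  apply: (mulfI (expf_neq0 2 om0)).
  transitivity (8 * (3 * s3 * ga * om ^+ 2 * m ^+ 3)); first by ring.
  by rewrite E; ring: om2.
pose f := 1 - (m - 2) / om.
have hE : (1 + s3 * 1) * (1 + f) = 4 + 2 * om * m by rewrite /f s3E; field: om2.
have kE : (1 - s3 * 1) * (1 - f) = - (2 * (m - 2)) by rewrite /f s3E; field.
exists (Params 0 1 0 0 f); first by split=> //; apply: oner_neq0.
apply: (@Nform_cubic_value K a charK 0 0 (s3 * 1) f); rewrite kE.
  by rewrite oppr_eq0 mulf_neq0 ?subr_eq0.
rewrite hE; apply: (has_form_subst2 (al := - (2 * m)) (be := 2 * om * m) (ga := c) (de := - (c * om ^+ 2))) H.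
  rewrite (_ : _ - _ = - (2 * m * c * s3)); first by rewrite oppr_eq0 !mulf_neq0.
  by rewrite s3E; ring: om2.
move=> p q s r; rewrite /Cform /Nform -C; transitivity (p * q * (p + q - 2 * m * s + 2 * om * m * r)
  - 8 * ga * m ^+ 3 * (s - om * r) ^+ 3 + c ^+ 3 * (s - om ^+ 2 * r) ^+ 3); first by ring.
by rewrite c3 s3E; ring: om2.
Qed.

Let om0 : om != 0.
Proof. by apply/eqP => e; move/eqP: om2; rewrite e expr0n add0r eq_sym oppr_eq0 oner_eq0. Qed.

Let om1 : 1 - om != 0.
Proof.
apply/eqP => e; have := om2; rewrite (_ : om = 1); last by apply/eqP; rewrite eq_sym -subr_eq0 e.
move/eqP; rewrite -subr_eq0 (_ : _ - _ = 3); last by ring.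
by rewrite (negPf n3).
Qed.

(** [Nform 4 4] is p q (p + q) + 64 s r (s + r). Each half is a sum of two cubes of linear forms,
    and 64 = 4^3 explains the factor 4 in the second pair. *)
Lemma Se_form18 : has_form a (@fermat K) -> Se_form 18.
Proof.
move=> H; apply: Se_form18_Nform.
have [d dE] : {d | d = (2 + om) / 3} by eexists.
have d0 : d != 0.
  apply/eqP => d0; have : d * (1 - om) = 1 by rewrite dE; field: om2.
  by move/eqP; rewrite d0 mul0r eq_sym oner_eq0.
apply: (has_form_subst4 (c1 := (d - 1, - (om ^+ 2 * d), 0, 0)) (c2 := (- d, om ^+ 2 * d, 0, 0))
  (c3 := (0, 0, 4 * (d - 1), - (4 * om ^+ 2 * d))) (c4 := (0, 0, - (4 * d), 4 * om ^+ 2 * d))) H.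
  have nz : om ^+ 2 * d != 0 by rewrite mulf_neq0 ?expf_neq0.
  rewrite /lin4 => x y z t h1 h2 h3 h4.
  have x0 : x = 0.
    apply: oppr_inj; apply: (etrans (y := ((d - 1) * x + - (om ^+ 2 * d) * y + 0 * z + 0 * t)
      + (- d * x + om ^+ 2 * d * y + 0 * z + 0 * t))); first by ring.
    by rewrite h1 h2; ring.
  have z0 : z = 0.
    apply: (mulfI n4); apply: oppr_inj.
    apply: (etrans (y := (0 * x + 0 * y + 4 * (d - 1) * z + - (4 * om ^+ 2 * d) * t)
      + (0 * x + 0 * y + - (4 * d) * z + 4 * om ^+ 2 * d * t))); first by ring.
    by rewrite h3 h4; ring.
  split=> //; first by apply: (mulfI nz); rewrite mulr0 -[RHS]h2 x0; ring.
  by apply: (mulfI nz); apply: (mulfI n4); rewrite !mulr0 -[RHS]h4 z0; ring.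
by move=> x y z t; rewrite /fermat /Nform /lin4 dE; field: om2.
Qed.

(** With p = -(x + y) and q = -(om x + om^2 y), the product p q (p + q) is x^3 + y^3; the second
    half needs in addition a cube root of 1/C. *)
Lemma fermat_of_split C : C != 0 ->
  has_form a (fun p q s r => p * q * (p + q) + C * (s * r * (s + r))) -> has_form a (@fermat K).
Proof.
move=> C0 H; have [c cE] := cube_root_exists C^-1.
have c0 : c != 0.
  by apply/eqP => c0; move/eqP: cE; rewrite c0 expr0n eq_sym invr_eq0 (negPf C0).
have nz : om - om ^+ 2 != 0 by rewrite (_ : _ - _ = om * (1 - om)); [rewrite mulf_neq0 | ring].
apply: (has_form_subst4 (c1 := (-1, -1, 0, 0)) (c2 := (- om, - om ^+ 2, 0, 0))
  (c3 := (0, 0, - c, - c)) (c4 := (0, 0, - (om * c), - (om ^+ 2 * c)))) H.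
  rewrite /lin4 => x y z t h1 h2 h3 h4.
  have y0 : y = 0.
    apply: (mulfI nz); apply: (etrans (y := (-om * x + - om ^+ 2 * y + 0 * z + 0 * t) - om * (- 1 * x + -1 * y + 0 * z + 0 * t))); first by ring.
    by rewrite h1 h2; ring.
  have t0 : t = 0.
    apply: (mulfI nz); apply: (mulfI c0); apply: (etrans (y := (0 * x + 0 * y + - (om * c) * z + - (om ^+ 2 * c) * t) - om * (0 * x + 0 * y + - c * z + - c * t))); first by ring.
    by rewrite h3 h4; ring.
  split=> //; first by apply: oppr_inj; rewrite oppr0 -[RHS]h1 y0; ring.
  by apply: (mulfI c0); apply: oppr_inj; rewrite mulr0 oppr0 -[RHS]h3 t0; ring.
move=> x y z t; rewrite /fermat /lin4.
transitivity (x ^+ 3 + y ^+ 3 + (C * c ^+ 3) * (z ^+ 3 + t ^+ 3)); first by ring: om2.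
by rewrite cE mulfV //; ring.
Qed.

(** The identity (X+Y+Z)^3 = X^3 + Y^3 + Z^3 + 3 (X+Y)(Y+Z)(Z+X), with X = x, Y = om y, Z = om^2 z:
    up to factors, p, q and p + q + z are the pairwise sums and z is the total. What remains is -9
    m^3 (X^3 + Y^3 + Z^3), hence m^3 = -1/9. *)
Lemma fermat_of_Cform ga : 24 * ga + 1 = 0 -> has_form a (Cform ga 0 0 1) -> has_form a (@fermat K).
Proof.
move=> ga24 H; have [m mE] := cube_root_exists (- 9^-1 : K).
have n9 := natK 8; have n24 := natK 23.
have m0 : m != 0.
  by apply/eqP => m0; move/eqP: mE; rewrite m0 expr0n eq_sym oppr_eq0 invr_eq0 (negPf n9).
have gaE : ga = - 24^-1.
  by apply: (mulfI n24); rewrite mulrN mulfV //; apply/eqP; rewrite -addr_eq0 ga24.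
apply: (has_form_subst4 (c1 := (0, - (3 * m * om), - (3 * m * om ^+ 2), 0))
  (c2 := (- (3 * m), 0, - (3 * m * om ^+ 2), 0))
  (c3 := (6 * m, 6 * m * om, 6 * m * om ^+ 2, 0)) (c4 := (0, 0, 0, 1))) H.
  rewrite /lin4 => x y z t h1 h2 h3 h4.
  have y0 : y = 0.
    apply: (mulfI om0); apply: (mulfI m0); apply: (mulfI (natK 5)); rewrite !mulr0.
    apply: (etrans (y := (6 * m * x + 6 * m * om * y + 6 * m * om ^+ 2 * z + 0 * t)
     + 2 * (- (3 * m) * x + 0 * y + - (3 * m * om ^+ 2) * z + 0 * t))); first by ring.
    by rewrite h2 h3; ring.
  have z0 : z = 0.
    apply: (mulfI (expf_neq0 2 om0)); apply: (mulfI m0); apply: (mulfI n3); apply: oppr_inj.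
    by rewrite !mulr0 oppr0 -[RHS]h1 y0; ring.
  split=> //; last by rewrite -[RHS]h4; ring.
  apply: (mulfI m0); apply: (mulfI n3); apply: oppr_inj.
  by rewrite !mulr0 oppr0 -[RHS]h2 z0; ring.
move=> x y z t; rewrite /fermat /lin4 /Cform gaE.
transitivity (- 9 * m ^+ 3 * (x ^+ 3 + y ^+ 3 + z ^+ 3) + t ^+ 3).
  by field: om2.
by rewrite mE; field.
Qed.

End SpecialForms.

(** * Reduction of the binary cubic and case distinction *)

Section NonCommuting.
Variables (K : closedFieldType) (a : triform K).
Hypothesis charK : [pchar K] =i pred0.
Hypothesis smooth : ~ sing a.
Local Notation V := 'rV[K]_4.

Let natK n : n.+1%:R != 0 :> K := natS_neq0 charK n.
Let n2 : (2 : K) != 0 := natK 1.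
Let n3 : (3 : K) != 0 := natK 2.

Lemma Cform_nonsing g0 g1 g2 g3 p q z t : has_form a (Cform g0 g1 g2 g3) ->
  [|| p != 0, q != 0, z != 0 | t != 0] ->
  q * (2 * p + q + z) = 0 -> p * (p + 2 * q + z) = 0 ->
  p * q + (3 * g0 * z ^+ 2 + 2 * g1 * z * t + g2 * t ^+ 2) = 0 ->
  g1 * z ^+ 2 + 2 * g2 * z * t + 3 * g3 * t ^+ 2 = 0 -> False.
Proof.
case=> [e1 [e2 [e3 [e4 [k [Bas k0 F]]]]]] nz h1 h2 h3 h4; apply: smooth.
apply: (sing_qcomb charK Bas F (u := (p, q, z, t))); first exact: comb_neq0.
case=> [[[p' q'] z'] t']; rewrite /polar_form /= /Cform.
transitivity (2 * (q * (2 * p + q + z) * p' + p * (p + 2 * q + z) * q'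
  + (p * q + (3 * g0 * z ^+ 2 + 2 * g1 * z * t + g2 * t ^+ 2)) * z'
  + (g1 * z ^+ 2 + 2 * g2 * z * t + 3 * g3 * t ^+ 2) * t')); first by ring.
by rewrite h1 h2 h3 h4 !mul0r !addr0 mulr0.
Qed.

Lemma noncommuting_form P Q : Eck a P -> Eck a Q -> a P P Q != 0 ->
  exists al be C, C != 0 /\
    has_form a (fun p q s r => p * q * (p + q + al * s + be * r) + C * (s * r * (s + r))).
Proof.
move=> EP EQ PQ; have [P' [Q' [W [dW FW nW]]]] := noncommuting_split charK smooth EP EQ PQ.
have [s [r [C [Fsr sW rW C0 E]]]] := binary_cubic_split charK dW nW.
have [Bas F] := FW s r Fsr sW rW.
exists (6 * a P' Q' s), (6 * a P' Q' r), C; split=> //.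
exists P', Q', s, r, 1; split=> //; first exact: oner_neq0.
by move=> x y z t; rewrite F /split_form E mul1r addrA.
Qed.

Lemma noncommuting_Cform al be C : C != 0 -> (al != 0) || (be != 0) ->
  has_form a (fun p q s r => p * q * (p + q + al * s + be * r) + C * (s * r * (s + r))) ->
  exists g0 g1 g2 g3, has_form a (Cform g0 g1 g2 g3).
Proof.
move=> C0; have [->|al0 _] := eqVneq al 0.
  move=> /= be0 H; exists 0, (C / be ^+ 2), (C / be), 0.
  apply: (has_form_subst2 (al := 0) (be := 1) (ga := be^-1) (de := 0)) H.
    by rewrite mul0r mul1r sub0r oppr_eq0 invr_eq0.
  by move=> p q z t; rewrite /Cform; field.
move=> H; exists 0, (C / al ^+ 2), (C * (al - 2 * be) / al ^+ 2), (- (C * be * (al - be)) / al ^+ 2).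
apply: (has_form_subst2 (al := al^-1) (be := - (be / al)) (ga := 0) (de := 1)) H.
  by rewrite mulr1 mulr0 subr0 invr_eq0.
by move=> p q z t; rewrite /Cform; field.
Qed.

(** The coordinate z is fixed by its occurrence in p + q + z, so the available substitutions are t
    -> d z + c t. *)
Lemma Cform_subst g0 g1 g2 g3 c d : c != 0 -> has_form a (Cform g0 g1 g2 g3) ->
  has_form a (Cform (g0 + g1 * d + g2 * d ^+ 2 + g3 * d ^+ 3)
    (c * (g1 + 2 * g2 * d + 3 * g3 * d ^+ 2)) (c ^+ 2 * (g2 + 3 * g3 * d)) (c ^+ 3 * g3)).
Proof.
move=> c0; apply: (has_form_subst2 (al := 1) (be := 0) (ga := d) (de := c)).
  by rewrite mul1r mul0r subr0.
by move=> p q z t; rewrite /Cform; ring.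
Qed.

Variables s3 s5 om : K.
Hypothesis hs3 : s3 ^+ 2 = - 3.
Hypothesis hs5 : s5 ^+ 2 = 5.
Hypothesis s3E : s3 = 2 * om + 1.

Let om2 : om ^+ 2 = - (om + 1).
Proof.
apply: (mulfI (natK 3)); apply/eqP; rewrite -subr_eq0; apply/eqP; move: hs3; rewrite s3E => e.
by transitivity ((2 * om + 1) ^+ 2 + 3); [ring | rewrite e addNr].
Qed.
Let om3 : om ^+ 2 + om + 1 = 0. Proof. by rewrite om2; ring. Qed.

Definition Se_classified := exists s : seq V, [/\ size s \in Eckardt_numbers, Eck_list a s
  & Se_form a s3 s5 (size s)].

Lemma fermat_classified : has_form a (@fermat K) -> Se_classified.
Proof.
move=> H; have [e1 [e2 [e3 [e4 [k [Bas k0 F]]]]]] := H.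
exists (map (qcomb e1 e2 e3 e4) (fermat_points om)); split=> //.
  exact: (eighteen_Eckardt charK smooth Bas k0 om3 F).
exact: (Se_form18 charK s5 hs3 s3E H).
Qed.

Lemma N4_classified ga : has_form a (Cform ga 0 1 0) -> Se_classified.
Proof.
move=> H; have [e1 [e2 [e3 [e4 [k [Bas k0 F]]]]]] := H.
have ga0 : ga != 0.
  apply/eqP => ga0; apply: (Cform_nonsing (p := 0) (q := 0) (z := 1) (t := 0) H);
    [by rewrite ?eqxx oner_eq0 ?orbT | by rewrite ?ga0; ring ..].
have [ga32|ga32] := eqVneq (32 * ga + 1) 0.
  have [T TE] := sqrt_exists (8^-1 : K).
  have T2 : 8 * T ^+ 2 = 1 by rewrite TE mulfV ?(natK 7).
  by eexists; split; [|exact: (ten_Eckardt charK smooth Bas k0 F ga32 T2)|exact: (Se_form10 charK s3 hs5 ga32 H)].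
by eexists; split; [|exact: (four_Eckardt charK smooth Bas k0 F ga32)|exact: (Se_form4 charK _ _ ga0 H)].
Qed.

Lemma N9_classified ga : has_form a (Cform ga 0 0 1) -> Se_classified.
Proof.
move=> H; have [e1 [e2 [e3 [e4 [k [Bas k0 F]]]]]] := H.
have ga0 : ga != 0.
  apply/eqP => ga0; apply: (Cform_nonsing (p := 0) (q := 0) (z := 1) (t := 0) H);
    [by rewrite ?eqxx oner_eq0 ?orbT | by rewrite ?ga0; ring ..].
have [ga24|ga24] := eqVneq (24 * ga + 1) 0.
  by apply: fermat_classified; apply: (fermat_of_Cform charK hs3 s3E ga24 H).
have [A A3] := cube_root_exists (1 + 27 * ga).
have A0 : A != 0.
  apply/eqP => A0; apply: (Cform_nonsing (p := -1) (q := -1) (z := 3) (t := 0) H); rewrite ?n3 ?orbT //; try ring.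
  by transitivity (A ^+ 3); [rewrite A3; ring | rewrite A0 expr0n].
eexists; split; [|exact: (nine_Eckardt charK smooth Bas k0 F om3 A3 A0 ga0 ga24)|] => //.
exact: (Se_form9 charK s5 hs3 s3E ga0 H).
Qed.

Lemma N6_classified eta : eta != 0 -> 3 * eta != 64 -> has_form a (Cform 0 1 8 eta) -> Se_classified.
Proof.
move=> eta0 eta1 H; have [e1 [e2 [e3 [e4 [k [Bas k0 F]]]]]] := H.
have eta16 : eta != 16.
  apply/eqP => e; apply: (Cform_nonsing (p := 0) (q := 0) (z := 4) (t := -1) H);
    [by rewrite ?eqxx (natK 3) | by rewrite ?e; ring ..].
eexists; split; [|exact: (six_Eckardt charK smooth Bas k0 F eta0 eta1)|] => //.
exact: (Se_form6 charK s3 s5 eta16 H).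
Qed.

(** A translation of t kills g1 if g3 = 0, and g2 otherwise, and a scaling makes the leading
    coefficient 1. Beyond [N4_classified] and [N9_classified], what counts is whether a side point
    exists; without any there are three Eckardt points, and [Nform] gives the family Se_3. *)
Lemma Cform_classified g0 g1 g2 g3 h k : h != 0 -> k != 0 -> has_form a (Nform h k) ->
  has_form a (Cform g0 g1 g2 g3) -> Se_classified.
Proof.
move=> h0 k0 HN H; have [g30|g30] := eqVneq g3 0.
  have g20 : g2 != 0.
    apply/eqP => g20; apply: (Cform_nonsing (p := 0) (q := 0) (z := 0) (t := 1) H);
      [by rewrite ?eqxx oner_eq0 | by rewrite ?g30 ?g20; ring ..].
  have [c c2] := sqrt_exists g2^-1.
  have c0 : c != 0.
    by apply/eqP => c0; move/eqP: c2; rewrite c0 expr0n eq_sym invr_eq0 (negPf g20).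
  have := Cform_subst (- (g1 / (2 * g2))) c0 H; rewrite g30.
  have -> : c * (g1 + 2 * g2 * (- (g1 / (2 * g2))) + 3 * 0 * (- (g1 / (2 * g2))) ^+ 2) = 0.
    by field; rewrite ?n2 ?g20.
  rewrite !mulr0 !mul0r !addr0 c2 mulVf //; exact: N4_classified.
have [c c3] := cube_root_exists g3^-1.
have c0 : c != 0.
  by apply/eqP => c0; move/eqP: c3; rewrite c0 expr0n eq_sym invr_eq0 (negPf g30).
have := Cform_subst (- (g2 / (3 * g3))) c0 H.
have -> : g2 + 3 * g3 * (- (g2 / (3 * g3))) = 0 by field; rewrite ?n3 ?g30.
rewrite mulr0 c3 mulVf //; move: (g0 + _ + _ + _) (c * _) => {g0 g1 g2 g3 g30 c c3 c0 H} g0 g1 H.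
have [g10|g10] := eqVneq g1 0; first by move: H; rewrite g10; apply: N9_classified.
have [[tau [t1 t2 t3]]|no] := classic (exists tau, [/\
    8 * g0 + 4 * g1 * tau + 2 * 0 * tau ^+ 2 + 1 * tau ^+ 3 = 0, 4 * 0 + 6 * 1 * tau != 0 &
    4 * (4 * g1 + 2 * 0 * tau) ^+ 2 = (4 * 0 + 6 * 1 * tau) * (2 + 4 * (12 * g0 + 2 * g1 * tau))]); last first.
  have [e1 [e2 [e3 [e4 [k' [Bas k'0 F]]]]]] := H.
  eexists; split; [|apply: (three_Eckardt charK smooth Bas k'0 F)|] => //.
  - exact: oner_neq0.
  - by move=> tau h1 h2 h3; apply: no; exists tau.
  - move=> z t /eqP; rewrite mulr0 mul0r addr0 !mulf_eq0 (negPf n2) (negPf g10) /=.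
    by move=> /eqP.
  exact: (Se_form3 charK _ _ k0 HN).
have tau0 : tau != 0 by apply: contra t2 => /eqP ->; rewrite !mulr0 addr0.
(* Translating t by (tau / 2) z brings the side points to t = 0, which kills the coefficient of z^3,
   and [g] becomes the coefficient of z^2 t. Once [g] is scaled to 1, the rank condition, rewritten
   as [gE], makes the coefficient of z t^2 equal to 8. *)
set g := g1 + 3 * (tau / 2) ^+ 2.
have gE : 8 * g ^+ 2 = 3 * (tau / 2).
  apply: (mulfI (natK 7)).
  transitivity (4 * (4 * g1 + 2 * 0 * tau) ^+ 2 + 12 * tau * (8 * g1 * tau + 3 * tau ^+ 3));
    first by rewrite /g; field.
  by rewrite t3; transitivity (12 * tau + 36 * tau * (8 * g0 + 4 * g1 * tau + 2 * 0 * tau ^+ 2 + 1 * tau ^+ 3)); [ring|rewrite t1; field].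
have g'0 : g != 0.
  apply/eqP => e; move/eqP: gE; rewrite e expr0n mulr0 eq_sym mulf_eq0 (negPf n3) mulf_eq0.
  by rewrite (negPf tau0) invr_eq0 (negPf n2).
have := Cform_subst (tau / 2) (c := g^-1) _ H; rewrite invr_eq0 => /(_ g'0).
have -> : g0 + g1 * (tau / 2) + 0 * (tau / 2) ^+ 2 + 1 * (tau / 2) ^+ 3 = 0.
  by apply: (mulfI (natK 7)); rewrite mulr0 -[RHS]t1; field.
have -> : g1 + 2 * 0 * (tau / 2) + 3 * 1 * (tau / 2) ^+ 2 = g by rewrite /g; ring.
have -> : g^-1 ^+ 2 * (0 + 3 * 1 * (tau / 2)) = 8.
  by rewrite add0r mulr1 -gE; field.
rewrite mulVf // mulr1; apply: N6_classified; first by rewrite expf_neq0 ?invr_eq0.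
(* With eta = g^-3, the forbidden value 3 eta = 64 would bring back g1 = 0, the case already
   treated. *)
apply/eqP => e; case/negP: g10; apply/eqP; apply: (mulfI n3); apply: (mulfI g'0).
have e' : 64 * g ^+ 3 = 3 by rewrite -e; field.
transitivity (3 * g * (g - 3 * (tau / 2) ^+ 2)); first by rewrite /g; ring.
transitivity (3 * g ^+ 2 - g * (3 * (tau / 2)) ^+ 2); first by ring.
by rewrite -gE; transitivity (3 * g ^+ 2 - g ^+ 2 * (64 * g ^+ 3)); [ring | rewrite e'; ring].
Qed.

Lemma noncommuting_classified P Q : Eck a P -> Eck a Q -> a P P Q != 0 -> Se_classified.
Proof.
move=> EP EQ /(noncommuting_form EP EQ)[al [be [C [C0 H]]]].
have [/andP[/eqP al0 /eqP be0]|] := boolP ((al == 0) && (be == 0)).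
  apply: fermat_classified; apply: (fermat_of_split charK hs3 s3E C0).
  have [e1 [e2 [e3 [e4 [k [Bas k0 F]]]]]] := H; exists e1, e2, e3, e4, k; split=> // x y z t.
  by rewrite F al0 be0 !mul0r !addr0.
rewrite negb_and => nz; have [g0 [g1 [g2 [g3 HC]]]] := noncommuting_Cform C0 nz H.
have [h [k [h0 k0 HN]]] := split_form_Nform charK C0 H.
exact: Cform_classified h0 k0 HN HC.
Qed.

End NonCommuting.

(** * Surfaces in projective space *)

Section ProjectiveGeometry.
Variables (K : closedFieldType).
Hypothesis charK : [pchar K] =i pred0.
Local Notation V := 'rV[K]_4.

Let natK n : n.+1%:R != 0 :> K := natS_neq0 charK n.
Let n2 : (2 : K) != 0 := natK 1.

Definition polarizes (F : {mpoly K[4]}) (a : triform K) := forall v : V,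
  F.@[v ord0] = cub a v /\ forall i, F^`M(i).@[v ord0] = 3 * a v v (delta_mx 0 i).

Section Cubic.
Variables (F : {mpoly K[4]}) (a : triform K).
Hypothesis Fa : polarizes F a.

Lemma singular_sing : singular F <-> sing a.
Proof.
split=> [[v [v0 _ dv]]|[v v0 dv]].
  exists v => // u; apply: tri_vanish_delta => i; apply: (mulfI (natK 2)).
  by rewrite mulr0 -(Fa v).2; apply: dv.
exists v; split=> // [|i]; rewrite /vanishes.
  by rewrite (Fa v).1; apply: dv.
by rewrite (Fa v).2 dv mulr0.
Qed.

Lemma line_on_sline L : line_on F L <-> sline a L.
Proof.
by split=> -[dL vL]; split=> // v /vL; rewrite /vanishes (Fa v).1.
Qed.

Hypothesis smooth : ~ sing a.

(** Directions [u1] and [u2] of two of the lines span the tangent plane together with [v], and there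
    a(v,w,w) = 2 y z a(v,u1,u2). On the third line y and z are nonzero, so the last factor is zero
    and the section is a cone. The converse is [Eck_tritan]. *)
Lemma Eckardt_point_Eck P : Eckardt_point F P <-> exists2 v, P = <[v]>%VS & Eck a v.
Proof.
split=> [[dP [L1 [L2 [L3 [[/line_on_sline s1 /line_on_sline s2 /line_on_sline s3] [n12 n13 n23] PE]]]]]|].
  have v0 : vpick P != 0 by rewrite vpick0 -dimv_eq0 dP.
  move: (memv_pick P) v0; move: (vpick P) => v vP v0.
  have vE : P = <[v]>%VS.
    by apply/eqP; rewrite eq_sym eqEdim dP dim_vline v0 andbT -memvE.
  exists v => //; split=> //.
    by apply: s1.2; move: vP; rewrite PE !memv_cap => /andP[/andP[]].
  have [v1 v2 v3] : [/\ v \in L1, v \in L2 & v \in L3].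
    by move: vP; rewrite PE !memv_cap => /andP[/andP[]].
  have [u1 F1 L1E] := dim2_basis s1.1 v1 v0.
  have [u2 F2 L2E] := dim2_basis s2.1 v2 v0.
  have [u3 F3 L3E] := dim2_basis s3.1 v3 v0.
  have mem u w (L : {vspace V}) : L = <<[:: u; w]>>%VS -> w \in L.
    by move->; rewrite memv_span ?inE ?eqxx ?orbT.
  have [m1 m2 m3] := And3 (mem _ _ _ L1E) (mem _ _ _ L2E) (mem _ _ _ L3E).
  have flat L w : sline a L -> v \in L -> w \in L -> a v v w = 0 /\ a v w w = 0.
    move=> sL vL wL; split; first exact: (sline_tangent charK sL).
    by rewrite triC13; apply: (sline_tangent charK sL).
  have [z1 q1] := flat _ _ s1 v1 m1; have [z2 q2] := flat _ _ s2 v2 m2.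
  have [z3 q3] := flat _ _ s3 v3 m3.
  have [T dT mT] := tangent_plane smooth v0.
  have F21 : free [:: u2; v; u1].
    rewrite free_cons F1 andbT -L1E; apply: contra n12 => u21.
    by apply/eqP; apply: (same_line s1.1 s2.1 F2).
  have vv0 : a v v v = 0 by apply: s1.2.
  have TE u : u \in T -> exists x y z, u = x *: v + y *: u1 + z *: u2.
    have -> : T = <<[:: u2; v; u1]>>%VS.
      apply/eqP; rewrite eq_sym eqEdim (eqnP F21) dT leqnn andbT.
      by apply/span_subvP => w; rewrite !inE => /or3P[] /eqP ->; rewrite mT ?z2 ?vv0 ?z1.
    rewrite !span_cons span_nil addv0.
    move=> /memv_addP[_ /vlineP[z ->] [_ /memv_addP[_ /vlineP[x ->] [_ /vlineP[y ->] ->]] ->]].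
    by exists x, y, z; rewrite [LHS]addrC.
  have polar x y z w : w = x *: v + y *: u1 + z *: u2 -> a v w w = 2 * y * z * a v u1 u2.
    move=> ->; rewrite !triE vv0 z1 z2 q1 q2 (triC23 a v u1 v) (triC23 a v u2 v) z1 z2 (triC23 a v u2 u1).
    ring.
  have [|x [y [z u3E]]] := TE u3; first by rewrite mT z3.
  have := polar _ _ _ _ u3E; rewrite q3 => /esym/eqP.
  rewrite !mulf_eq0 (negPf n2) /= => /orP[/orP[]|] /eqP e.
  - case/negP: n23; apply/eqP; apply: (same_line s2.1 s3.1 F3) => //.
    by rewrite u3E e scale0r addr0 memvD ?memvZ.
  - case/negP: n13; apply/eqP; apply: (same_line s1.1 s3.1 F3) => //.
    by rewrite u3E e scale0r addr0 memvD ?memvZ.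
  move=> u /eqP; rewrite -mT => /TE[x' [y' [z' uE]]].
  by rewrite (polar _ _ _ _ uE) e mulr0.
move=> [v -> Ev]; have [v0 _ _] := Ev; split; first by rewrite /is_point dim_vline v0.
have [T [L1 [L2 [L3 [_ [dT [s1 s2 s3] _ [n12 n13 n23] _] [v1 v2 v3]]]]]] := Eck_tritan charK smooth Ev.
exists L1, L2, L3; split=> //; first by split; apply/line_on_sline.
apply/eqP; rewrite eqEsubv; apply/andP; split.
  by rewrite -memvE !memv_cap v1 v2 v3.
apply/subvP => w; rewrite !memv_cap => /andP[/andP[w1 w2] _].
apply: not_free2 => //; apply/negP => Fw; case/negP: n12; apply/eqP.
exact: (same_line s1.1 s2.1 Fw).
Qed.

Lemma num_Eckardt_of_list s : Eck_list a s -> num_Eckardt_points F (size s).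
Proof.
case=> Fs Es Cs; exists (map (fun v => <[v]>%VS) s); split; rewrite ?size_map //.
  rewrite uniq_pairwise pairwise_map; move: Fs; apply: (@sub_in_pairwise _ (mem s)); last exact/allP.
  move=> u v /Es[u0 _ _] _ Fuv /=.
  apply/eqP => e; have /vlineP[c vE] : v \in <[u]>%VS by rewrite e memv_line.
  by move/(free2P _ u0)/(_ c): Fuv; rewrite vE eqxx.
move=> P; split=> [/mapP[v vs ->]|/Eckardt_point_Eck[v -> Ev]].
  by apply/Eckardt_point_Eck; exists v => //; apply: Es.
have [u us vu] := Cs v Ev; suff -> : <[v]>%VS = <[u]>%VS by apply: map_f.
have [v0 _ _] := Ev; have [u0 _ _] := Es u us.
by apply/eqP; rewrite eqEdim -memvE vu !dim_vline v0 u0.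
Qed.

End Cubic.

Lemma num_Eckardt_points_unique (F : {mpoly K[4]}) n m : num_Eckardt_points F n -> num_Eckardt_points F m -> n = m :> nat.
Proof.
case=> s [us <- sE] [s' [us' <- s'E]]; apply: perm_size; apply: uniq_perm => // P.
by apply/idP/idP => [/sE/s'E|/s'E/sE].
Qed.

Lemma cubicS_value (p : params K) (v : V) : (cubicS p).@[v ord0] =
  cubic_value p (v 0 0) (v 0 1) (v 0 2) (v 0 3).
Proof.
case: p => b c d e f; rewrite /cubicS /cubic_value.
rewrite !expr2 !mulr_natl !(mevalD, mevalN, mevalZ, mevalM, mevalXU, mevalMn).
ring.
Qed.

Lemma cubicS_homog (p : params K) : cubicS p \is 3.-homog.
Proof.
case: p => b c d e f; rewrite /cubicS.
have X i : ('X_i : {mpoly K[4]}) \is 1.-homog by rewrite dhomogX; apply/eqP; apply: mdeg1.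
have M2 (x y : {mpoly K[4]}) : x \is 1.-homog -> y \is 1.-homog -> x * y \is 2.-homog.
  exact: dhomogM.
have M3 (x u : {mpoly K[4]}) : x \is 1.-homog -> u \is 2.-homog -> x * u \is 3.-homog.
  exact: dhomogM.
rewrite !mulr_natl !expr2 !mulrnAl -!mulrA.
by do ?[apply: rpredB | apply: rpredD | apply: rpredZ | apply: rpredMn | apply: X | apply: M3 | apply: M2].
Qed.

Lemma has_form_equiv F a p : polarizes F a -> has_form a (cubic_value p) -> proj_equiv F (cubicS p).
Proof.
move=> Fa [e1 [e2 [e3 [e4 [k [Bas k0 E]]]]]].
pose B : 'M[K]_4 := \matrix_(i < 4) nth 0 [:: e1; e2; e3; e4] i.
have BE (v : V) : v *m B = comb e1 e2 e3 e4 (v 0 0) (v 0 1) (v 0 2) (v 0 3).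
  rewrite mulmx_sum_row !big_ord_recl big_ord0 addr0 !addrA !rowK /= /comb.
  by do ![congr (_ + _)]; congr (v 0 _ *: _); apply: val_inj.
have uB : B \in unitmx.
  rewrite -row_free_unit -kermx_eq0; apply/rowV0P => v /sub_kermxP; rewrite BE => /Bas[h0 h1 h2 h3].
  apply/rowP => i; rewrite mxE; case: i => -[|[|[|[|//]]]] lt.
  - by rewrite -[RHS]h0; congr (v 0 _); apply: val_inj.
  - by rewrite -[RHS]h1; congr (v 0 _); apply: val_inj.
  - by rewrite -[RHS]h2; congr (v 0 _); apply: val_inj.
  by rewrite -[RHS]h3; congr (v 0 _); apply: val_inj.
(* [B] turns coordinates into vectors, so the projectivity from [F] to the member of the family is
   its inverse. *)
exists (invmx B); first by rewrite unitmx_inv.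
move=> v; rewrite /vanishes cubicS_value (Fa v).1.
have -> : cub a v = k * cubic_value p ((v *m invmx B) 0 0) ((v *m invmx B) 0 1) ((v *m invmx B) 0 2) ((v *m invmx B) 0 3).
  by rewrite -E -BE mulmxKV.
by split=> [/eqP|->]; rewrite ?mulr0 // mulf_eq0 (negPf k0) => /eqP.
Qed.

End ProjectiveGeometry.

(** * The singular members *)

Section SingularMembers.
Variables (K : closedFieldType).
Hypothesis charK : [pchar K] =i pred0.
Let natK n : n.+1%:R != 0 :> K := natS_neq0 charK n.
Let n2 : (2 : K) != 0 := natK 1.

(* The discriminant of the planes through the line [x = y = 0]: its roots are the
   five tritangent planes. *)
Definition five_lines (a b a' b' m n : K) := m * n * (m - n) * (a * m - b * n) * (a' * m - b' * n).
Definition five_lines_m (a b a' b' m n : K) :=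
  (n * (m - n) + m * n) * (a * m - b * n) * (a' * m - b' * n)
  + m * n * (m - n) * (a * (a' * m - b' * n) + a' * (a * m - b * n)).
Definition five_lines_n (a b a' b' m n : K) :=
  (m * (m - n) - m * n) * (a * m - b * n) * (a' * m - b' * n)
  - m * n * (m - n) * (b * (a' * m - b' * n) + b' * (a * m - b * n)).

(** Up to sign, the product of the 2 x 2 determinants of all pairs among the five linear forms;
    those of m, n and m - n are units. It vanishes exactly when two forms are proportional. *)
Definition five_lines_disc (a b a' b' : K) :=
  a * b * (a - b) * (a' * b' * (a' - b')) * (a * b' - a' * b).

Definition double_line a b a' b' (m n : K) := [/\ (m != 0) || (n != 0),
  five_lines a b a' b' m n = 0, five_lines_m a b a' b' m n = 0 & five_lines_n a b a' b' m n = 0].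

Lemma five_lines_double a b a' b' : (exists m n, double_line a b a' b' m n) <->
  five_lines_disc a b a' b' = 0.
Proof.
rewrite /double_line /five_lines /five_lines_m /five_lines_n /five_lines_disc; split.
  move=> [m [n [nz D Dm Dn]]]; apply/eqP/negPn/negP.
  rewrite !mulf_eq0 !negb_or => /andP[/andP[/andP[/andP[a0 b0] ab] /andP[/andP[a'0 b'0] a'b']] d0].
  move/eqP: D; have [m0|m0] := eqVneq m 0.
    move: nz Dm; rewrite m0 eqxx /= => n0 /eqP.
    rewrite (_ : _ + _ = - (n ^+ 2 * (b * n) * (b' * n))); last by ring.
    by rewrite oppr_eq0 !mulf_eq0 (negPf n0) (negPf b0) (negPf b'0).
  have [n0|n0] := eqVneq n 0.
    move: Dn => /eqP; rewrite n0 (_ : _ - _ = m ^+ 2 * (a * m) * (a' * m)); last by ring.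
    by rewrite !mulf_eq0 (negPf m0) (negPf a0) (negPf a'0).
  have [mn|mn] := eqVneq (m - n) 0.
    move: Dm => /eqP; rewrite (subr0_eq mn) (_ : _ + _ = n ^+ 2 * ((a - b) * n) * ((a' - b') * n)); last by ring.
    by rewrite !mulf_eq0 (negPf n0) (negPf ab) (negPf a'b').
  have mn0 : m * n * (m - n) != 0 by rewrite !mulf_neq0.
  have both : a * m - b * n = 0 -> a' * m - b' * n = 0 -> False.
    move=> h1 h2; have /eqP : m * n * (a * b' - a' * b) = 0.
      transitivity (n * b' * (a * m - b * n) - n * b * (a' * m - b' * n)); first by ring.
      by rewrite h1 h2; ring.
    by rewrite !mulf_eq0 (negPf m0) (negPf n0) (negPf d0).
  rewrite !mulf_eq0 (negPf m0) (negPf n0) (negPf mn) /= => /orP[] /eqP L0.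
    apply: (both) => //; apply: (mulfI a0); apply: (mulfI mn0).
    by rewrite !mulr0 -[RHS]Dm L0; ring.
  apply: (both) => //; apply: (mulfI a'0); apply: (mulfI mn0).
  by rewrite !mulr0 -[RHS]Dm L0; ring.
have [/eqP e _|aa] := boolP (a * a' == 0); first
  by exists 1, 0; rewrite oner_eq0; split=> //; [ring | ring | rewrite -[RHS]e; ring].
have [/eqP e _|bb] := boolP (b * b' == 0); first
  by exists 0, 1; rewrite oner_eq0 orbT; split=> //; [ring | apply: oppr_inj; rewrite oppr0 -[RHS]e; ring | ring].
have [/eqP e _|ab] := boolP ((a - b) * (a' - b') == 0); first
  by exists 1, 1; rewrite oner_eq0 orbT; split=> //; [ring | rewrite -[RHS]e; ring
    | apply: oppr_inj; rewrite oppr0 -[RHS]e; ring].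
move: aa bb ab; rewrite !mulf_eq0 !negb_or => /andP[/negPf a0 /negPf a'0] /andP[/negPf b0 /negPf b'0] /andP[/negPf ab /negPf ab'].
move/eqP; rewrite !mulf_eq0 a0 a'0 b0 b'0 ab ab' /= => /eqP d0.
exists b, a; rewrite a0 b0; have L : a * b - b * a = 0 by ring.
have L' : a' * b - b' * a = 0 by apply: oppr_inj; rewrite oppr0 -[RHS]d0; ring.
by split=> //; rewrite L L'; ring.
Qed.

(* The section of [cubicS p] by the plane through the line [x = y = 0] and the
   point (m, n, 0, 0) is that line and a residual conic; these are the
   coefficients of the conic. *)
Definition con0 (p : params K) (m n : K) := let: Params b c d e f := p in - (2 * e * f) * (m * n * (m - n)).
Definition conz (p : params K) (m n : K) := let: Params b c d e f := p in
  - (b * c * m ^+ 2) - c * d * m * n + c * (e + f) * (m ^+ 2 - m * n).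
Definition cont (p : params K) (m n : K) := let: Params b c d e f := p in
  - (b * c * m * n) - c * d * n ^+ 2 - c * (e + f) * (m - n) * n.
Definition conzz (p : params K) (m n : K) := let: Params b c d e f := p in (c ^+ 2 + c * d - e * f) * m.
Definition conzt (p : params K) (m n : K) := let: Params b c d e f := p in
  (b * c + c ^+ 2 + e * f) * m + (c * d - c ^+ 2 - e * f) * n.
Definition contt (p : params K) (m n : K) := let: Params b c d e f := p in (b * c - c ^+ 2 + e * f) * n.

(* Derivatives of the first three coefficients; the others are linear. *)
Definition con0' (p : params K) (m n m' n' : K) := let: Params b c d e f := p in
  - (2 * e * f) * ((2 * m * n - n ^+ 2) * m' + (m ^+ 2 - 2 * m * n) * n').
Definition conz' (p : params K) (m n m' n' : K) := let: Params b c d e f := p in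
  (- (2 * b * c * m) - c * d * n + c * (e + f) * (2 * m - n)) * m' - (c * d * m + c * (e + f) * m) * n'.
Definition cont' (p : params K) (m n m' n' : K) := let: Params b c d e f := p in
  - (b * c * n + c * (e + f) * n) * m' - (b * c * m + 2 * c * d * n + c * (e + f) * (m - 2 * n)) * n'.

(** The coefficients of [L_f], then those of [L_e]. *)
Definition line_coefs (p : params K) := let: Params b c d e f := p in
  ((c + f) * (b * c - c * f + e * f), (c - f) * (c * f - c * d + e * f),
   (c + e) * (b * c - c * e + e * f), (c - e) * (c * e - c * d + e * f)).

Lemma conic_disc_five_lines p m n : let: (a, b, a', b') := line_coefs p in
  conic_disc (con0 p m n) (conz p m n) (cont p m n) (conzz p m n) (conzt p m n) (contt p m n)
  = 2 * five_lines a b a' b' m n.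
Proof.
case: p => b c d e f /=; rewrite /conic_disc /five_lines; ring.
Qed.

Lemma conic_disc'_five_lines p m n m' n' : let: (a, b, a', b') := line_coefs p in
  conic_disc' (con0 p m n) (conz p m n) (cont p m n) (conzz p m n) (conzt p m n) (contt p m n)
    (con0' p m n m' n') (conz' p m n m' n') (cont' p m n m' n') (conzz p m' n') (conzt p m' n') (contt p m' n')
  = 2 * (five_lines_m a b a' b' m n * m' + five_lines_n a b a' b' m n * n').
Proof.
case: p => b c d e f /=; rewrite /conic_disc' /five_lines_m /five_lines_n; ring.
Qed.

(** The determinant of [L_e] and [L_f] accounts for the factors c, -e + f and the last one of
    [Sigma0]; the two cubic factors are the differences a - b and a' - b'. The three quadratic
    factors set apart concern singular points on the line x = y = 0. *)
Lemma Sigma0_five_lines p : Sigma0 p = let: Params b c d e f := p in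
  let: (a, b', a', b'') := line_coefs p in
  - (five_lines_disc a b' a' b'' * ((- c ^+ 2 - c * d + e * f) * (b * c - c * d + 2 * e * f)
     * (b * c - c ^+ 2 + e * f))).
Proof. by case: p => b c d e f; rewrite /Sigma0 /five_lines_disc /=; ring. Qed.

Definition grad_x p x y z t := con0' p x y 1 0 + conz' p x y 1 0 * z + cont' p x y 1 0 * t
  + conzz p 1 0 * z ^+ 2 + conzt p 1 0 * z * t + contt p 1 0 * t ^+ 2.
Definition grad_y p x y z t := con0' p x y 0 1 + conz' p x y 0 1 * z + cont' p x y 0 1 * t
  + conzz p 0 1 * z ^+ 2 + conzt p 0 1 * z * t + contt p 0 1 * t ^+ 2.
Definition grad_z p x y z t := conz p x y + 2 * conzz p x y * z + conzt p x y * t.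
Definition grad_t p x y z t := cont p x y + conzt p x y * z + 2 * contt p x y * t.

Lemma polar_cubic_value p x y z t x' y' z' t' :
  polar_form (cubic_value p) (x, y, z, t) (x, y, z, t) (x', y', z', t') =
  2 * (grad_x p x y z t * x' + grad_y p x y z t * y' + grad_z p x y z t * z' + grad_t p x y z t * t').
Proof.
case: p => b c d e f; rewrite /polar_form /= /grad_x /grad_y /grad_z /grad_t.
by rewrite /con0' /conz' /cont' /conz /cont /conzz /conzt /contt; ring.
Qed.

Lemma singular_cubicS p : singular (cubicS p) <-> exists x y z t,
  [/\ [|| x != 0, y != 0, z != 0 | t != 0], grad_x p x y z t = 0, grad_y p x y z t = 0,
      grad_z p x y z t = 0 & grad_t p x y z t = 0].
Proof.
have [a Fa] := triform_of_homog charK (cubicS_homog p).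
pose e i : 'rV[K]_4 := delta_mx 0 (inord i).
have coords x y z t : let v := comb (e 0) (e 1) (e 2) (e 3) x y z t in
    [/\ v 0 0 = x, v 0 1 = y, v 0 2 = z & v 0 3 = t].
  have ij (i : nat) (j : 'I_4) : (i < 4)%N -> (j == inord i :> 'I_4) = (j == i :> nat).
    by move=> i4; rewrite -val_eqE /= inordK.
  by rewrite /comb /e !mxE !eqxx /= !ij //= !(mulr0, mulr1, addr0, add0r).
have Bas : basis4 (e 0) (e 1) (e 2) (e 3).
  move=> x y z t E; have := coords x y z t; rewrite /= E !mxE.
  by case=> <- <- <- <-.
have F x y z t : cub a (comb (e 0) (e 1) (e 2) (e 3) x y z t) = 1 * cubic_value p x y z t.
  by have := coords x y z t => -[h1 h2 h3 h4]; rewrite -(Fa _).1 cubicS_value mul1r h1 h2 h3 h4.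
apply: (iff_trans (singular_sing charK Fa)); split.
  case=> v v0 dv; have [[[[x y] z] t] vE] := qcomb_surj Bas v.
  have D q : polar_form (cubic_value p) (x, y, z, t) (x, y, z, t) q = 0.
    by rewrite -[LHS]mul1r -(tri_qcomb F) -vE dv mulr0.
  have G x' y' z' t' : grad_x p x y z t * x' + grad_y p x y z t * y' + grad_z p x y z t * z' + grad_t p x y z t * t' = 0.
    by apply: (mulfI n2); rewrite -polar_cubic_value D mulr0.
  exists x, y, z, t; split.
  - apply: contraNT v0; rewrite !negb_or !negbK => /and4P[/eqP x0 /eqP y0 /eqP z0 /eqP t0].
    by rewrite vE /= x0 y0 z0 t0 /comb !scale0r !addr0.
  - by rewrite -[RHS](G 1 0 0 0); ring.
  - by rewrite -[RHS](G 0 1 0 0); ring.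
  - by rewrite -[RHS](G 0 0 1 0); ring.
  by rewrite -[RHS](G 0 0 0 1); ring.
move=> [x [y [z [t [nz gx gy gz gt]]]]].
apply: (sing_qcomb charK Bas F (u := (x, y, z, t))); first exact: comb_neq0.
by case=> [[[x' y'] z'] t']; rewrite polar_cubic_value gx gy gz gt; ring.
Qed.

(** The converse of [conic_double_kernel] for a kernel vector with u = 1: the determinant and its
    derivative are combinations of the equations, with cofactors as coefficients. *)
Lemma conic_kernel_disc (al be ga de ep ze al' be' ga' de' ep' ze' z t : K) :
  2 * al + be * z + ga * t = 0 -> be + 2 * de * z + ep * t = 0 -> ga + ep * z + 2 * ze * t = 0 ->
  conic_disc al be ga de ep ze = 0 /\
  (al' + be' * z + ga' * t + de' * z ^+ 2 + ep' * z * t + ze' * t ^+ 2 = 0 ->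
   conic_disc' al be ga de ep ze al' be' ga' de' ep' ze' = 0).
Proof.
set E1 := 2 * al + _ + _; set E2 := be + _ + _; set E3 := ga + _ + _ => e1 e2 e3; split=> [|e4].
  apply: (mulfI n2); rewrite mulr0.
  transitivity ((4 * de * ze - ep ^+ 2) * E1 + (ep * ga - 2 * be * ze) * E2 + (be * ep - 2 * ga * de) * E3).
    by rewrite /conic_disc /E1 /E2 /E3; ring.
  by rewrite e1 e2 e3; ring.
transitivity ((4 * de * ze - ep ^+ 2) * (al' + be' * z + ga' * t + de' * z ^+ 2 + ep' * z * t + ze' * t ^+ 2)
  + be' * (ep * E3 - 2 * ze * E2) + ga' * (ep * E2 - 2 * de * E3)
  + de' * (2 * ze * E1 - ga * E3 + z * (ep * E3 - 2 * ze * E2))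
  + ep' * (t * (ep * E3 - 2 * ze * E2) + be * E3 - ep * E1)
  + ze' * (2 * de * E1 - be * E2 + t * (ep * E2 - 2 * de * E3))).
  by rewrite /conic_disc' /E1 /E2 /E3; ring.
by rewrite e1 e2 e3 e4; ring.
Qed.

(** In the plane through the point and the line x = y = 0, the point is (1, z, t) and is singular on
    the residual conic; the two remaining derivatives make the discriminant vanish to second order.
    Euler's relation supplies [E1]. *)
Lemma singular_off_line p x y z t a b a' b' : line_coefs p = (a, b, a', b') ->
  (x != 0) || (y != 0) ->
  grad_x p x y z t = 0 -> grad_y p x y z t = 0 -> grad_z p x y z t = 0 -> grad_t p x y z t = 0 ->
  double_line a b a' b' x y.
Proof.
move=> lE nz gx gy E2 E3.
have := conic_disc_five_lines p x y; have := conic_disc'_five_lines p x y 1 0.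
have := conic_disc'_five_lines p x y 0 1; rewrite lE => Dn Dm D0.
have E1 : 2 * con0 p x y + conz p x y * z + cont p x y * t = 0.
  apply: (mulfI (natK 2)); rewrite mulr0.
  transitivity (2 * (x * grad_x p x y z t + y * grad_y p x y z t) - z * grad_z p x y z t - t * grad_t p x y z t).
    case: (p) => b0 c d e f; rewrite /grad_x /grad_y /grad_z /grad_t.
    by rewrite /con0' /conz' /cont' /conz /cont /con0 /conzz /conzt /contt; ring.
  by rewrite gx gy E2 E3; ring.
split=> //; apply: (mulfI n2); rewrite mulr0.
- by rewrite -D0; have [-> _] := conic_kernel_disc 0 0 0 0 0 0 E1 E2 E3.
- have [_ /(_ gx) e] := conic_kernel_disc (con0' p x y 1 0) (conz' p x y 1 0) (cont' p x y 1 0)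
    (conzz p 1 0) (conzt p 1 0) (contt p 1 0) E1 E2 E3.
  by rewrite -[RHS]e Dm; ring.
have [_ /(_ gy) e] := conic_kernel_disc (con0' p x y 0 1) (conz' p x y 0 1) (cont' p x y 0 1)
    (conzz p 0 1) (conzt p 0 1) (contt p 0 1) E1 E2 E3.
by rewrite -[RHS]e Dn; ring.
Qed.

Lemma grad_xyE p x y z t m n : grad_x p x y z t * m + grad_y p x y z t * n =
  con0' p x y m n + conz' p x y m n * z + cont' p x y m n * t
  + conzz p m n * z ^+ 2 + conzt p m n * z * t + contt p m n * t ^+ 2.
Proof.
case: p => b c d e f; rewrite /grad_x /grad_y /con0' /conz' /cont' /conzz /conzt /contt; ring.
Qed.

(** The gradient in x and y is tested on two independent directions: along (m, n) it vanishes by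
    Euler's relation in the plane, and along (m', n') because the kernel vector lies on the
    derivative conic. The point may fall on the line x = y = 0, when u = 0. *)
Lemma double_line_singular p m n a b a' b' : line_coefs p = (a, b, a', b') ->
  double_line a b a' b' m n -> singular (cubicS p).
Proof.
move=> lE [nz D Dm Dn]; apply/singular_cubicS.
have := conic_disc_five_lines p m n; rewrite lE D mulr0 => D0.
have [m' [n' d0]] : exists m' n', m * n' - n * m' != 0.
  by case/orP: nz => h; [exists 0, 1 | exists 1, 0]; rewrite mulr0 mulr1 ?subr0 ?sub0r ?oppr_eq0.
have := conic_disc'_five_lines p m n m' n'; rewrite lE Dm Dn !mul0r addr0 mulr0 => D1.
have [u [z [t [nz' k1 k2 k3 k4]]]] := conic_double_kernel charK D0 D1.
have dir : grad_x p (u * m) (u * n) z t * m' + grad_y p (u * m) (u * n) z t * n' = 0.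
  rewrite grad_xyE -[RHS]k4; case: (p) => b0 c d e f.
  by rewrite /con0' /conz' /cont' /conzz /conzt /contt; ring.
have dir' : grad_x p (u * m) (u * n) z t * m + grad_y p (u * m) (u * n) z t * n = 0.
  rewrite grad_xyE; apply: (mulfI n2); rewrite mulr0.
  transitivity (3 * u * (2 * con0 p m n * u + conz p m n * z + cont p m n * t)
    + z * (conz p m n * u + 2 * conzz p m n * z + conzt p m n * t)
    + t * (cont p m n * u + conzt p m n * z + 2 * contt p m n * t)).
    case: (p) => b0 c d e f.
    by rewrite /con0 /conz /cont /con0' /conz' /cont' /conzz /conzt /contt; ring.
  by rewrite k1 k2 k3; ring.
exists (u * m), (u * n), z, t; split.
- move: nz'; rewrite !mulf_eq0 !negb_or; case: (u == 0) => //=.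
  by case/orP: nz => ->; rewrite ?orbT.
- apply: (mulfI d0); rewrite mulr0.
  transitivity (n' * (grad_x p (u * m) (u * n) z t * m + grad_y p (u * m) (u * n) z t * n)
    - n * (grad_x p (u * m) (u * n) z t * m' + grad_y p (u * m) (u * n) z t * n')); first by ring.
  by rewrite dir dir'; ring.
- apply: (mulfI d0); rewrite mulr0.
  transitivity (m * (grad_x p (u * m) (u * n) z t * m' + grad_y p (u * m) (u * n) z t * n')
    - m' * (grad_x p (u * m) (u * n) z t * m + grad_y p (u * m) (u * n) z t * n)); first by ring.
  by rewrite dir dir'; ring.
- transitivity (u * (conz p m n * u + 2 * conzz p m n * z + conzt p m n * t)); last by rewrite k2 mulr0.
  by case: (p) => b0 c d e f; rewrite /grad_z /conz /conzz /conzt; ring.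
transitivity (u * (cont p m n * u + conzt p m n * z + 2 * contt p m n * t)); last by rewrite k3 mulr0.
by case: (p) => b0 c d e f; rewrite /grad_t /cont /contt /conzt; ring.
Qed.

(** On the line, the gradient is z times one linear form and t times another. A common zero has t =
    0, or z = 0, or makes the determinant of the two forms vanish; these are the three factors, the
    determinant being 2 c^2 times the middle one. *)
Lemma singular_on_line (p : params K) z t : pc p != 0 -> ((z != 0) || (t != 0)) ->
  (let: Params b c d e f := p in
   (- c ^+ 2 - c * d + e * f) * (b * c - c * d + 2 * e * f) * (b * c - c ^+ 2 + e * f)) != 0 ->
  grad_x p 0 0 z t = 0 -> grad_y p 0 0 z t = 0 -> False.
Proof.
case: p => b c d e f /= c0 nz; rewrite !mulf_eq0 !negb_or => /andP[/andP[f1 f2] f3] gx gy.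
have {}gx : z * ((c ^+ 2 + c * d - e * f) * z + (b * c + c ^+ 2 + e * f) * t) = 0.
  by rewrite -[RHS]gx /grad_x /=; ring.
have {}gy : t * ((c * d - c ^+ 2 - e * f) * z + (b * c - c ^+ 2 + e * f) * t) = 0.
  by rewrite -[RHS]gy /grad_y /=; ring.
have [z0|z0] := eqVneq z 0.
  move: nz gy; rewrite z0 eqxx mulr0 add0r /= => t0 /eqP.
  by rewrite !mulf_eq0 (negPf t0) (negPf f3).
have [t0|t0] := eqVneq t 0.
  case/negP: f1; apply/eqP; apply: (mulfI z0); apply: (mulfI z0); apply: oppr_inj.
  by rewrite !mulr0 oppr0 -[RHS]gx t0; ring.
move: gx gy => /eqP + /eqP; rewrite mulf_eq0 mulf_eq0 (negPf z0) (negPf t0) => /eqP gx /eqP gy.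
have /eqP : 2 * c ^+ 2 * (b * c - c * d + 2 * e * f) * z = 0.
  transitivity ((b * c - c ^+ 2 + e * f) * ((c ^+ 2 + c * d - e * f) * z + (b * c + c ^+ 2 + e * f) * t)
    - (b * c + c ^+ 2 + e * f) * ((c * d - c ^+ 2 - e * f) * z + (b * c - c ^+ 2 + e * f) * t)); first by ring.
  by rewrite gx gy; ring.
by rewrite !mulf_eq0 (negPf n2) (negPf c0) (negPf f2) (negPf z0).
Qed.

Lemma singular_Sigma0 (p : params K) : pc p != 0 -> singular (cubicS p) <-> Sigma0 p = 0.
Proof.
move=> c0; have S0 := Sigma0_five_lines p.
case lE : (line_coefs p) => [[[a b] a'] b'].
move: S0 (@singular_off_line p) (@singular_on_line p) (@double_line_singular p) (singular_cubicS p) => S0 off on dl sc.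
case: p => b0 c d e f in c0 lE S0 off on dl sc *; rewrite lE in S0; rewrite S0 {S0}.
have sing_at z t : (z != 0) || (t != 0) -> grad_x (Params b0 c d e f) 0 0 z t = 0 ->
    grad_y (Params b0 c d e f) 0 0 z t = 0 -> singular (cubicS (Params b0 c d e f)).
  move=> nz gx gy; apply/sc; exists 0, 0, z, t; rewrite eqxx /=; split=> //.
    by rewrite /grad_z /=; ring.
  by rewrite /grad_t /=; ring.
split=> [/sc[x [y [z [t [nz gx gy gz gt]]]]]|/eqP].
  apply/eqP; rewrite oppr_eq0 mulf_eq0; have [//|D] := eqVneq (five_lines_disc a b a' b') 0.
  apply/negPn/negP => nz'; have [xy|] := boolP ((x != 0) || (y != 0)).
    have := off _ _ _ _ _ _ _ _ lE xy gx gy gz gt => dL.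
    by case/eqP: D; apply/five_lines_double; exists x, y.
  rewrite negb_or !negbK => /andP[/eqP x0 /eqP y0]; move: nz gx gy; rewrite x0 y0 eqxx /= => nz gx gy.
  by apply: (on z t c0 nz _ gx gy).
rewrite oppr_eq0 mulf_eq0 => /orP[/eqP/five_lines_double[m [n mn]]|]; first exact: dl lE mn.
rewrite !mulf_eq0 => /orP[/orP[]|] /eqP h.
- apply: (sing_at 1 0); first by rewrite oner_eq0.
    by apply: oppr_inj; rewrite oppr0 -[RHS]h /grad_x /=; ring.
  by rewrite /grad_y /=; ring.
- apply: (sing_at 1 (-1)); first by rewrite oner_eq0.
    by apply: oppr_inj; rewrite oppr0 -[RHS]h /grad_x /=; ring.
  by rewrite -[RHS]h /grad_y /=; ring.
apply: (sing_at 0 1); first by rewrite oner_eq0 orbT.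
  by rewrite /grad_x /=; ring.
by rewrite -[RHS]h /grad_y /=; ring.
Qed.

End SingularMembers.

(** * Classification of the smooth surfaces and conclusion *)

Lemma smooth_classified (K : closedFieldType) (charK : [pchar K] =i pred0) (s3 s5 : K)
    (hs3 : s3 ^+ 2 = - 3) (hs5 : s5 ^+ 2 = 5) (a : triform K) (smooth : ~ sing a) :
  Se_classified a s3 s5.
Proof.
have n2 : (2 : K) != 0 := natS_neq0 charK 1.
have [[P [Q [EP EQ PQ]]]|comm] := classic (exists P Q, [/\ Eck a P, Eck a Q & a P P Q != 0]).
  (* Here (s3 - 1) / 2 is the primitive cube root of 1 called [om] above. *)
  have s3E : s3 = 2 * ((s3 - 1) / 2) + 1 by field.
  exact: (noncommuting_classified charK smooth hs3 hs5 s3E EP EQ PQ).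
have [|s [p [s2 Es c1 Hp]]] := few_Eckardt charK smooth s3 s5.
  by move=> P Q EP EQ; apply/eqP/negPn/negP => PQ; apply: comm; exists P, Q.
exists s; split=> //; first by case: (size s) s2 => [|[|[|]]].
exists p => //; case: p c1 {Hp} => b c d e f /= c1.
by case: (size s) s2 => [|[|[|//]]] _; split; rewrite //= c1 oner_neq0.
Qed.

Theorem theorem3p12 (K : closedFieldType) (charK : [pchar K] =i pred0)
    (s3 s5 : K) (hs3 : s3 ^+ 2 = - 3) (hs5 : s5 ^+ 2 = 5) :
  [/\ forall F : {mpoly K[4]}, smooth_cubic F ->
        exists2 n, n \in Eckardt_numbers & num_Eckardt_points F n,
      forall (F : {mpoly K[4]}) (n : nat), n \in Eckardt_numbers ->
        smooth_cubic F -> num_Eckardt_points F n ->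
        exists2 p : params K, admissible s3 s5 n p &
          proj_equiv F (Se s3 s5 n p)
    & forall (n : nat) (p : params K), n \in Eckardt_numbers ->
        admissible s3 s5 n p ->
        (singular (Se s3 s5 n p) <-> Sigma s3 s5 n p = 0)].
Proof.
have classify (F : {mpoly K[4]}) : smooth_cubic F -> exists2 a : triform K, polarizes F a &
    ~ sing a /\ Se_classified a s3 s5.
  move=> [[_ hF] nF]; have [a Fa] := triform_of_homog charK hF; exists a => //.
  have smooth : ~ sing a by move/(singular_sing charK Fa).
  by split=> //; apply: smooth_classified.
split=> [F /classify[a Fa [smooth [s [ns Es _]]]]|F n _ /classify[a Fa [smooth [s [_ Es [p adm Hp]]]]] Fn|n p _ [c0 _]].
- by exists (size s) => //; apply: num_Eckardt_of_list Es.
- have nE := num_Eckardt_points_unique Fn (num_Eckardt_of_list charK Fa smooth Es).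
  by rewrite nE; exists p => //; apply: (has_form_equiv Fa Hp).
exact: singular_Sigma0.
Qed.
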